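(* Let $\tau>0$, $\gamma>1$, $p(\rho)=\rho^\gamma$, $R>0$, $\overline{\rho}=1$. Let $(\rho_0,S_0)\in C^1(\mathbb{R})$ with $(\rho_0-1,S_0)\in H^2(\mathbb{R})$. Suppose $\rho_0(x)>0$ for all $x\in\mathbb{R}$, $\operatorname{supp}(\rho_0-1,S_0)\subset(-R,R)$, and $$\int_{\mathbb{R}}(\rho_0(x)-1)\,dx\ge 0.$$ Set $\sigma:=\sqrt{\gamma+\tau^{-1}}$. Let $\tilde\sigma,L>0$ be such that $$\tilde\sigma^2=\max\{\sigma^2,(8\max\rho_0)^{-1}\}$$ and $$\frac{L}{2}\min\rho_0>\max\{\sqrt{8\max\rho_0},\,16\,\tilde\sigma\max\rho_0\}.$$ Define $$H_0:=\int_{\mathbb{R}}\left(\frac{p(\rho_0(x))-1-\gamma(\rho_0(x)-1)}{\gamma-1}+\frac{\tau\rho_0(x)S_0^2(x)}{2}\right)dx$$ and let $M\ge\max\{4,R\}$ be such that $$H_0+\max\rho_0\,L^2M\le 2\tilde\sigma M^2\max\rho_0.$$ Let $(\rho,u,S)$ be the solution of the system $$\rho_t+(\rho u)_x=0,\qquad \rho u_t+\rho u u_x+p(\rho)_x=S_x,\qquad \tau\rho(S_t+uS_x)-u_x=-S$$ with initial data $(\rho(0),u(0),S(0))=(\rho_0,u_{L,M},S_0)$ and maximal time of existence $T>0$, where $u_{L,M}$ and the maximal time of existence are as defined in the context. Then $T$ is finite, and, with $u_0:=u_{L,M}$, $$\int_{\mathbb{R}}x\,\rho_0(x)u_0(x)\,dx>\max\{16\,\tilde\sigma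 M^2\max\rho_0,\;M^2\sqrt{8\max\rho_0}\}.$$
   Context: Here $\max\rho_0$ and $\min\rho_0$ denote the maximum and minimum of $\rho_0$ over $\mathbb{R}$. For $L>0$ and $M>2$ the function $u_{L,M}:\mathbb{R}\to\mathbb{R}$ (an element of $H^2(\mathbb{R})\cap C^1(\mathbb{R})$) is defined by $$u_{L,M}(x):=\begin{cases}0,& x\in(-\infty,-M],\\ \tfrac L2\cos(\pi(x+M))-\tfrac L2,& x\in(-M,-M+1],\\ -L,& x\in(-M+1,-1],\\ L\cos(\tfrac{\pi}{2}(x-1)),& x\in(-1,1],\\ L,& x\in(1,M-1],\\ \tfrac L2\cos(\pi(x-M+1))+\tfrac L2,& x\in(M-1,M],\\ 0,& x\in(M,\infty).\end{cases}$$ Solutions and maximal time of existence: for $\overline\rho>0$ and initial data $(\rho_0,u_0,S_0):\mathbb{R}\to\mathbb{R}^3$ with $(\rho_0-\overline\rho,u_0,S_0)\in H^2(\mathbb{R})$ and $\rho_0>0$ on $\mathbb{R}$, there is (by the standard local existence theory for symmetrizable hyperbolic systems) a maximal $T\in(0,\infty]$ such that there is a unique solution $(\rho,u,S)$ of the system on $[0,T)\times\mathbb{R}$ with $$(\rho-\overline\rho,u,S)\in C^0([0,T),H^2(\mathbb{R}))\cap C^1([0,T),H^1(\mathbb{R})),$$ $(\rho(0),u(0),S(0))=(\rho_0,u_0,S_0)$, and $\rho(t,x)>0$ for all $(t,x)\in[0,T)\times\mathbb{R}$. This $T$ is the maximal time of existence; in the theorem it is taken with $\overline\rho=1$. *)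

(* Defs.v *)
From HB Require Import structures.
From mathcomp Require Import all_boot all_order all_algebra.
From mathcomp Require Import all_classical all_reals all_analysis.

Set Implicit Arguments.
Unset Strict Implicit.
Unset Printing Implicit Defensive.
Import Order.TTheory GRing.Theory Num.Theory.
Import numFieldNormedType.Exports.

Local Open Scope classical_set_scope.
Local Open Scope ring_scope.

Notation leb R := (@lebesgue_measure R).

Definition is_max (R : realType) (A : set R) (m : R) : Prop :=
  A m /\ ubound A m.

Definition is_min (R : realType) (A : set R) (m : R) : Prop :=
  A m /\ lbound A m.

Definition C1 (R : realType) (f : R -> R) : Prop :=
  (forall x, derivable f x 1) /\ continuous (derive1 f).

Definition smooth (R : realType) (f : R -> R) : Prop :=
  forall n x, derivable (derive1n n f) x 1.

Definition supp (R : realType) (V : zmodType) (f : R -> V) : set R :=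
  closure [set x | f x != 0].

(** * Sobolev spaces [H^k] on the real line *)

Definition weak_derivative (R : realType) (f g : R -> R) : Prop :=
  [/\ locally_integrable setT f, locally_integrable setT g &
      forall phi : R -> R, smooth phi -> compact (supp phi) ->
        \int[leb R]_x (f x * derive1 phi x) = - \int[leb R]_x (g x * phi x)].

Fixpoint in_H (R : realType) (k : nat) (f : R -> R) : Prop :=
  f \in Lfun (leb R) 2%:E /\
  if k is k'.+1 then exists g, weak_derivative f g /\ in_H k' g else True.

(* A weak derivative of [f], unique up to a null set; the default value [0]
   only occurs if [f] has none. *)
Definition wderiv (R : realType) (f : R -> R) : R -> R :=
  xget (fun=> 0) [set g | weak_derivative f g].

(* Meaningful for [f] in [H^k] only: [fine] sends an infinite norm to [0]. *)
Definition Hnorm (R : realType) (k : nat) (f : R -> R) : R :=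
  Num.sqrt (\sum_(i < k.+1)
    fine ('N[leb R]_2%:E[EFin \o iter i (@wderiv R) f])%E ^+ 2).

(** * Curves [0, T) -> H^k *)

Definition time_itv (R : realType) (T : \bar R) : set R :=
  [set t | 0 <= t /\ (t%:E < T)%E].

Definition C0_H (R : realType) (T : \bar R) (k : nat) (U : R -> R -> R) :
    Prop :=
  forall t, time_itv T t ->
    in_H k (U t) /\
    Hnorm k (fun x => U s x - U t x) @[s --> within (time_itv T) (nbhs t)]
      --> (0 : R).

(* [U] is in [C^1([0, T), H^k)], with derivative [dU]; at [t = 0] the
   derivative is one-sided. *)
Definition C1_H (R : realType) (T : \bar R) (k : nat) (U dU : R -> R -> R) :
    Prop :=
  [/\ C0_H T k U, C0_H T k dU &
      forall t, time_itv T t ->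
        Hnorm k (fun x => (s - t)^-1 * (U s x - U t x) - dU t x)
          @[s --> within (time_itv T) t^'] --> (0 : R)].

(** * The Cauchy problem *)

(* [rho t], [u t], [S t] are the continuous representatives of their classes,
   hence (in [H^2]) continuously differentiable, so that the space derivatives
   below are classical ones. The time derivatives are those of curves in
   [H^1], which are only determined up to null sets; this is why the equations
   are required at every time [t], including [t = 0], for almost every [x]. *)
Definition is_solution (R : realType) (p : R -> R) (tau rhobar : R)
    (rho0 u0 S0 : R -> R) (T : \bar R) (rho u S : R -> R -> R) : Prop :=
  [/\ [/\ C0_H T 2 (fun t x => rho t x - rhobar), C0_H T 2 u & C0_H T 2 S],
      (forall t, time_itv T t ->
        [/\ continuous (rho t), continuous (u t) & continuous (S t)]),
      [/\ rho 0 =1 rho0, u 0 =1 u0 & S 0 =1 S0],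
      (forall t x, time_itv T t -> 0 < rho t x) &
      exists rho_t u_t S_t : R -> R -> R,
        [/\ C1_H T 1 (fun t x => rho t x - rhobar) rho_t,
            C1_H T 1 u u_t, C1_H T 1 S S_t &
            forall t, time_itv T t -> {ae leb R, forall x,
              [/\ rho_t t x + derive1 (fun y => rho t y * u t y) x = 0,
                  rho t x * u_t t x + rho t x * u t x * derive1 (u t) x
                    + derive1 (fun y => p (rho t y)) x = derive1 (S t) x &
                  tau * rho t x * (S_t t x + u t x * derive1 (S t) x)
                    - derive1 (u t) x = - S t x]}]].

Definition uniquely_solvable (R : realType) (p : R -> R) (tau rhobar : R)
    (rho0 u0 S0 : R -> R) (T : \bar R) : Prop :=
  (exists rho u S, is_solution p tau rhobar rho0 u0 S0 T rho u S) /\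
  (forall rho u S rho' u' S',
    is_solution p tau rhobar rho0 u0 S0 T rho u S ->
    is_solution p tau rhobar rho0 u0 S0 T rho' u' S' ->
    forall t x, time_itv T t ->
      [/\ rho t x = rho' t x, u t x = u' t x & S t x = S' t x]).

Definition is_maximal_time (R : realType) (p : R -> R) (tau rhobar : R)
    (rho0 u0 S0 : R -> R) (T : \bar R) : Prop :=
  [/\ (0 < T)%E, uniquely_solvable p tau rhobar rho0 u0 S0 T &
      forall T', (0 < T')%E ->
        uniquely_solvable p tau rhobar rho0 u0 S0 T' -> (T' <= T)%E].

(** * Data of the theorem *)

Definition u_LM (R : realType) (L M : R) (x : R) : R :=
  if x <= - M then 0
  else if x <= - M + 1 then L / 2 * cos (pi * (x + M)) - L / 2
  else if x <= -1 then - L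
  else if x <= 1 then L * cos (pi / 2 * (x - 1))
  else if x <= M - 1 then L
  else if x <= M then L / 2 * cos (pi * (x - M + 1)) + L / 2
  else 0.

Definition H_zero (R : realType) (p : R -> R) (gamma tau : R)
    (rho0 S0 : R -> R) : R :=
  \int[leb R]_x ((p (rho0 x) - 1 - gamma * (rho0 x - 1)) / (gamma - 1)
                 + tau * rho0 x * S0 x ^+ 2 / 2).

(* Main.v *)
Require Import Defs.
From HB Require Import structures.
From mathcomp Require Import all_boot all_order all_algebra.
From mathcomp Require Import all_classical all_reals all_analysis.
From mathcomp Require Import measurable_realfun ring lra.
Import Order.TTheory GRing.Theory Num.Theory.
Import numFieldNormedType.Exports.
Set Implicit Arguments.
Unset Strict Implicit.
Unset Printing Implicit Defensive.
Local Open Scope classical_set_scope.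
Local Open Scope ring_scope.

(* Suppose the solution is global. By Sobolev embedding it is classical. The energy
   [E], whose density is the relative entropy plus kinetic plus stress energy, satisfies
   [E' = - \int S^2], and a localized version of this identity shows that the perturbation
   of the rest state [(1, 0, 0)] stays in [[- y t, y t]], where [y t = M + c t] and
   [c = 3/2 sigmat]. The moment [F = \int x rho u] satisfies
   [F' = \int (rho u^2 + rho^gamma - 1 - S)]. Conservation of mass and convexity of
   [rho^gamma] make the pressure contribution nonnegative, Cauchy-Schwarz bounds
   [\int rho u^2] below by [F^2 / \int x^2 rho], and the stress is absorbed by the
   dissipation of [E]. So a corrected moment [K <= F] satisfies
   [K' >= K^2 / (2 rmax y^3)], and its initial value is too large for it to survive
   until [y = 2 M]. The required size of the initial moment comes from the plateaus of
   [u_LM], where [x u_LM = L |x|]. *)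

(** * Real calculus and smooth bump functions *)

Section Calculus.
Variable R : realType.
Implicit Types (f g : R -> R) (x d e : R).

Lemma is_derive1_littleoP f x d : is_derive x 1 f d <->
  forall e, 0 < e -> exists2 r : R, 0 < r & forall h : R, `|h| < r ->
    `|f (x + h) - f x - h * d| <= e * `|h|.
Proof.
split=> [[df <-] e e0|H].
  have : h^-1 * (f (x + h) - f x) @[h --> 0^'] --> 'D_1 f x.
    move/cvg_ex : df => [l fl].
    have -> : 'D_1 f x = l by exact/cvg_lim.
    apply: cvg_trans fl; apply: near_eq_cvg; near=> h => /=.
    by rewrite [h%:A]mulr1 [x + h]addrC.
  move=> /cvgrPdist_le /(_ e e0) [r /= r0 Hr].
  exists r => // h hr; have [->|h0] := eqVneq h 0.
    by rewrite addr0 mul0r !subrr !normr0 mulr0.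
  have := Hr h; rewrite /ball_/= sub0r normrN => /(_ hr h0).
  rewrite distrC -(ler_pM2r (x := `|h|)) ?normr_gt0// -normrM.
  by rewrite mulrBl (mulrAC h^-1) mulVf// mul1r (mulrC _ h).
have cf : h^-1 *: (f (h *: (1 : R) + x) - f x) @[h --> 0^'] --> d.
  apply/cvgrPdist_le => e /H[r r0 Hr]; exists r => //= h.
  rewrite /ball_/= sub0r normrN => hr h0; have H1 := Hr h hr.
  rewrite distrC -(ler_pM2r (x := `|h|)) ?normr_gt0// -normrM.
  by rewrite [h%:A]mulr1 (addrC h) mulrBl [_ *: _]mulrC divfK// (mulrC d).
split; first by apply/cvg_ex; exists d.
exact/cvg_lim.
Unshelve. all: by end_near. Qed.

Lemma der_cst (c : R) x : is_derive x 1 (fun=> c) 0.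
Proof. exact: is_derive_cst. Qed.

Lemma der_id x : is_derive x 1 (fun y : R => y) 1.
Proof. exact: is_derive_id. Qed.

Section PointwiseRules.
Variables (f g : R -> R) (x a b : R).

Lemma derD : is_derive x 1 f a -> is_derive x 1 g b ->
  is_derive x 1 (fun y => f y + g y) (a + b).
Proof. by move=> df dg; exact: is_deriveD. Qed.

Lemma derB : is_derive x 1 f a -> is_derive x 1 g b ->
  is_derive x 1 (fun y => f y - g y) (a - b).
Proof. by move=> df dg; exact: is_deriveB. Qed.

Lemma derN : is_derive x 1 f a -> is_derive x 1 (fun y => - f y) (- a).
Proof. by move=> df; exact: is_deriveN. Qed.

Lemma derM : is_derive x 1 f a -> is_derive x 1 g b ->
  is_derive x 1 (fun y => f y * g y) (a * g x + f x * b).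
Proof.
by move=> df dg; rewrite mulrC addrC; exact: is_deriveM.
Qed.

Lemma derZ (k : R) : is_derive x 1 f a ->
  is_derive x 1 (fun y => k * f y) (k * a).
Proof. by move=> df; exact: is_deriveZ. Qed.

Lemma derX n : is_derive x 1 f a ->
  is_derive x 1 (fun y => f y ^+ n) (n%:R * f x ^+ n.-1 * a).
Proof.
move=> df; have := is_deriveX n df.
by congr is_derive; apply/funext => y; rewrite fctE.
Qed.

Lemma derV : is_derive x 1 f a -> f x != 0 ->
  is_derive x 1 (fun y => (f y)^-1) (- (f x) ^- 2 * a).
Proof. by move=> df fx; exact: is_deriveV. Qed.

Lemma dercomp : is_derive x 1 g b -> is_derive (g x) 1 f a ->
  is_derive x 1 (fun y => f (g y)) (a * b).
Proof. by move=> dg df; exact: is_derive1_comp. Qed.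

Lemma der_eq : is_derive x 1 f a -> a = b -> is_derive x 1 f b.
Proof. by move=> ? <-. Qed.

Lemma der_ext : is_derive x 1 f a -> f =1 g -> is_derive x 1 g a.
Proof. by move=> df /funext <-. Qed.

End PointwiseRules.

(* Functions of this form are closed under differentiation, whence the smoothness of
   the standard bump [bumpP 1 0]. *)
Definition bumpP (P : {poly R}) (k : nat) (x : R) : R :=
  if `|x| < 1 then P.[x] * (1 - x ^+ 2)^-1 ^+ k * expR (- (1 - x ^+ 2)^-1)
  else 0.

Lemma sqr_lt1 x : `|x| < 1 -> 0 < 1 - x ^+ 2.
Proof. by move=> x1; rewrite subr_gt0 -real_normK ?num_real// expr_lt1. Qed.

Lemma bumpP_le P k : exists2 C : R, 0 <= C &
  forall x, `|bumpP P k x| <= C * (1 - x ^+ 2) ^+ 2.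
Proof.
exists ((\sum_(i < size P) `|P`_i|) * (k.+2)`!%:R).
  by rewrite mulr_ge0// sumr_ge0.
move=> x; rewrite /bumpP; case: ifPn => x1; last first.
  by rewrite normr0; apply: mulr_ge0; [rewrite mulr_ge0// sumr_ge0|exact: sqr_ge0].
have y0 := sqr_lt1 x1; set y := 1 - x ^+ 2 in y0 *.
have yi0 : 0 < y^-1 by rewrite invr_gt0.
rewrite !normrM -!mulrA ler_pM ?mulr_ge0//.
  rewrite horner_coef (le_trans (ler_norm_sum _ _ _))// ler_sum// => i _.
  by rewrite normrM normrX ler_piMr// exprn_ile1// ltW.
rewrite !ger0_norm ?expR_ge0 ?exprn_ge0 ?(ltW yi0)// expRN.
have := expR_ge1Dxn k.+1 (ltW yi0) => e1.
have f0 : 0 < (k.+2)`!%:R :> R by rewrite ltr0n fact_gt0.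
have e2 : y^-1 ^+ k.+2 / (k.+2)`!%:R <= expR y^-1.
  by apply: le_trans e1; rewrite lerDr.
rewrite ler_pdivrMr ?expR_gt0//.
apply: le_trans (_ : _ <= (k.+2)`!%:R * y ^+ 2 * (y^-1 ^+ k.+2 / (k.+2)`!%:R)) _; last first.
  by rewrite ler_wpM2l// mulr_ge0 ?sqr_ge0.
rewrite le_eqVlt; apply/orP; left; apply/eqP.
rewrite -[in RHS]addn2 exprD.
by field; rewrite !gt_eqF ?exprn_gt0.
Qed.

Lemma is_derive_horner (P : {poly R}) x :
  is_derive x 1 (fun y => P.[y]) P^`().[x].
Proof.
elim/poly_ind: P => [|P c ih].
  rewrite derivC; under [X in is_derive _ _ X]eq_fun do rewrite horner0.
  by rewrite horner0; exact: is_derive_cst.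
rewrite derivD derivC addr0 derivM derivX mulr1 !hornerE.
under [X in is_derive _ _ X]eq_fun do rewrite !hornerE.
apply: der_eq (derD (derM ih (der_id x)) (der_cst c x)) _.
by rewrite addr0 mulr1.
Qed.

Definition bumpP_deriv (P : {poly R}) (k : nat) : {poly R} :=
  P^`() * (1 - 'X^2) ^+ 2 + (k%:R *+ 2) *: ('X * P * (1 - 'X^2)) - 2 *: ('X * P).

Lemma is_derive_bumpP P k x :
  is_derive x 1 (bumpP P k) (bumpP (bumpP_deriv P k) k.+2 x).
Proof.
have [x1|x1] := ltP `|x| 1.
  have y0 := sqr_lt1 x1.
  apply: (@near_eq_is_derive _ _ _
    (fun x => P.[x] * (1 - x ^+ 2)^-1 ^+ k * expR (- (1 - x ^+ 2)^-1))).
    have : \forall z \near (x : R^o), `|z| < 1.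
      exact: (@cvgr_norm_lt R R _ (nbhs x) _ id x _ 1 x1).
    by apply: filterS => z z1; rewrite /bumpP z1.
  have Dy : is_derive x 1 (fun x : R => 1 - x ^+ 2) (- (2 * x)).
    apply: der_eq (derB (der_cst 1 x) (derX 2 (der_id x))) _.
    by rewrite sub0r /= mulr1 expr1.
  have Dv := derV Dy (lt0r_neq0 y0).
  have De := dercomp (derN Dv) (is_derive_expR _).
  have Dk := derX k Dv.
  apply: der_eq (derM (derM (is_derive_horner P x) Dk) De) _.
  rewrite /bumpP x1 /bumpP_deriv (exprS _ k.+1) (exprS _ k) !hornerE/=.
  have y0' := lt0r_neq0 y0.
  set E := expR _; set v := (1 - x ^+ 2)^-1.
  have -> : (1 - x ^+ 2) ^- 2 = v ^+ 2 by rewrite exprVn.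
  have vy : v * (1 - x ^+ 2) = 1 by rewrite mulVf.
  have vk : k%:R * v ^+ k.-1 * v = k%:R * v ^+ k.
    by case: (k) => [|n]; rewrite ?mul0r//= -mulrA -exprSr.
  rewrite mulr2n.
  set w := 1 - x ^+ 2 in vy *.
  set p := P.[x]; set p' := P^`().[x].
  transitivity ((p' * v ^+ k + p * (k%:R * v ^+ k.-1 * v) * v * (2 * x)
    - p * v ^+ k * v ^+ 2 * (2 * x)) * E); first by ring.
  rewrite vk; transitivity ((p' * (v * w) ^+ 2 + (k%:R + k%:R) * x * p * (v * w) * v
    - 2 * x * p * v ^+ 2) * v ^+ k * E); last by ring.
  by rewrite vy; ring.
have fx0 Q l : bumpP Q l x = 0 by rewrite /bumpP ltNge x1.
rewrite fx0; apply/is_derive1_littleoP => e e0.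
have [C C0 bC] := bumpP_le P k.
pose c := C * (2 * `|x| + 1) ^+ 2 + 1.
have c0 : 0 < c by rewrite ltr_wpDl// mulr_ge0// sqr_ge0.
exists (Num.min 1 (e / c)); first by rewrite lt_min ltr01 divr_gt0.
move=> h; rewrite lt_min => /andP[h1 he]; rewrite fx0 mulr0 !subr0.
have [xh1|xh1] := ltP `|x + h| 1; last first.
  by rewrite /bumpP ltNge xh1/= normr0 mulr_ge0// ltW.
apply: le_trans (bC _) _.
have y0 := sqr_lt1 xh1.
have yh : 1 - (x + h) ^+ 2 <= `|h| * (2 * `|x| + 1).
  apply: le_trans (_ : `|h| * `|- (2 * x + h)| <= _).
    rewrite -normrM; apply: le_trans (ler_norm _).
    have : 1 <= x ^+ 2 by rewrite -real_normK ?num_real// expr_ge1.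
    lra.
  rewrite ler_wpM2l// normrN (le_trans (ler_normD _ _))// lerD ?(ltW h1)//.
  by rewrite normrM ger0_norm.
apply: le_trans (_ : C * (`|h| * (2 * `|x| + 1)) ^+ 2 <= _).
  by rewrite ler_wpM2l// ler_sqr ?nnegrE ?(ltW y0)// (le_trans (ltW y0)).
rewrite exprMn mulrCA mulrC expr2 mulrA ler_wpM2r//.
apply: le_trans (_ : c * `|h| <= _).
  by rewrite ler_wpM2r// /c lerDl.
by rewrite mulrC -ler_pdivlMr// ltW.
Qed.
End Calculus.

Section Smooth.
Variable R : realType.
Implicit Types (f g : R -> R).

Lemma smooth_coind (P : (R -> R) -> Prop) :
  (forall f, P f -> (forall x, derivable f x 1) /\ P (derive1 f)) ->
  forall f, P f -> smooth f.
Proof.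
move=> H f Pf n.
suff : P (derive1n n f) by move=> /H[].
by elim: n => [//|n ih]; rewrite derive1nS; exact: (H _ ih).2.
Qed.

Lemma derive1_is_derive f (df : R -> R) : (forall x : R, is_derive x 1 f (df x)) ->
  derive1 f = df.
Proof. by move=> H; apply/funext => x; rewrite derive1E; exact: (@derive_val _ _ _ _ _ _ _ (H x)). Qed.

Lemma smooth_bumpP (P : {poly R}) k : smooth (bumpP P k).
Proof.
apply: (smooth_coind (P := fun f => exists P k, f = bumpP P k)); last by exists P, k.
move=> _ [{}P [{}k ->]]; split=> [x|]; first by have := is_derive_bumpP P k x; case.
exists (bumpP_deriv P k), k.+2.
exact: (derive1_is_derive (is_derive_bumpP P k)).
Qed.

End Smooth.

Section IntervalIntegral.
Variable R : realType.
Implicit Types (f g phi : R -> R) (a b c x : R).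
Local Notation mu := (leb R).

Lemma der_continuous f (df : R -> R) :
  (forall x : R, is_derive x 1 f (df x)) -> continuous f.
Proof.
by move=> H x; apply/differentiable_continuous/derivable1_diffP; have [] := H x.
Qed.

Lemma cont_measurable f (D : set R) : measurable D -> continuous f ->
  measurable_fun D f.
Proof. by move=> mD cf; apply: subspace_continuous_measurable_fun => //; exact: continuous_subspaceT. Qed.

Lemma cont_integrable a b f : continuous f ->
  mu.-integrable `[a, b] (EFin \o f).
Proof.
move=> cf; apply: continuous_compact_integrable; first exact: segment_compact.
exact: continuous_subspaceT.
Qed.

Lemma locint_integrable a b f : locally_integrable setT f ->
  mu.-integrable `[a, b] (EFin \o f).
Proof.
move=> [mf _ fi]; apply/integrableP; split.
  by apply/measurable_EFinP; exact: measurable_funTS.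
by apply: fi => //; exact: segment_compact.
Qed.

Lemma locint_cont f : continuous f -> locally_integrable setT f.
Proof.
move=> cf; split => //; [exact: cont_measurable|exact: openT|].
move=> K _ cK; have := @continuous_compact_integrable _ f K cK.
by move/(_ (continuous_subspaceT cf)) => /integrableP[].
Qed.

Lemma Rintegral_support a b f : (forall x, x \notin `[a, b] -> f x = 0) ->
  \int[mu]_x f x = \int[mu]_(x in `[a, b]) f x.
Proof.
move=> H; rewrite [RHS]Rintegral_mkcond; congr (Rintegral _ _ _).
apply/funext => x; rewrite patchE; case: ifPn => // xab.
by apply: H; apply: contra xab => xab; rewrite inE.
Qed.

Lemma integrable_support a b f : (forall x, x \notin `[a, b] -> f x = 0) ->
  mu.-integrable `[a, b] (EFin \o f) -> mu.-integrable setT (EFin \o f).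
Proof.
move=> H fi; have mab : measurable (`[a, b]%classic : set R) by exact: measurable_itv.
have := (@integrable_mkcond _ _ R mu `[a, b] (EFin \o f) mab).1 fi.
congr (mu.-integrable _ _); apply/funext => x; rewrite patchE.
by case: ifPn => // xab; rewrite /= H//; apply: contra xab => xab; rewrite inE.
Qed.

Lemma Rintegral_chasles a b c f : a <= b -> b <= c ->
  mu.-integrable `[a, c] (EFin \o f) ->
  \int[mu]_(x in `[a, c]) f x =
  \int[mu]_(x in `[a, b]) f x + \int[mu]_(x in `[b, c]) f x.
Proof.
move=> ab bc fi; have /(_ b) := Rintegral_itvB fi.
rewrite !bnd_simp => /(_ ab bc)/eqP.
rewrite subr_eq addrC => /eqP ->; congr (_ + _).
rewrite Rintegral_itv_obnd_cbnd//; apply: integrableS fi => //.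
by apply: subset_itvr; rewrite bnd_simp.
Qed.

Lemma Rintegral_FTC2 a b F f : a <= b -> (forall x, is_derive x 1 F (f x)) ->
  continuous f -> \int[mu]_(x in `[a, b]) f x = F b - F a.
Proof.
rewrite le_eqVlt => /predU1P[<-|ab] dF cf.
  by rewrite set_itv1 Rintegral_set1 subrr.
have cF := der_continuous dF.
rewrite /Rintegral (@continuous_FTC2 _ f F)//.
- exact: continuous_subspaceT.
- split => [x _||]; first by have [] := dF x.
  + exact/cvg_at_right_filter/cF.
  + exact/cvg_at_left_filter/cF.
- by move=> x _; rewrite (derive1_is_derive dF).
Qed.

Lemma Rintegral_itv_cst a b c : a <= b ->
  \int[mu]_(x in `[a, b]) c = c * (b - a).
Proof.
move=> ab; have dF x : is_derive x 1 (fun x => c * x) c.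
  by apply: der_eq (derZ c (der_id x)) (mulr1 c).
by rewrite (Rintegral_FTC2 ab dF (@cst_continuous _ _ c)) mulrBr.
Qed.

Lemma integral_continuous_ge0_eq0 a b f : continuous f ->
  (forall x, a <= x <= b -> 0 <= f x) -> \int[mu]_(x in `[a, b]) f x <= 0 ->
  forall x, a < x < b -> f x = 0.
Proof.
move=> cf f0 fi0 x /andP[ax xb].
have f0x : 0 <= f x by apply: f0; rewrite !ltW.
apply/eqP; rewrite eq_le f0x andbT leNgt; apply/negP => fx0.
have [e /= e0 He] : \forall y \near x, f x / 2 < f y.
  by apply: (cvgr_gt (f x) (cf x)); lra.
pose r := Num.min (e / 2) (Num.min (x - a) (b - x)).
have r0 : 0 < r by rewrite !lt_min divr_gt0// !subr_gt0 ax xb.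
have [re ra rb] : [/\ r <= e / 2, r <= x - a & r <= b - x].
  by rewrite /r; split; rewrite !ge_min lexx ?orbT.
clearbody r.
have fi (u v : R) : mu.-integrable `[u, v] (EFin \o f) by exact: cont_integrable.
have f_ge0 (u v : R) : a <= u -> v <= b -> 0 <= \int[mu]_(y in `[u, v]) f y.
  move=> au vb; apply: Rintegral_ge0 => y /=; rewrite in_itv/= => /andP[uy yv].
  by apply: f0; rewrite (le_trans au uy) (le_trans yv vb).
have : f x / 2 * r <= \int[mu]_(y in `[x, x + r]) f y.
  have -> : f x / 2 * r = \int[mu]_(y in `[x, x + r]) (f x / 2).
    by rewrite Rintegral_itv_cst ?(addrC x) ?addrK// lerDr ltW.
  apply: le_Rintegral => //.
    by apply: cont_integrable; exact: cst_continuous.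
  move=> y /=; rewrite in_itv/= => /andP[xy yr]; apply/ltW/He.
  rewrite /ball_/= ltr_norml; lra.
have h1 : \int[mu]_(y in `[a, b]) f y = \int[mu]_(y in `[a, x]) f y +
   (\int[mu]_(y in `[x, x + r]) f y + \int[mu]_(y in `[x + r, b]) f y).
  by rewrite -!Rintegral_chasles ?lerDl ?(ltW ax) ?(ltW xb) ?(ltW r0)//; lra.
have i1 := f_ge0 a x (lexx _) (ltW xb).
have i2 : 0 <= \int[mu]_(y in `[x + r, b]) f y by apply: f_ge0 => //; rewrite ler_wpDr// ltW.
move=> h2; have : 0 < \int[mu]_(y in `[a, b]) f y.
  rewrite h1 ltr_wpDl// ltr_wpDr//; apply: lt_le_trans h2.
  by rewrite mulr_gt0// divr_gt0.
by rewrite ltNge fi0.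
Qed.

End IntervalIntegral.

Section TestFunctions.
Variable R : realType.
Implicit Types (f g : R -> R) (a b e x : R).
Local Notation mu := (leb R).

Definition bump_mass : R := \int[mu]_(x in `[-1, 1]) bumpP 1 0 x.

Definition mollifier : R -> R := bumpP (bump_mass^-1)%:P 0.

Lemma bumpP1E x : `|x| < 1 ->
  bumpP (1 : {poly R}) 0 x = expR (- (1 - x ^+ 2)^-1).
Proof. by move=> x1; rewrite /bumpP x1 hornerC expr0 !mul1r. Qed.

Lemma bumpP_out (P : {poly R}) k x : 1 <= `|x| -> bumpP P k x = 0.
Proof. by move=> x1; rewrite /bumpP ltNge x1. Qed.

Lemma bumpP_ge0 x : 0 <= bumpP (1 : {poly R}) 0 x.
Proof.
have [x1|x1] := ltP `|x| 1; last by rewrite bumpP_out.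
by rewrite bumpP1E// expR_ge0.
Qed.

Lemma bumpP_continuous (P : {poly R}) k : continuous (bumpP P k).
Proof. exact: der_continuous (is_derive_bumpP P k). Qed.

Lemma bump_mass_gt0 : 0 < bump_mass.
Proof.
rewrite ltNge; apply/negP => m0.
have /(_ 0) := integral_continuous_ge0_eq0 (@bumpP_continuous 1 0)
  (fun x _ => bumpP_ge0 x) m0.
rewrite oppr_lt0 ltr01 => /(_ isT)/eqP.
by rewrite bumpP1E ?normr0// gt_eqF// expR_gt0.
Qed.

Lemma mollifierE x : mollifier x = bump_mass^-1 * bumpP 1 0 x.
Proof.
rewrite /mollifier /bumpP; case: ifP; last by rewrite mulr0.
by rewrite !hornerC mul1r !mulrA.
Qed.

Lemma mollifier_ge0 x : 0 <= mollifier x.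
Proof. by rewrite mollifierE mulr_ge0 ?bumpP_ge0// invr_ge0 ltW// bump_mass_gt0. Qed.

Lemma mollifier_le x : mollifier x <= bump_mass^-1.
Proof.
rewrite mollifierE ler_piMr//; first by rewrite invr_ge0 ltW// bump_mass_gt0.
have [x1|x1] := ltP `|x| 1; last by rewrite bumpP_out// ler01.
rewrite bumpP1E// -[leRHS]expR0 ler_expR oppr_le0 invr_ge0.
exact/ltW/sqr_lt1.
Qed.

Lemma mollifier_out x : 1 <= `|x| -> mollifier x = 0.
Proof. exact: bumpP_out. Qed.

Lemma mollifier_continuous : continuous mollifier.
Proof. exact: bumpP_continuous. Qed.

Lemma smooth_mollifier : smooth mollifier.
Proof. exact: smooth_bumpP. Qed.

Lemma mollifier_integrable : mu.-integrable setT (EFin \o mollifier).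
Proof.
apply: (@integrable_support _ (-1) 1).
  move=> x; rewrite in_itv/= => x1; rewrite mollifier_out// leNgt ltr_norml.
  by apply: contra x1 => /andP[/ltW-> /ltW->].
exact: cont_integrable mollifier_continuous.
Qed.

Definition step x : R := \int[mu]_(t in `]-oo, x]) mollifier t.

Lemma is_derive_step x : is_derive x 1 step (mollifier x).
Proof.
have xx1 : x < x + 1 by rewrite ltrDl.
have fi : mu.-integrable `]-oo, x + 1] (EFin \o mollifier).
  by apply: integrableS mollifier_integrable.
have [d Fx] := continuous_FTC1 xx1 fi (ltNyr _) (@mollifier_continuous x).
have D1 : 'D_1 step x = mollifier x by rewrite -derive1E; exact: Fx.
exact: (DeriveDef d D1).
Qed.

Lemma step_le x : x <= -1 -> step x = 0.
Proof.
move=> x1; rewrite /step /Rintegral integral0_eq// => t /=; rewrite in_itv/= => tx.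
congr EFin; apply: mollifier_out.
by rewrite ler_normr lerNr (le_trans tx x1) orbT.
Qed.

Lemma step_ge x : 1 <= x -> step x = 1.
Proof.
move=> x1.
have step1 : step 1 = 1.
  have i1 : (-1 : R) <= 1 by rewrite (le_trans (lerN10 _)).
  have := @Rintegral_FTC2 _ (-1) 1 _ _ i1 is_derive_step mollifier_continuous.
  rewrite (step_le (lexx _)) subr0 => <-//.
  under eq_Rintegral do rewrite mollifierE.
  rewrite RintegralZl//; last exact: cont_integrable (@bumpP_continuous _ _).
  by rewrite mulVf// gt_eqF// bump_mass_gt0.
have := @Rintegral_FTC2 _ 1 x _ _ x1 is_derive_step mollifier_continuous.
rewrite /Rintegral integral0_eq/=.
  by rewrite step1 => /esym/eqP; rewrite subr_eq0 => /eqP.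
move=> t /=; rewrite in_itv/= => /andP[t1 _]; congr EFin; apply: mollifier_out.
by rewrite ler_normr t1.
Qed.

Lemma step_mono x y : x <= y -> step x <= step y.
Proof.
move=> xy; rewrite -subr_ge0.
rewrite -(@Rintegral_FTC2 _ x y _ _ xy is_derive_step mollifier_continuous).
by apply: Rintegral_ge0 => t _; exact: mollifier_ge0.
Qed.

Lemma step_itv x : 0 <= step x <= 1.
Proof.
apply/andP; split.
  have [x1|x1] := leP x (-1); first by rewrite step_le.
  by rewrite -(step_le (lexx (-1))) step_mono// ltW.
have [x1|x1] := leP 1 x; first by rewrite step_ge.
by rewrite -(step_ge (lexx 1)) step_mono// ltW.
Qed.

Lemma smooth_derive1 f : smooth f -> smooth (derive1 f).
Proof. by move=> sf n x; rewrite -derive1Sn; exact: sf. Qed.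

Lemma smooth_step : smooth step.
Proof.
case=> [|n] x; first by have [] := is_derive_step x.
by rewrite derive1Sn (derive1_is_derive is_derive_step); exact: smooth_mollifier.
Qed.

Definition cutoff (e a b x : R) : R := step ((x - a) / e) - step ((x - b) / e).

Lemma is_derive_scale G dG (c k a x : R) : is_derive ((x - a) / k) 1 G dG ->
  is_derive x 1 (fun x => c * G ((x - a) / k)) (c / k * dG).
Proof.
move=> DG.
have D1 : is_derive x 1 (fun x => (x - a) / k) k^-1.
  have := derM (derB (der_id x) (der_cst a x)) (der_cst k^-1 x).
  by move=> /der_eq; apply; rewrite subr0 mul1r mulr0 addr0.
by apply: der_eq (derZ c (dercomp D1 DG)) _; rewrite (mulrC dG) mulrA.
Qed.

Lemma smooth_is_derive f x : smooth f -> is_derive x 1 f (derive1 f x).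
Proof. by move=> sf; rewrite derive1E; apply: DeriveDef => //; exact: (sf 0%N). Qed.

Lemma smooth_cutoff e a b : smooth (cutoff e a b).
Proof.
apply: (smooth_coind (P := fun f => exists2 Gc, smooth Gc.1 & f = fun x =>
  Gc.2 * Gc.1 ((x - a) / e) - Gc.2 * Gc.1 ((x - b) / e))); last first.
  exists (step, 1); first exact: smooth_step.
  by apply/funext => x; rewrite !mul1r.
move=> _ [[G c] /= sG ->].
have D x : is_derive x 1 (fun x => c * G ((x - a) / e) - c * G ((x - b) / e))
  (c / e * derive1 G ((x - a) / e) - c / e * derive1 G ((x - b) / e)).
  apply: derB; apply: is_derive_scale; exact: smooth_is_derive.
split=> [x|]; first by have [] := D x.
exists (derive1 G, c / e); first exact: smooth_derive1.
exact: derive1_is_derive D.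
Qed.

Lemma derive1_cutoff e a b x : derive1 (cutoff e a b) x =
  e^-1 * mollifier ((x - a) / e) - e^-1 * mollifier ((x - b) / e).
Proof.
have D (y : R) : is_derive y 1 (cutoff e a b)
  (e^-1 * mollifier ((y - a) / e) - e^-1 * mollifier ((y - b) / e)).
  have K c := is_derive_scale 1 (is_derive_step ((y - c) / e)).
  apply: (@der_eq _ _ _ (1 / e * mollifier ((y - a) / e) -
    1 / e * mollifier ((y - b) / e))); last by rewrite mul1r.
  by apply: der_ext (derB (K a) (K b)) _ => z; rewrite !mul1r.
by rewrite (derive1_is_derive D).
Qed.

End TestFunctions.

(** * Weak derivatives and Sobolev regularity *)

Section WeakDerivative.
Variable R : realType.
Implicit Types (f g h : R -> R) (a b e x : R).
Local Notation mu := (leb R).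

Section RealIntegrable.
Variables (D : set R) (mD : measurable D) (f h : R -> R).
Hypothesis fi : mu.-integrable D (EFin \o f).
Hypothesis hi : mu.-integrable D (EFin \o h).

Lemma integrable_scale c : mu.-integrable D (EFin \o (fun x => c * f x)).
Proof. exact: (@integrableZl _ _ _ mu D mD c _ fi). Qed.

Lemma integrable_add : mu.-integrable D (EFin \o (fun x => f x + h x)).
Proof. exact: (@integrableD _ _ _ mu D mD _ _ fi hi). Qed.

Lemma integrable_sub : mu.-integrable D (EFin \o (fun x => f x - h x)).
Proof. exact: (@integrableB _ _ _ mu D mD _ _ fi hi). Qed.

End RealIntegrable.

Lemma itvcc_oo a b f : mu.-integrable `[a, b] (EFin \o f) ->
  \int[mu]_(x in `[a, b]) f x = \int[mu]_(x in `]a, b[) f x.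
Proof.
move=> fi; rewrite Rintegral_itv_bndo_bndc ?Rintegral_itv_obnd_cbnd//.
  by apply: integrableS fi => //; apply: subset_itvr; rewrite bnd_simp.
apply: integrableS fi => //.
by apply: subset_itv; rewrite bnd_simp.
Qed.

Lemma integrable_norm_sub a b c f : locally_integrable setT f ->
  mu.-integrable `[a, b] (EFin \o (fun y => `|f y - c|)).
Proof.
move=> lf; apply/integrable_norm/locint_integrable.
by apply: locally_integrableB => //; apply: locint_cont; exact: cst_continuous.
Qed.

Lemma lebesgue_pt_itv f a e : locally_integrable setT f -> lebesgue_pt f a ->
  0 < e -> exists2 d : R, 0 < d & forall r : R, 0 < r -> r < d ->
    \int[mu]_(y in `[a - r, a + r]) `|f y - f a| <= e * r.
Proof.
move=> lf /fine_cvgP[_ /cvgrPdist_le/(_ (e / 2))] H e0.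
have /H[d /= d0 Hd] : 0 < e / 2 by rewrite divr_gt0.
exists d => // r r0 rd; have := Hd r.
rewrite /ball_/= sub0r normrN gtr0_norm// => /(_ rd r0).
rewrite sub0r normrN /davg /iavg lebesgue_measure_ball ?(ltW r0)//.
rewrite ball_itv.
have fi := integrable_norm_sub (a - r) (a + r) (f a) lf.
rewrite itvcc_oo//.
have fi' : mu.-integrable `]a - r, a + r[ (EFin \o (fun y => `|f y - f a|)).
  by apply: integrableS fi => //; apply: subset_itv; rewrite bnd_simp.
have <- : (\int[mu]_(y in `]a - r, a + r[) `|f y - f a|)%:E =
   (\int[mu]_(y in `](a - r)%R, (a + r)%R[) `|((center (f a) \o f) y)%:E|)%E.
  by rewrite /Rintegral fineK//; exact: integrable_fin_num.
rewrite inver mulrn_eq0/= gt_eqF//= => h; have := le_trans (ler_norm _) h.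
rewrite ler_pdivrMl ?pmulrn_lgt0// => /le_trans; apply.
by have -> : r *+ 2 * (e / 2) = e * r by rewrite mulr2n; field.
Qed.

Lemma integral_norm_small f a e : locally_integrable setT f -> 0 < e ->
  exists2 d : R, 0 < d & forall r : R, 0 < r -> r < d ->
    \int[mu]_(y in `[a - r, a + r]) `|f y| <= e.
Proof.
move=> lf e0; pose A : set R := `[a - 1, a + 1]%classic.
have mA : measurable A by exact: measurable_itv.
have fA : mu.-integrable setT (EFin \o (f \_ A)).
  rewrite -restrict_EFin; apply/integrable_restrict => //=.
  by rewrite setTI; exact: locint_integrable.
have [d [d0 Hd]] := integral_normr_continuous fA e0.
exists (Num.min 1 (d / 4)); first by rewrite lt_min ltr01 divr_gt0.
move=> r r0; rewrite lt_min => /andP[r1 rd].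
have mE : mu `[a - r, a + r] = (2 * r)%:E.
  rewrite lebesgue_measure_itv/= lte_fin ltrD2l gtrN// -EFinB.
  by congr EFin; ring.
have mI : measurable (`[a - r, a + r]%classic : set R) by exact: measurable_itv.
have H : (mu `[(a - r)%R, (a + r)%R] < d%:E)%E by rewrite mE lte_fin; lra.
have := Hd _ mI H; move/ltW; congr (_ <= _); apply: eq_Rintegral => y.
rewrite inE/= in_itv/= => /andP[y1 y2]; rewrite patchE ifT// inE /A/= in_itv/=.
by apply/andP; split; lra.
Qed.

Lemma cutoff_itv e0 a b x : `|cutoff e0 a b x| <= 1.
Proof.
have /andP[s0 s1] := step_itv ((x - a) / e0).
have /andP[t0 t1] := step_itv ((x - b) / e0).
rewrite ler_norml /cutoff; apply/andP; split; lra.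
Qed.

Lemma cutoff_in e a b x : 0 < e -> a + e <= x <= b - e -> cutoff e a b x = 1.
Proof.
move=> e0 /andP[ax xb]; rewrite /cutoff step_ge ?step_le ?subr0//.
  by rewrite ler_pdivrMr// mulN1r; lra.
by rewrite ler_pdivlMr// mul1r; lra.
Qed.

Lemma cutoff_out e a b x : 0 < e -> a <= b -> x \notin `[a - e, b + e] ->
  cutoff e a b x = 0.
Proof.
move=> e0 ab; rewrite in_itv/= negb_and -!ltNge => /orP[xa|xb]; rewrite /cutoff.
  by rewrite !step_le ?subrr// ler_pdivrMr// mulN1r; lra.
by rewrite !step_ge ?subrr// ler_pdivlMr// mul1r; lra.
Qed.

Lemma cutoff_continuous e a b : continuous (cutoff e a b).
Proof. by apply: der_continuous => x; exact/smooth_is_derive/smooth_cutoff. Qed.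

Lemma compact_supp_cutoff e a b : 0 < e -> a <= b -> compact (supp (cutoff e a b)).
Proof.
move=> e0 ab; apply: (@subclosed_compact _ _ `[a - e, b + e]%classic).
- exact: closed_closure.
- exact: segment_compact.
- rewrite [X in _ `<=` X](closure_id _).1; last exact: itv_closed.
  apply: closure_subset => x /=; apply: contra_neqP => /negP xab.
  exact: cutoff_out.
Qed.

Lemma continuous_itv_bounded a b h : continuous h ->
  exists2 N : R, 0 <= N & forall x, a <= x <= b -> `|h x| <= N.
Proof.
move=> ch; have [ab|ba] := leP a b; last first.
  by exists 0 => // x /andP[ax xb]; have := le_trans ax xb; rewrite leNgt ba.
have cn : {within `[a, b], continuous (fun x => `|h x|)}.
  apply: continuous_subspaceT => x.
  by apply: continuous_comp; [exact: ch|exact: norm_continuous].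
have [c _ Hc] := EVT_max ab cn.
by exists `|h c| => // x xab; apply: Hc; rewrite in_itv.
Qed.

Lemma integrableM_cont a b f h : locally_integrable setT f -> continuous h ->
  mu.-integrable `[a, b] (EFin \o (fun x => f x * h x)).
Proof.
move=> lf ch; have fi := locint_integrable a b lf.
apply: (integrableMl _ fi); [exact: measurable_itv|exact: cont_measurable|].
have [N _ hN] := continuous_itv_bounded a b ch.
exists N; split=> [|k Nk x /=]; first exact: num_real.
by rewrite in_itv/= => /hN /le_trans; apply; exact: ltW.
Qed.

Lemma mollifier_scale_continuous e a :
  continuous (fun x => e^-1 * mollifier ((x - a) / e)).
Proof.
apply: (der_continuous (df := fun x => e^-1 / e * derive1 (@mollifier R) ((x - a) / e))).
by move=> x; apply: is_derive_scale; exact/smooth_is_derive/smooth_mollifier.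
Qed.

Lemma mollifier_scale_out e a x : 0 < e -> x \notin `[a - e, a + e] ->
  e^-1 * mollifier ((x - a) / e) = 0.
Proof.
move=> e0; rewrite in_itv/= negb_and -!ltNge => xa.
rewrite mollifier_out ?mulr0// normrM (gtr0_norm (x := e^-1)) ?invr_gt0//.
rewrite ler_pdivlMr// mul1r ler_normr; case/orP: xa => xa; apply/orP.
  by right; lra.
by left; lra.
Qed.

Lemma mollifier_scale_integral e a : 0 < e ->
  \int[mu]_(x in `[a - e, a + e]) (e^-1 * mollifier ((x - a) / e)) = 1.
Proof.
move=> e0; have ae : a - e <= a + e by lra.
have D (x : R) : is_derive x 1 (fun x => 1 * step ((x - a) / e))
    (e^-1 * mollifier ((x - a) / e)).
  by have := is_derive_scale 1 (is_derive_step ((x - a) / e)); rewrite div1r.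
rewrite (Rintegral_FTC2 ae D); last exact: mollifier_scale_continuous.
have -> : (a + e - a) / e = 1 by field; rewrite gt_eqF.
have -> : (a - e - a) / e = -1 by field; rewrite gt_eqF.
by rewrite !mul1r step_ge// step_le// subr0.
Qed.

Lemma mollify_lebesgue_pt f a e : locally_integrable setT f -> lebesgue_pt f a ->
  0 < e -> exists2 d : R, 0 < d & forall r : R, 0 < r -> r < d ->
    `|\int[mu]_x (f x * (r^-1 * mollifier ((x - a) / r))) - f a| <= e.
Proof.
move=> lf La e0.
pose k := e * bump_mass R.
have k0 : 0 < k by rewrite mulr_gt0// bump_mass_gt0.
have [d d0 Hd] := lebesgue_pt_itv lf La k0.
exists d => // r r0 rd; have {}Hd := Hd r r0 rd.
set psi := fun x => r^-1 * mollifier ((x - a) / r).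
have cpsi : continuous psi by exact: mollifier_scale_continuous.
rewrite (@Rintegral_support _ (a - r) (a + r)); last first.
  by move=> x xa; rewrite mollifier_scale_out ?mulr0.
have fpsi : mu.-integrable `[a - r, a + r] (EFin \o (fun x => f x * psi x)).
  exact: integrableM_cont.
have fapsi : mu.-integrable `[a - r, a + r] (EFin \o (fun x => f a * psi x)).
  by apply: integrableM_cont => //; apply: locint_cont; exact: cst_continuous.
have fa1 : f a = \int[mu]_(x in `[a - r, a + r]) (f a * psi x).
  rewrite RintegralZl//; last exact: cont_integrable.
  by rewrite mollifier_scale_integral// mulr1.
rewrite [in X in _ - X]fa1 -RintegralB//.
under eq_Rintegral do rewrite -mulrBl.
have lfa : locally_integrable setT (fun x => f x - f a).
  by apply: locally_integrableB => //; apply: locint_cont; exact: cst_continuous.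
have fi := integrableM_cont (a - r) (a + r) lfa cpsi.
apply: le_trans (le_normr_Rintegral _ fi) _ => //.
have ni := integrable_norm_sub (a - r) (a + r) (f a) lf.
pose c := r^-1 * (bump_mass R)^-1.
have m0 := bump_mass_gt0 R.
have c0 : 0 < c by rewrite mulr_gt0 ?invr_gt0.
apply: (@le_trans _ _ (\int[mu]_(x in `[a - r, a + r]) (c * `|f x - f a|))).
  apply: le_Rintegral => //.
  - exact: (integrable_norm fi).
  - exact: integrable_scale.
  - move=> x _; rewrite normrM mulrC ler_wpM2r// ger0_norm.
      by rewrite ler_wpM2l ?invr_ge0 ?(ltW r0)// mollifier_le.
    by rewrite mulr_ge0 ?invr_ge0 ?(ltW r0)// mollifier_ge0.
rewrite RintegralZl//.
apply: le_trans (ler_wpM2l (ltW c0) Hd) _.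
by rewrite le_eqVlt /c /k; apply/orP; left; apply/eqP; field; rewrite !gt_eqF.
Qed.

Lemma integral_cutoff_approx g a b e : locally_integrable setT g -> a < b ->
  0 < e -> exists2 d : R, 0 < d & forall r : R, 0 < r -> r < d ->
    `|\int[mu]_x (g x * cutoff r a b x) - \int[mu]_(x in `[a, b]) g x| <= e.
Proof.
move=> lg ab e0.
have e40 : 0 < e / 4 by rewrite divr_gt0.
have [d1 d10 H1] := integral_norm_small a lg e40.
have [d2 d20 H2] := integral_norm_small b lg e40.
exists (Num.min ((b - a) / 2) (Num.min d1 d2)).
  by rewrite !lt_min d10 d20 divr_gt0// subr_gt0.
move=> r r0; rewrite !lt_min => /and3P[rab rd1 rd2].
have {H1}h1 := H1 r r0 rd1; have {H2}h2 := H2 r r0 rd2.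
have gi u v : mu.-integrable `[u, v] (EFin \o g) by exact: locint_integrable.
have gpi u v : mu.-integrable `[u, v] (EFin \o (fun x => g x * cutoff r a b x)).
  by apply: integrableM_cont => //; exact: cutoff_continuous.
have ngi u v : mu.-integrable `[u, v] (EFin \o (fun x => `|g x|)).
  exact: (integrable_norm (gi u v)).
rewrite (@Rintegral_support _ (a - r) (b + r)); last first.
  by move=> x xab; rewrite cutoff_out ?mulr0// ltW.
have [l1 l2 l3] : [/\ a - r <= a + r, a + r <= b - r & b - r <= b + r].
  by split; lra.
have [l4 l5] : a - r <= a /\ a <= a + r by split; lra.
have [l6 l7] : b - r <= b /\ b <= b + r by split; lra.
rewrite (Rintegral_chasles l1 (le_trans l2 l3))// (Rintegral_chasles l2 l3)//.
rewrite (Rintegral_chasles l5 (le_trans l2 l6))// (Rintegral_chasles l2 l6)//.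
have -> : \int[mu]_(x in `[a + r, b - r]) (g x * cutoff r a b x) =
          \int[mu]_(x in `[a + r, b - r]) g x.
  apply: eq_Rintegral => x; rewrite inE/= in_itv/= => xab.
  by rewrite cutoff_in// mulr1.
have bd u v w z : u <= w -> w <= v -> v <= z -> 
  `|\int[mu]_(x in `[w, v]) g x| <= \int[mu]_(x in `[u, z]) `|g x|.
  move=> uw wv vz; apply: le_trans (le_normr_Rintegral _ _) _ => //.
  rewrite (Rintegral_chasles uw (le_trans wv vz))// (Rintegral_chasles wv vz)//.
  by rewrite ler_wpDl ?ler_wpDr// Rintegral_ge0.
have bdp u v : `|\int[mu]_(x in `[u, v]) (g x * cutoff r a b x)| <=
    \int[mu]_(x in `[u, v]) `|g x|.
  apply: le_trans (le_normr_Rintegral _ _) _ => //.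
  apply: le_Rintegral => //; first exact: (integrable_norm (gpi u v)).
  by move=> x _; rewrite normrM ler_piMr// cutoff_itv.
have b1 := bd _ _ _ _ l4 l5 (lexx _).
have b2 := bd _ _ _ _ (lexx _) l6 l7.
have b3 := bdp (a - r) (a + r).
have b4 := bdp (b - r) (b + r).
move: (le_trans b1 h1) (le_trans b2 h2) (le_trans b3 h1) (le_trans b4 h2).
move: (\int[mu]_(x in _) _) (\int[mu]_(x in _) _) (\int[mu]_(x in _) _)
  (\int[mu]_(x in _) _) (\int[mu]_(x in _) _).
clear => x1 x2 x3 x4 x5.
rewrite !ler_norml => /andP[? ?] /andP[? ?] /andP[? ?] /andP[? ?].
by apply/andP; split; lra.
Qed.

Lemma ler_norm_eps x y : (forall e, 0 < e -> `|x - y| <= e) -> x = y.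
Proof.
move=> H; apply/eqP; rewrite -subr_eq0 -normr_le0; apply/ler_addgt0Pl => e e0.
by rewrite addr0; exact: H.
Qed.

(* Test the weak derivative against smoothed indicators of [[a, b]]. *)
Lemma weak_derivative_FTC f g a b : weak_derivative f g -> a < b ->
  lebesgue_pt f a -> lebesgue_pt f b -> f b - f a = \int[mu]_(x in `[a, b]) g x.
Proof.
move=> [lf lg H] ab La Lb; apply: ler_norm_eps => e e0.
have e30 : 0 < e / 3 by rewrite divr_gt0.
have [d1 d10 H1] := mollify_lebesgue_pt lf La e30.
have [d2 d20 H2] := mollify_lebesgue_pt lf Lb e30.
have [d3 d30 H3] := integral_cutoff_approx lg ab e30.
pose r := Num.min d1 (Num.min d2 d3) / 2.
have m0 : 0 < Num.min d1 (Num.min d2 d3) by rewrite !lt_min d10 d20 d30.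
have r0 : 0 < r by rewrite divr_gt0.
have : r < Num.min d1 (Num.min d2 d3) by rewrite /r; lra.
rewrite !lt_min => /and3P[rd1 rd2 rd3].
have h1 := H1 r r0 rd1; have h2 := H2 r r0 rd2; have h3 := H3 r r0 rd3.
have := H (cutoff r a b) (@smooth_cutoff _ _ _ _) (compact_supp_cutoff r0 (ltW ab)).
under eq_Rintegral do rewrite derive1_cutoff mulrBr.
have fm c : mu.-integrable setT (EFin \o (fun x => f x * (r^-1 * mollifier ((x - c) / r)))).
  apply: (@integrable_support _ (c - r) (c + r)).
    by move=> x xc; rewrite mollifier_scale_out ?mulr0.
  by apply: integrableM_cont => //; exact: mollifier_scale_continuous.
rewrite RintegralB//.
move: h1 h2 h3.
move: (\int[mu]_(x in _) _) (\int[mu]_(x in _) _) (\int[mu]_(x in _) _)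
  (\int[mu]_(x in _) _) (f a) (f b).
clear => x1 x2 x3 x4 fa fb.
rewrite !ler_norml => /andP[? ?] /andP[? ?] /andP[? ?] ?.
by apply/andP; split; lra.
Qed.

End WeakDerivative.

Section Sobolev.
Variable R : realType.
Implicit Types (f g h F G : R -> R) (a b c e x y : R).
Local Notation mu := (leb R).

Lemma ae_and (P Q : R -> Prop) : {ae mu, forall x, P x} ->
  {ae mu, forall x, Q x} -> {ae mu, forall x, P x /\ Q x}.
Proof.
move=> HP HQ; apply: (@filterS2 _ _ (ae_filter_ringOfSetsType mu)) HP HQ.
by move=> x.
Qed.

Lemma ae_imp (P Q : R -> Prop) : (forall x, P x -> Q x) ->
  {ae mu, forall x, P x} -> {ae mu, forall x, Q x}.
Proof.
by move=> PQ; apply: (@filterS _ _ (ae_filter_ringOfSetsType mu)).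
Qed.

Lemma ae_itv_exists (P : R -> Prop) a b : {ae mu, forall x, P x} -> a < b ->
  exists2 x : R, a < x < b & P x.
Proof.
move=> [N [mN N0 HN]] ab; apply: contrapT => H.
have sub : `]a, b[%classic `<=` N.
  move=> x /=; rewrite in_itv/= => xab; apply: HN => /= Px.
  by apply: H; exists x.
have : (mu `]a, b[ <= mu N)%E by apply: le_measure => //; rewrite inE//.
by rewrite N0 lebesgue_measure_itv/= lte_fin ab -EFinB lee_fin subr_le0 leNgt ab.
Qed.

Lemma ae_eq_continuous F G : continuous F -> continuous G ->
  {ae mu, forall x, F x = G x} -> F = G.
Proof.
move=> cF cG H; apply/funext => x; apply: contrapT => /eqP FG.
have cFG : continuous (fun y => F y - G y).
  by move=> y; apply: cvgB; [exact: cF|exact: cG].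
have : F x - G x != 0 by rewrite subr_eq0.
move=> /(cvgr_neq0 _ (cFG x)) [e /= e0 He].
have xe : x - e < x + e by lra.
have [y /andP[y1 y2] Fy] := ae_itv_exists H xe.
have := He y; rewrite /ball_/= Fy subrr eqxx => /(_ _)/negP; apply => //.
by rewrite ltr_norml; apply/andP; split; lra.
Qed.

Lemma eq_Rintegral_ae (D : set R) f g : measurable D ->
  measurable_fun D f -> measurable_fun D g ->
  {ae mu, forall x, f x = g x} ->
  \int[mu]_(x in D) f x = \int[mu]_(x in D) g x.
Proof.
move=> mD mf mg H; rewrite /Rintegral; congr fine.
apply: ae_eq_integral => //; try exact/measurable_EFinP.
by apply: ae_imp H => x fg _; rewrite fg.
Qed.

Lemma continuous_lebesgue_ptT f x : continuous f -> lebesgue_pt f x.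
Proof.
move=> cf; apply: (@continuous_lebesgue_pt _ _ _ setT) => //.
- by split => //; exact: openT.
- exact: cont_measurable.
- exact: cf.
Qed.

Lemma smooth_mollifier_scale e a : smooth (fun x => e^-1 * mollifier ((x - a) / e)).
Proof.
apply: (smooth_coind (P := fun f => exists2 Gc, smooth Gc.1 & f = fun x =>
  Gc.2 * Gc.1 ((x - a) / e))); last first.
  by exists (@mollifier R, e^-1) => //; exact: smooth_mollifier.
move=> _ [[G c] /= sG ->].
have D (x : R) : is_derive x 1 (fun x => c * G ((x - a) / e))
    (c / e * derive1 G ((x - a) / e)).
  by apply: is_derive_scale; exact: smooth_is_derive.
split=> [x|]; first by have [] := D x.
exists (derive1 G, c / e); first exact: smooth_derive1.
exact: derive1_is_derive D.
Qed.

Lemma compact_supp_itv f a b : (forall x, x \notin `[a, b] -> f x = 0) ->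
  compact (supp f).
Proof.
move=> H; apply: (@subclosed_compact _ _ `[a, b]%classic).
- exact: closed_closure.
- exact: segment_compact.
- rewrite [X in _ `<=` X](closure_id _).1; last exact: itv_closed.
  by apply: closure_subset => x /=; apply: contra_neqP => /negP /H.
Qed.

Lemma weak_derivative_uniq f g h : weak_derivative f g -> weak_derivative f h ->
  {ae mu, forall x, g x = h x}.
Proof.
move=> [lf lg Hg] [_ lh Hh].
have lgh := locally_integrableB lg lh.
apply: ae_imp (lebesgue_differentiation lgh) => a La.
apply/eqP; rewrite -subr_eq0; apply/eqP; apply: ler_norm_eps => e e0.
have [d d0 /(_ (d / 2))] := mollify_lebesgue_pt lgh La e0.
have r0 : 0 < d / 2 by rewrite divr_gt0.
have rd : d / 2 < d by lra.
move=> /(_ r0 rd); move: r0; move: (d / 2) => r r0.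
have cs : compact (supp (fun x => r^-1 * mollifier ((x - a) / r))).
  apply: (@compact_supp_itv _ (a - r) (a + r)) => x.
  exact: mollifier_scale_out.
have := Hh _ (@smooth_mollifier_scale r a) cs.
rewrite Hg//; last exact: smooth_mollifier_scale.
have im k : locally_integrable setT k ->
    mu.-integrable setT (EFin \o (fun x => k x * (r^-1 * mollifier ((x - a) / r)))).
  move=> lk; apply: (@integrable_support _ (a - r) (a + r)).
    by move=> x xc; rewrite mollifier_scale_out ?mulr0.
  by apply: integrableM_cont => //; exact: mollifier_scale_continuous.
move=> /oppr_inj E.
under eq_Rintegral do rewrite mulrBl.
by rewrite RintegralB ?im// E subrr sub0r normrN subr0 /=.
Qed.

Definition prim g c x : R := if c <= x then \int[mu]_(t in `[c, x]) g t
  else - \int[mu]_(t in `[x, c]) g t.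

Lemma primB g c a b : locally_integrable setT g -> a <= b ->
  prim g c b - prim g c a = \int[mu]_(x in `[a, b]) g x.
Proof.
move=> lg ab; have gi u v : mu.-integrable `[u, v] (EFin \o g).
  exact: locint_integrable.
rewrite /prim; case: (leP c a) => ca.
  by rewrite (le_trans ca ab) (Rintegral_chasles ca ab)// addrAC subrr add0r.
case: (leP c b) => cb; first by rewrite opprK (Rintegral_chasles (ltW ca) cb)// addrC.
by rewrite opprK (Rintegral_chasles ab (ltW cb))// addrC addrK.
Qed.

Lemma prim_continuous g c : locally_integrable setT g -> continuous (prim g c).
Proof.
move=> lg x; apply/cvgrPdist_le => /= e e0.
have [d d0 Hd] := integral_norm_small x lg e0.
have gi u v : mu.-integrable `[u, v] (EFin \o g) by exact: locint_integrable.
have ngi u v : mu.-integrable `[u, v] (EFin \o (fun x => `|g x|)).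
  exact: (integrable_norm (gi u v)).
have d20 : 0 < d / 2 by rewrite divr_gt0.
have d2d : d / 2 < d by lra.
have {}Hd := Hd _ d20 d2d.
have bd u v : x - d / 2 <= u -> u <= v -> v <= x + d / 2 ->
    `|\int[mu]_(y in `[u, v]) g y| <= e.
  move=> xu uv vx; apply: le_trans _ Hd; apply: le_trans (le_normr_Rintegral _ _) _ => //.
  rewrite (Rintegral_chasles xu (le_trans uv vx))// (Rintegral_chasles uv vx)//.
  by rewrite ler_wpDl ?ler_wpDr// Rintegral_ge0.
exists (d / 2) => //= y; rewrite /ball_/= => /ltW; rewrite ler_norml => /andP[y1 y2].
have [xy|/ltW yx] := leP x y.
  by rewrite distrC primB//; apply: bd; lra.
by rewrite primB//; apply: bd; lra.
Qed.

Lemma primitive_is_derive F G x : continuous G ->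
  (forall a b, a <= b -> F b - F a = \int[mu]_(t in `[a, b]) G t) ->
  is_derive x 1 F (G x).
Proof.
move=> cG H; apply/is_derive1_littleoP => e e0.
have [d /= d0 Hd] := (cvgrPdist_le _ _).1 (cG x) e e0.
exists d => // k kd.
have bd a b : `|x - a| < d -> `|x - b| < d -> a <= b ->
    `|F b - F a - (b - a) * G x| <= e * (b - a).
  move=> xa xb ab; rewrite H// (mulrC (b - a)) -(Rintegral_itv_cst (G x) ab) -RintegralB//;
    try exact: cont_integrable.
    apply: le_trans (le_normr_Rintegral _ _) _ => //.
      by apply: integrable_sub => //; apply: cont_integrable => //; exact: cst_continuous.
    rewrite -Rintegral_itv_cst//; apply: le_Rintegral => //.
    - apply: (integrable_norm (integrable_sub _ _ _)) => //; apply: cont_integrable => //.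
      exact: cst_continuous.
    - by apply: cont_integrable; exact: cst_continuous.
    - move=> t /=; rewrite in_itv/= => /andP[a_t tb]; rewrite distrC; apply: Hd => /=.
      rewrite /ball_/=; move: xa xb; rewrite !ltr_norml => /andP[? ?] /andP[? ?].
      by apply/andP; split; lra.
  by apply: cont_integrable; exact: cst_continuous.
have x0 : `|x - x| < d by rewrite subrr normr0.
have xk : `|x - (x + k)| < d by rewrite opprD addrA subrr add0r normrN.
have [k0|/ltW k0] := leP 0 k.
  have := bd x (x + k) x0 xk; rewrite lerDl k0 => /(_ isT).
  by rewrite (addrC x k) addrK (ger0_norm k0).
have := bd (x + k) x xk x0; rewrite gerDl k0 => /(_ isT).
rewrite (ler0_norm k0) -normrN; have -> : x - (x + k) = - k by ring.
by congr (`|_| <= _); ring.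
Qed.

Lemma continuous_weak_FTC f g a b : continuous f -> weak_derivative f g -> a <= b ->
  f b - f a = \int[mu]_(x in `[a, b]) g x.
Proof.
move=> cf wfg; rewrite le_eqVlt => /predU1P[<-|ab].
  by rewrite set_itv1 Rintegral_set1 subrr.
by apply: weak_derivative_FTC => //; exact: continuous_lebesgue_ptT.
Qed.

Lemma continuous_representative f g : weak_derivative f g ->
  exists2 F, continuous F & {ae mu, forall x, f x = F x}.
Proof.
move=> wfg; have [lf lg _] := wfg; have L := lebesgue_differentiation lf.
have [a _ La] := ae_itv_exists L (@ltr01 R).
exists (fun x => f a + prim g a x).
  by move=> x; apply: cvgD; [exact: cvg_cst|exact: prim_continuous].
apply: ae_imp L => x Lx; rewrite /prim; case: (ltgtP a x) => [ax|xa|<-].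
- by rewrite -(weak_derivative_FTC wfg)// addrC subrK.
- by rewrite -(weak_derivative_FTC wfg)// opprB addrC subrK.
- by rewrite set_itv1 Rintegral_set1 addr0.
Qed.

Lemma weak_derivative_ae f F g : weak_derivative f g -> continuous F ->
  {ae mu, forall x, f x = F x} -> weak_derivative F g.
Proof.
move=> [[mf _ _] lg H] cF fF; split => // [|phi sphi cphi]; first exact: locint_cont.
rewrite -H//; apply: eq_Rintegral_ae => //.
- apply: measurable_funM; apply: cont_measurable => //.
  apply: (der_continuous (df := derive1 (derive1 phi))) => x.
  exact/smooth_is_derive/smooth_derive1.
- apply: measurable_funM => //; apply: cont_measurable => //.
  apply: (der_continuous (df := derive1 (derive1 phi))) => x.
  exact/smooth_is_derive/smooth_derive1.
- by apply: ae_imp fF => x ->.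
Qed.

Lemma H2_C1 f g h : continuous f -> weak_derivative f g -> weak_derivative g h ->
  (forall x, is_derive x 1 f (derive1 f x)) /\ continuous (derive1 f).
Proof.
move=> cf wfg wgh; have [G cG gG] := continuous_representative wgh.
have D (x : R) : is_derive x 1 f (G x).
  apply: primitive_is_derive => // a b ab; rewrite (continuous_weak_FTC cf wfg)//.
  have [_ [mg _ _] _] := wfg.
  by apply: eq_Rintegral_ae => //; [exact: measurable_funTS|exact: cont_measurable].
by rewrite (derive1_is_derive D).
Qed.

Lemma Lnorm2_sqr f : ('N[mu]_2%:E[EFin \o f] `^ 2 = \int[mu]_x (f x ^+ 2)%:E)%E.
Proof.
rewrite powR_Lnorm//; apply: eq_integral => x _ /=.
by rewrite powR_mulrn// real_normK ?num_real.
Qed.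

Lemma fine_Lnorm2 f : (\int[mu]_x (f x ^+ 2)%:E < +oo)%E ->
  fine 'N[mu]_2%:E[EFin \o f] ^+ 2 = \int[mu]_x (f x ^+ 2).
Proof.
rewrite /Rintegral -Lnorm2_sqr.
have : (0 <= 'N[mu]_2%:E[EFin \o f])%E by exact: Lnorm_ge0.
case: ('N[_]_ _[_])%E => [r r0 _|_|//]; last by rewrite poweRyr // ltxx.
by rewrite poweR_EFin /= powR_mulrn.
Qed.

Lemma Lfun2_sqr_integrable f : f \in Lfun mu 2%:E ->
  mu.-integrable setT (EFin \o (fun x => f x ^+ 2)).
Proof. exact: Lfun2_integrable_sqr. Qed.

Lemma integral_norm_sqr f x e : locally_integrable setT f ->
  mu.-integrable setT (EFin \o (fun x => f x ^+ 2)) ->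
  0 < e -> \int[mu]_x (f x ^+ 2) <= e ^+ 2 ->
  \int[mu]_(t in `[x, x + 1]) `|f t| <= e.
Proof.
move=> lf f2i e0 Hf.
have x1 : x <= x + 1 by rewrite lerDl.
have nfi : mu.-integrable `[x, x + 1] (EFin \o (fun x => `|f x|)).
  exact/integrable_norm/locint_integrable.
have f2i' : mu.-integrable `[x, x + 1] (EFin \o (fun x => f x ^+ 2)).
  by apply: integrableS f2i => //; exact: measurableT.
have Hf' : \int[mu]_(t in `[x, x + 1]) (f t ^+ 2) <= e ^+ 2.
  apply: le_trans Hf; rewrite [leLHS]Rintegral_mkcond; apply: le_Rintegral => //.
  - rewrite -restrict_EFin.
    by apply/(@integrable_mkcond _ _ R mu `[x, x + 1]) => //; exact: measurable_itv.
  - by move=> t _; rewrite patchE; case: ifP => // _; exact: sqr_ge0.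
have ci : mu.-integrable `[x, x + 1] (EFin \o (fun=> e / 2)).
  by apply: cont_integrable; exact: cst_continuous.
have si : mu.-integrable `[x, x + 1] (EFin \o (fun t => (2 * e)^-1 * f t ^+ 2)).
  by apply: integrable_scale => //; exact: measurable_itv.
apply: (@le_trans _ _ (\int[mu]_(t in `[x, x + 1]) ((2 * e)^-1 * f t ^+ 2 + e / 2))).
  apply: le_Rintegral => //.
    by apply: integrable_add => //; exact: measurable_itv.
  move=> t _; rewrite -(ler_pM2l (_ : 0 < 2 * e)) ?mulr_gt0//.
  rewrite -subr_ge0 -[f t ^+ 2]real_normK ?num_real//.
  have -> : 2 * e * ((2 * e)^-1 * `|f t| ^+ 2 + e / 2) - 2 * e * `|f t| = (`|f t| - e) ^+ 2.
    by field; rewrite gt_eqF.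
  exact: sqr_ge0.
rewrite RintegralD// (Rintegral_itv_cst _ x1) RintegralZl//.
rewrite addrAC subrr add0r mulr1.
have : (2 * e)^-1 * \int[mu]_(t in `[x, x + 1]) (f t ^+ 2) <= (2 * e)^-1 * e ^+ 2.
  by rewrite ler_wpM2l// invr_ge0 mulr_ge0// ltW.
have -> : (2 * e)^-1 * e ^+ 2 = e / 2 by field; rewrite gt_eqF.
move=> H; apply: le_trans (lerD H (lexx _)) _.
by rewrite -splitr.
Qed.

Lemma wderivP f g : weak_derivative f g -> weak_derivative f (wderiv f).
Proof. by move=> H; apply: (@xgetPex _ (fun=> 0) [set g | weak_derivative f g]); exists g. Qed.

Lemma H1_norm f e : in_H 1 f -> Hnorm 1 f <= e -> 0 < e ->
  [/\ weak_derivative f (wderiv f),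
    mu.-integrable setT (EFin \o (fun x => f x ^+ 2)),
    mu.-integrable setT (EFin \o (fun x => wderiv f x ^+ 2)),
    \int[mu]_x (f x ^+ 2) <= e ^+ 2 &
    \int[mu]_x (wderiv f x ^+ 2) <= e ^+ 2].
Proof.
move=> [fL [g [wfg [gL _]]]] + e0; have wf := wderivP wfg.
have gf := weak_derivative_uniq wfg wf.
have f2 := Lfun2_sqr_integrable fL.
have g2 := Lfun2_sqr_integrable gL.
have [_ [mw _ _] _] := wf; have [_ [mg _ _] _] := wfg.
have E : (\int[mu]_x (g x ^+ 2)%:E = \int[mu]_x (wderiv f x ^+ 2)%:E)%E.
  apply: ae_eq_integral => //; try by apply/measurable_EFinP; exact: measurable_funX.
  by apply: ae_imp gf => x -> _.
have w2 : mu.-integrable setT (EFin \o (fun x => wderiv f x ^+ 2)).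
  apply/integrableP; split; first by apply/measurable_EFinP; exact: measurable_funX.
  under eq_integral do rewrite /= ger0_norm ?sqr_ge0//.
  rewrite -E; move/integrableP : g2 => [_].
  by under eq_integral do rewrite /= ger0_norm ?sqr_ge0//.
have fin k : mu.-integrable setT (EFin \o (fun x => k x ^+ 2)) ->
    (\int[mu]_x (k x ^+ 2)%:E < +oo)%E.
  move/integrableP => [_].
  by under eq_integral do rewrite /= ger0_norm ?sqr_ge0//.
rewrite /Hnorm !big_ord_recl big_ord0 addr0 /= !fine_Lnorm2 ?fin//.
set I1 := Rintegral _ _ _; set I2 := Rintegral _ _ _ => H.
have I10 : 0 <= I1 by apply: Rintegral_ge0 => x _; exact: sqr_ge0.
have I20 : 0 <= I2 by apply: Rintegral_ge0 => x _; exact: sqr_ge0.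
have : I1 + I2 <= e ^+ 2.
  by rewrite -(sqr_sqrtr (addr_ge0 I10 I20)) ler_sqr ?nnegrE ?sqrtr_ge0// ltW.
move=> I12; split => //; apply: le_trans I12; [by rewrite lerDl|by rewrite lerDr].
Qed.

Lemma Sobolev_sup f F e x : in_H 1 f -> Hnorm 1 f <= e -> 0 < e ->
  continuous F -> {ae mu, forall x, f x = F x} -> `|F x| <= 2 * e.
Proof.
move=> Hf He e0 cF fF; have [wf f2 w2 If Iw] := H1_norm Hf He e0.
have [lf lw _] := wf; have [mf _ _] := lf.
have wF := weak_derivative_ae wf cF fF.
have h1 := integral_norm_sqr x lf f2 e0 If.
have h2 := integral_norm_sqr x lw w2 e0 Iw.
have x1 : x <= x + 1 by rewrite lerDl.
have nF : continuous (fun y => `|F y|).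
  by move=> y; apply: continuous_comp; [exact: cF|exact: norm_continuous].
have Ef : \int[mu]_(t in `[x, x + 1]) `|f t| = \int[mu]_(t in `[x, x + 1]) `|F t|.
  apply: eq_Rintegral_ae => //.
  - by apply: measurableT_comp => //; exact: measurable_funTS.
  - exact: cont_measurable.
  - by apply: ae_imp fF => t ->.
set I := \int[mu]_(t in `[x, x + 1]) `|wderiv f t| in h2.
have wi u v : mu.-integrable `[u, v] (EFin \o (fun t => `|wderiv f t|)).
  exact/integrable_norm/locint_integrable.
have bd y : x <= y <= x + 1 -> `|F x| - I <= `|F y|.
  move=> /andP[xy yx]; have := continuous_weak_FTC cF wF xy => E.
  have : `|F y - F x| <= I.
    rewrite E; apply: le_trans (le_normr_Rintegral _ _) _ => //.
      exact: locint_integrable.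
    by rewrite /I (Rintegral_chasles xy yx)// lerDl Rintegral_ge0.
  rewrite distrC => H; rewrite lerBlDr; apply: le_trans (lerD (lexx _) H).
  by rewrite -{1}(subrK (F y) (F x)) addrC ler_normD.
have : \int[mu]_(t in `[x, x + 1]) (`|F x| - I) <= \int[mu]_(t in `[x, x + 1]) `|F t|.
  apply: le_Rintegral; [by []|by apply: cont_integrable; exact: cst_continuous| |].
    exact: cont_integrable.
  by move=> t /=; rewrite in_itv/=; exact: bd.
rewrite (Rintegral_itv_cst _ x1) addrAC subrr add0r mulr1 -Ef => /le_trans/(_ h1).
rewrite lerBlDr => /le_trans; apply; rewrite mulr2n mulrDl mul1r.
exact: lerD.
Qed.

Lemma weak_derivative_lin c f g f' g' : weak_derivative f f' -> weak_derivative g g' ->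
  weak_derivative (fun x => c * f x + g x) (fun x => c * f' x + g' x).
Proof.
move=> [lf lf' Hf] [lg lg' Hg].
have lZ k : locally_integrable setT k -> locally_integrable setT (fun x => c * k x).
  move=> [mk oT Hk]; split => //; first exact: measurable_funM.
  move=> K KT cK.
  have ki : mu.-integrable K (EFin \o k).
    apply/integrableP; split; last exact: Hk.
    by apply/measurable_EFinP; exact: measurable_funTS.
  have := integrable_scale (compact_measurable cK) ki c.
  by case/integrableP.
split; [exact: locally_integrableD (lZ _ lf) lg|exact: locally_integrableD (lZ _ lf') lg'|].
move=> phi sphi cphi.
have [a [b phi0]] : exists a b, forall x, x \notin `[a, b] -> phi x = 0.
  have [N [_ HN]] := compact_bounded cphi.
  have N1 : N < `|N| + 1 by rewrite (le_lt_trans (ler_norm N))// ltrDl.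
  exists (- (`|N| + 1)), (`|N| + 1) => x; rewrite in_itv/= => xN.
  apply/eqP; apply: contraNT xN => phix; rewrite -ler_norml.
  by apply: (HN _ N1); apply: subset_closure.
have cphi' : continuous phi.
  apply: (der_continuous (df := derive1 phi)) => x; exact/smooth_is_derive.
have cdphi : continuous (derive1 phi).
  apply: (der_continuous (df := derive1 (derive1 phi))) => x.
  exact/smooth_is_derive/smooth_derive1.
have dphi0 x : x \notin `[a - 1, b + 1] -> derive1 phi x = 0.
  rewrite in_itv/= negb_and -!ltNge => xab.
  have : \forall y \near x, phi y = cst 0 y.
    exists 1 => //= y; rewrite /ball_/= ltr_norml => /andP[? ?].
    apply: phi0; rewrite in_itv/= negb_and -!ltNge.
    by case/orP: xab => ?; apply/orP; [left|right]; lra.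
  by move=> /near_eq_derive H; rewrite derive1E H derive_cst.
have ip k : locally_integrable setT k ->
    mu.-integrable setT (EFin \o (fun x => k x * phi x)).
  move=> lk; apply: (@integrable_support _ a b).
    by move=> x /phi0 ->; rewrite mulr0.
  exact: integrableM_cont.
have idp k : locally_integrable setT k ->
    mu.-integrable setT (EFin \o (fun x => k x * derive1 phi x)).
  move=> lk; apply: (@integrable_support _ (a - 1) (b + 1)).
    by move=> x /dphi0 ->; rewrite mulr0.
  exact: integrableM_cont.
under eq_Rintegral do rewrite mulrDl -mulrA.
rewrite RintegralD//=; [|by apply: integrable_scale => //; exact: idp|exact: idp].
under [in RHS]eq_Rintegral do rewrite mulrDl -mulrA.
rewrite [in RHS]RintegralD//=; [|by apply: integrable_scale => //; exact: ip|exact: ip].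
rewrite !RintegralZl//=; [|exact: ip|exact: idp].
by rewrite Hf// Hg// mulrN opprD.
Qed.

Lemma in_H_lin k c f g : in_H k f -> in_H k g -> in_H k (fun x => c * f x + g x).
Proof.
have p1 : (1 <= 2%:E :> \bar R)%E by rewrite lee_fin ler1n.
have [_ L2] := @Lfun_submod_closed _ _ R mu _ p1.
elim: k f g => [|k ih] f g [fL Hf] [gL Hg]; split => //; try exact: (L2 c f g).
case: Hf => f' [wf Hf]; case: Hg => g' [wg Hg].
exists (fun x => c * f' x + g' x); split; last exact: ih.
exact: weak_derivative_lin.
Qed.

End Sobolev.

Section Continuity.
Variable R : realType.
Implicit Types (f g h F G : R -> R) (U V : R -> R -> R) (a b c e t s x y : R).

Lemma contD f g : continuous f -> continuous g -> continuous (fun x => f x + g x).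
Proof. by move=> cf cg x; apply: cvgD; [exact: cf|exact: cg]. Qed.

Lemma contB f g : continuous f -> continuous g -> continuous (fun x => f x - g x).
Proof. by move=> cf cg x; apply: cvgB; [exact: cf|exact: cg]. Qed.

Lemma contM f g : continuous f -> continuous g -> continuous (fun x => f x * g x).
Proof. by move=> cf cg x; apply: cvgM; [exact: cf|exact: cg]. Qed.

Lemma contN f : continuous f -> continuous (fun x => - f x).
Proof. by move=> cf x; apply: cvgN; exact: cf. Qed.

Lemma contX f n : continuous f -> continuous (fun x => f x ^+ n).
Proof.
move=> cf; elim: n => [|n ih]; first exact: cst_continuous.
by under [X in continuous X]eq_fun do rewrite exprS; exact: contM.
Qed.

Lemma contC c : continuous (fun _ : R => c).
Proof. exact: cst_continuous. Qed.

Lemma contid : continuous (fun x : R => x).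
Proof. by move=> x; exact: cvg_id. Qed.

Lemma cont_powR gamma f : continuous f -> (forall x, 0 < f x) ->
  continuous (fun x => f x `^ gamma).
Proof.
move=> cf f0 x; apply: (@continuous_comp _ _ _ f (fun y => y `^ gamma)).
  exact: cf.
have [df _] := is_derive1_powR gamma (f0 x).
exact/differentiable_continuous/derivable1_diffP.
Qed.

End Continuity.

Ltac cont1 := lazymatch goal with
  | |- forall z, continuous_at z (fun w => @?f w - @?g w) => apply: contB
  | |- forall z, continuous_at z (fun w => @?f w + @?g w) => apply: contD
  | |- forall z, continuous_at z (fun w => @?f w * @?g w) => apply: contM
  | |- forall z, continuous_at z (fun w => - @?f w) => apply: contN
  | |- forall z, continuous_at z (fun w => @?f w ^+ _) => apply: contX
  end.

Ltac cont := repeat first [cont1 | assumption | exact: contC | exact: contid].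

(** * Global solutions are classical *)

Section ClassicalSolution.
Variable R : realType.
Implicit Types (f g h F G : R -> R) (U V : R -> R -> R) (a b c e t s x y : R).
Local Notation mu := (leb R).

Definition unif_time_derivative U V :=
  forall t, 0 <= t -> forall e, 0 < e ->
  exists2 d : R, 0 < d & forall s, 0 <= s -> `|s - t| < d ->
    forall x, `|U s x - U t x - (s - t) * V t x| <= e * `|s - t|.

Lemma C1_H_unif U dU : C1_H +oo 1 U dU ->
  (forall t, 0 <= t -> continuous (U t)) ->
  exists2 V, unif_time_derivative U V &
    forall t, 0 <= t -> continuous (V t) /\ {ae mu, forall x, dU t x = V t x}.
Proof.
move=> [CU CdU HU] cU.
have tT t : 0 <= t -> time_itv +oo%E t by move=> t0; split => //; exact: ltry.
have : forall t, exists W : R -> R, 0 <= t ->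
    [/\ continuous W, {ae mu, forall x, dU t x = W x} & forall e, 0 < e ->
    exists2 d : R, 0 < d & forall s, 0 <= s -> `|s - t| < d ->
    forall x, `|U s x - U t x - (s - t) * W x| <= e * `|s - t| ].
  move=> t; have [t0|t0] := leP 0 t; last by exists (fun=> 0).
  have [[dUL [g [wg Hg]]] _] := CdU t (tT t t0).
  have [W cW dUW] := continuous_representative wg.
  exists W => _; split => // e e0.
  have e20 : 0 < e / 2 by rewrite divr_gt0.
  have := HU t (tT t t0) => /cvgrPdist_le/(_ _ e20) [d /= d0 Hd].
  exists d => // s s0 sd x.
  have [->|st] := eqVneq s t; first by rewrite !subrr mul0r subrr normr0 mulr0.
  have := Hd s; rewrite /ball_/= distrC => /(_ sd st (tT s s0)).
  rewrite sub0r normrN => /(le_trans (ler_norm _)).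
  set f := (fun y => _) => Hf.
  have fH : in_H 1 f.
    have [HUs _] := CU s (tT s s0); have [HUt _] := CU t (tT t t0).
    have [HdUt _] := CdU t (tT t t0).
    have h1 := in_H_lin (-1) HUt HUs.
    have h2 := in_H_lin ((s - t)^-1 - 1) h1 h1.
    have := in_H_lin (-1) HdUt h2.
    by congr (in_H 1 _); apply/funext => y; rewrite /f; ring.
  have := @Sobolev_sup _ f (fun y => (s - t)^-1 * (U s y - U t y) - W y) _ x fH Hf e20.
  have -> : 2 * (e / 2) = e by field.
  move=> H; have : `|(s - t)^-1 * (U s x - U t x) - W x| <= e.
    apply: H; last by apply: ae_imp dUW => y; rewrite /f => ->.
    apply: contB => //; apply: contM; first exact: contC.
    by apply: contB; exact: cU.
  have st0 : s - t != 0 by rewrite subr_eq0.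
  rewrite -(ler_pM2r (x := `|s - t|)) ?normr_gt0// -normrM mulrBl (mulrAC _^-1) mulVf// mul1r.
  by rewrite (mulrC (W x)).
move=> /choice[V HV]; exists V.
  by move=> t t0 e e0; have [_ _] := HV t t0; exact.
by move=> t t0; have [] := HV t t0.
Qed.

Lemma C0_H2_C1 U c t : C0_H +oo 2 (fun t x => U t x - c) -> 0 <= t ->
  continuous (U t) ->
  (forall x, is_derive x 1 (U t) (derive1 (U t) x)) /\ continuous (derive1 (U t)).
Proof.
move=> H t0 cU; have tT : time_itv +oo%E t by split => //; exact: ltry.
have [[_ [g [wg [_ [h [wh _]]]]]] _] := H t tT.
have cf : continuous (fun x => U t x - c) by apply: contB => //; exact: contC.
have [Df cdf] := H2_C1 cf wg wh.
have D (x : R) : is_derive x 1 (U t) (derive1 (fun x => U t x - c) x).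
  apply: (@der_ext _ (fun x => U t x - c + c)); last by move=> y; rewrite subrK.
  by apply: der_eq (derD (Df x) (der_cst c x)) _; rewrite addr0.
by rewrite (derive1_is_derive D).
Qed.

Lemma ae_eq_continuous_pt F G x : continuous F -> continuous G ->
  {ae mu, forall x, F x = G x} -> F x = G x.
Proof. by move=> cF cG FG; rewrite (ae_eq_continuous cF cG FG). Qed.

Record classical_solution (tau gamma : R) (rho u S rhot ut St : R -> R -> R) := {
  cs_pos : forall t x, 0 <= t -> 0 < rho t x;
  cs_drho : forall t x, 0 <= t -> is_derive x 1 (rho t) (derive1 (rho t) x);
  cs_du : forall t x, 0 <= t -> is_derive x 1 (u t) (derive1 (u t) x);
  cs_dS : forall t x, 0 <= t -> is_derive x 1 (S t) (derive1 (S t) x);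
  cs_crho : forall t, 0 <= t -> continuous (derive1 (rho t));
  cs_cu : forall t, 0 <= t -> continuous (derive1 (u t));
  cs_cS : forall t, 0 <= t -> continuous (derive1 (S t));
  cs_crhot : forall t, 0 <= t -> continuous (rhot t);
  cs_cut : forall t, 0 <= t -> continuous (ut t);
  cs_cSt : forall t, 0 <= t -> continuous (St t);
  cs_rhot : unif_time_derivative rho rhot;
  cs_ut : unif_time_derivative u ut;
  cs_St : unif_time_derivative S St;
  cs_mass : forall t x, 0 <= t ->
    rhot t x + (derive1 (rho t) x * u t x + rho t x * derive1 (u t) x) = 0;
  cs_momentum : forall t x, 0 <= t ->
    rho t x * ut t x + rho t x * u t x * derive1 (u t) x
    + gamma * rho t x `^ (gamma - 1) * derive1 (rho t) x = derive1 (S t) x;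
  cs_stress : forall t x, 0 <= t ->
    tau * rho t x * (St t x + u t x * derive1 (S t) x) - derive1 (u t) x = - S t x
}.

Lemma solution_classical (tau gamma : R) (rho0 u0 S0 : R -> R) rho u S :
  is_solution (fun y => y `^ gamma) tau 1 rho0 u0 S0 +oo rho u S ->
  exists rhot ut St, classical_solution tau gamma rho u S rhot ut St.
Proof.
move=> [[Hr Hu HS] Hc _ Hpos [rho_t [u_t [S_t [C1r C1u C1S Heq]]]]].
have tT t : 0 <= t -> time_itv +oo%E t by move=> t0; split => //; exact: ltry.
have cr t : 0 <= t -> continuous (rho t) by move=> /tT/Hc[].
have cu t : 0 <= t -> continuous (u t) by move=> /tT/Hc[].
have cS t : 0 <= t -> continuous (S t) by move=> /tT/Hc[].
have pos t x : 0 <= t -> 0 < rho t x by move=> t0; apply: Hpos; exact: tT.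
have cr1 t : 0 <= t -> continuous (fun x => rho t x - 1).
  by move=> t0; apply: contB; [exact: cr|exact: contC].
have H0 U : C0_H +oo 2 U -> C0_H +oo 2 (fun t x => U t x - 0).
  by congr (C0_H _ _ _); apply/funext => t; apply/funext => x; rewrite subr0.
have dr t (t0 : 0 <= t) := C0_H2_C1 Hr t0 (cr t t0).
have du t (t0 : 0 <= t) := C0_H2_C1 (H0 _ Hu) t0 (cu t t0).
have dS t (t0 : 0 <= t) := C0_H2_C1 (H0 _ HS) t0 (cS t t0).
have [rhot ur Vr] := C1_H_unif C1r cr1.
have [ut uu Vu] := C1_H_unif C1u cu.
have [St uS VS] := C1_H_unif C1S cS.
have Dru t x : 0 <= t -> derive1 (fun y => rho t y * u t y) x =
    derive1 (rho t) x * u t x + rho t x * derive1 (u t) x.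
  move=> t0; have D (y : R) := derM ((dr t t0).1 y) ((du t t0).1 y).
  by rewrite (derive1_is_derive D).
have Dp t x : 0 <= t -> derive1 (fun y => rho t y `^ gamma) x =
    gamma * rho t x `^ (gamma - 1) * derive1 (rho t) x.
  move=> t0; have D (y : R) := dercomp ((dr t t0).1 y) (is_derive1_powR gamma (pos t y t0)).
  by rewrite (derive1_is_derive D).
have E t : 0 <= t -> {ae mu, forall x,
  [/\ rhot t x + (derive1 (rho t) x * u t x + rho t x * derive1 (u t) x) = 0,
   rho t x * ut t x + rho t x * u t x * derive1 (u t) x
    + gamma * rho t x `^ (gamma - 1) * derive1 (rho t) x = derive1 (S t) x &
  tau * rho t x * (St t x + u t x * derive1 (S t) x) - derive1 (u t) x = - S t x]}.
  move=> t0; have [_ a1] := Vr t t0; have [_ a2] := Vu t t0; have [_ a3] := VS t t0.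
  have := ae_and (ae_and a1 a2) (ae_and a3 (Heq t (tT t t0))).
  apply: ae_imp => x [[e1 e2] [e3 [E1 E2 E3]]].
  by rewrite -e1 -e2 -e3 -Dru// -Dp//.
exists rhot, ut, St; split => //.
- by move=> t x t0; exact: (dr t t0).1.
- by move=> t x t0; exact: (du t t0).1.
- by move=> t x t0; exact: (dS t t0).1.
- by move=> t t0; exact: (dr t t0).2.
- by move=> t t0; exact: (du t t0).2.
- by move=> t t0; exact: (dS t t0).2.
- by move=> t t0; exact: (Vr t t0).1.
- by move=> t t0; exact: (Vu t t0).1.
- by move=> t t0; exact: (VS t t0).1.
- move=> t t0 e e0; have [d d0 Hd] := ur t t0 e e0; exists d => // s s0 sd x.
  by have := Hd s s0 sd x; congr (`|_| <= _); ring.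
- move=> t x t0; have [c1 c2 c3] := And3 (Vr t t0).1 (dr t t0).2 (du t t0).2.
  have [c4 c5] := conj (cr t t0) (cu t t0).
  apply: (@ae_eq_continuous_pt
    (fun x => rhot t x + (derive1 (rho t) x * u t x + rho t x * derive1 (u t) x)) (fun=> 0)).
  + by cont.
  + by cont.
  + by apply: ae_imp (E t t0) => y [].
- move=> t x t0; have [c1 c2 c3] := And3 (Vu t t0).1 (dr t t0).2 (du t t0).2.
  have [c4 c5 c6] := And3 (cr t t0) (cu t t0) (dS t t0).2.
  have c7 : continuous (fun x => rho t x `^ (gamma - 1)).
    by apply: cont_powR => // y; exact: pos.
  apply: (@ae_eq_continuous_pt (fun x => rho t x * ut t x + rho t x * u t x * derive1 (u t) x
    + gamma * rho t x `^ (gamma - 1) * derive1 (rho t) x) (derive1 (S t))).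
  + by cont.
  + by cont.
  + by apply: ae_imp (E t t0) => y [].
- move=> t x t0; have [c1 c2 c3] := And3 (VS t t0).1 (dr t t0).2 (du t t0).2.
  have [c4 c5 c6] := And3 (cr t t0) (cu t t0) (dS t t0).2; have c7 := cS t t0.
  apply: (@ae_eq_continuous_pt (fun x =>
    tau * rho t x * (St t x + u t x * derive1 (S t) x) - derive1 (u t) x) (fun x => - S t x)).
  + by cont.
  + by cont.
  + by apply: ae_imp (E t t0) => y [].
Qed.

End ClassicalSolution.

(** * Differentiating integrals in time *)

Section TimeDerivative.
Variable R : realType.
Implicit Types (f g h F G : R -> R -> R) (I D : R -> R) (a b c e t s x y r C N : R).
Local Notation mu := (leb R).

Lemma real_induction t1 t2 (P : R -> Prop) : t1 <= t2 -> P t1 ->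
  (forall t, t1 < t <= t2 -> (forall s, t1 <= s < t -> P s) -> P t) ->
  (forall t, t1 <= t < t2 -> P t ->
     exists2 d : R, 0 < d & forall s, t < s < t + d -> s <= t2 -> P s) ->
  P t2.
Proof.
move=> t12 P1 Pcl Pop.
pose A := [set t | t1 <= t <= t2 /\ forall s, t1 <= s <= t -> P s].
have A1 : A t1.
  by split; [rewrite lexx|move=> s /andP[? ?]; rewrite (_ : s = t1)//; apply/eqP; rewrite eq_le; apply/andP].
have hA : has_sup A by split; [exists t1|exists t2 => t [/andP[]]].
pose m := sup A.
have m1 : t1 <= m by apply: ub_le_sup => //; exact: hA.2.
have m2 : m <= t2 by apply: ge_sup; [exact: hA.1|move=> t [/andP[]]].
have before s : t1 <= s < m -> P s.
  move=> /andP[ts sm]; have [t [_ At] st] := @sup_gt _ A s hA.1 sm.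
  by apply: At; rewrite ts ltW.
have Pm : P m.
  by have [->|tm] := eqVneq m t1 => //; apply: Pcl => //; rewrite lt_neqAle eq_sym tm m1.
have Am : A m.
  split=> [|s /andP[ts]]; first by rewrite m1 m2.
  by rewrite le_eqVlt => /predU1P[->//|sm]; apply: before; rewrite ts.
have [<-//|mt] := eqVneq m t2.
have mt2 : m < t2 by rewrite lt_neqAle mt m2.
have [|d d0 Hd] := Pop m _ Pm; first by rewrite m1 mt2.
pose s := Num.min t2 (m + d / 2).
have ms : m < s by rewrite lt_min mt2 ltrDl divr_gt0.
have : A s.
  split=> [|y /andP[ty ys]]; first by rewrite (le_trans m1 (ltW ms)) ge_min lexx.
  have [ym|my] := leP y m; first by apply: Am.2; rewrite ty.
  apply: Hd; last by apply: le_trans ys _; rewrite ge_min lexx.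
  rewrite my (le_lt_trans ys)// gt_min; apply/orP; right.
  by rewrite ltrD2l; lra.
move/(ub_le_sup hA.2); rewrite leNgt => /negP; exact.
Qed.

Definition time_der I t c := forall e, 0 < e -> exists2 d : R, 0 < d &
  forall s, 0 <= s -> `|s - t| < d -> `|I s - I t - (s - t) * c| <= e * `|s - t|.

Lemma time_der_nonincr I D t1 t2 : 0 <= t1 -> t1 <= t2 ->
  (forall t, t1 <= t <= t2 -> time_der I t (D t)) ->
  (forall t, t1 <= t <= t2 -> D t <= 0) -> I t2 <= I t1.
Proof.
move=> t10 t12 HD D0; apply/ler_addgt0Pl => k k0.
pose e := k / (t2 - t1 + 1).
have k1 : 0 < t2 - t1 + 1 by rewrite ltr_wpDl// subr_ge0.
have e0 : 0 < e by rewrite divr_gt0.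
suff : I t2 <= I t1 + e * (t2 - t1).
  move=> /le_trans; apply; rewrite addrC lerD2r /e mulrAC ler_pdivrMr//.
  by rewrite ler_pM2l// lerDl.
apply: (@real_induction t1 t2 (fun t => I t <= I t1 + e * (t - t1))) => //.
- by rewrite subrr mulr0 addr0.
- move=> t /andP[t1t tt2] H; apply/ler_addgt0Pl => n n0.
  have tin : t1 <= t <= t2 by rewrite (ltW t1t).
  have [d d0 Hd] := HD t tin 1 ltr01.
  pose C := `|D t| + 1 + 1; have C0 : 0 < C by rewrite !ltr_wpDl// addr_ge0.
  pose s := Num.max t1 (t - Num.min (d / 2) (n / C)).
  have m0 : 0 < Num.min (d / 2) (n / C) by rewrite lt_min !divr_gt0.
  have st : s < t by rewrite gt_max t1t gtrBl.
  have t1s : t1 <= s by rewrite le_max lexx.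
  have tsm : t - s <= Num.min (d / 2) (n / C).
    by rewrite lerBlDr -lerBlDl le_max lexx orbT.
  have [tsd tsn] : t - s <= d / 2 /\ t - s <= n / C.
    by move: tsm; rewrite le_min => /andP.
  have sn : `|s - t| = t - s by rewrite distrC gtr0_norm// subr_gt0.
  have := Hd s (le_trans t10 t1s); rewrite sn => /(_ _).
  have sd : t - s < d by lra.
  move=> /(_ sd); rewrite mul1r ler_norml => /andP[_ h1].
  have h2 := H s; rewrite t1s st in h2; have {}h2 := h2 isT.
  have h3 : (t - s) * C <= n by rewrite -ler_pdivlMr.
  have h4 : (t - s) * D t <= (t - s) * `|D t|.
    by rewrite ler_pM2l ?subr_gt0// ler_norm.
  have h5 : `|I s - I t - (s - t) * D t| <= t - s.
    by have := Hd s (le_trans t10 t1s); rewrite sn mul1r; apply.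
  move: h5; rewrite ler_norml => /andP[h5 _].
  have h6 : e * (s - t1) <= e * (t - t1) by rewrite ler_pM2l// lerD2r ltW.
  rewrite /C in h3; clear -h1 h2 h3 h4 h5 h6 st.
  nra.
- move=> t /andP[t1t tt2] H.
  have tin : t1 <= t <= t2 by rewrite t1t ltW.
  have [d d0 Hd] := HD t tin e e0; exists d => // s /andP[ts std] st2.
  have t0 := le_trans t10 t1t.
  have sn : `|s - t| = s - t by rewrite gtr0_norm// subr_gt0.
  have := Hd s (le_trans t0 (ltW ts)); rewrite sn ltrBlDl => /(_ std).
  rewrite ler_norml => /andP[_ h1].
  have h2 : (s - t) * D t <= 0 by rewrite pmulr_rle0 ?subr_gt0// D0.
  clear -h1 h2 H.
  lra.
Qed.

(* [f] is differentiable in time at [t], uniformly for [x] in [[a, b]], with derivative [g t];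
   one-sided at [t = 0]. *)
Definition UD a b t f g := forall e, 0 < e -> exists2 d : R, 0 < d &
  forall s, 0 <= s -> `|s - t| < d -> forall x, a <= x <= b ->
    `|f s x - f t x - (s - t) * g t x| <= e * `|s - t|.

Lemma unif_UD f g a b t : unif_time_derivative f g -> 0 <= t -> UD a b t f g.
Proof.
move=> H t0 e e0; have [d d0 Hd] := H t t0 e e0; exists d => // s s0 sd x _.
exact: Hd.
Qed.

Lemma UD_const (k : R -> R) a b t : UD a b t (fun _ x => k x) (fun _ _ => 0).
Proof.
by move=> e e0; exists 1 => // s _ _ x _; rewrite subrr mulr0 subrr normr0 mulr_ge0// ltW.
Qed.

Lemma UD_D f1 f2 g1 g2 a b t : UD a b t f1 g1 -> UD a b t f2 g2 ->
  UD a b t (fun s x => f1 s x + f2 s x) (fun s x => g1 s x + g2 s x).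
Proof.
move=> H1 H2 e e0; have e20 : 0 < e / 2 by rewrite divr_gt0.
have [d1 d10 h1] := H1 _ e20; have [d2 d20 h2] := H2 _ e20.
exists (Num.min d1 d2); first by rewrite lt_min d10.
move=> s s0; rewrite lt_min => /andP[sd1 sd2] x xab.
have := lerD (h1 s s0 sd1 x xab) (h2 s s0 sd2 x xab).
rewrite -mulrDl -splitr; apply: le_trans; apply: le_trans (ler_normD _ _).
by rewrite le_eqVlt; apply/orP; left; apply/eqP; congr `|_|; ring.
Qed.

Lemma UD_lipschitz f g a b t N : UD a b t f g ->
  (forall x, a <= x <= b -> `|g t x| <= N) -> 0 <= N ->
  exists2 d : R, 0 < d & forall s, 0 <= s -> `|s - t| < d -> forall x, a <= x <= b ->
    `|f s x - f t x| <= (N + 1) * `|s - t|.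
Proof.
move=> H gN N0; have [d d0 Hd] := H 1 ltr01; exists d => // s s0 sd x xab.
have := Hd s s0 sd x xab; rewrite mul1r => h.
rewrite -[f s x - f t x](subrK ((s - t) * g t x)).
apply: le_trans (ler_normD _ _) _; rewrite [leRHS]mulrDl mul1r [leRHS]addrC lerD//.
by rewrite normrM mulrC ler_wpM2r// gN.
Qed.

Lemma UD_comp (phi phi' : R -> R) f g a b t r C N : UD a b t f g ->
  0 < r -> 0 <= C -> 0 <= N ->
  (forall x, a <= x <= b -> `|g t x| <= N) ->
  (forall x, a <= x <= b -> `|phi' (f t x)| <= N) ->
  (forall x y, a <= x <= b -> `|y - f t x| <= r ->
    `|phi y - phi (f t x) - phi' (f t x) * (y - f t x)| <= C * (y - f t x) ^+ 2) ->
  UD a b t (fun s x => phi (f s x)) (fun s x => phi' (f s x) * g s x).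
Proof.
move=> H r0 C0 N0 gN phiN T e e0.
have [d1 d10 h1] := UD_lipschitz H gN N0.
have e20 : 0 < e / 2 / (N + 1) by rewrite !divr_gt0// ltr_wpDl.
have [d2 d20 h2] := H _ e20.
have N1 : 0 < N + 1 by rewrite ltr_wpDl.
pose K := C * (N + 1) ^+ 2 + 1.
have K0 : 0 < K by rewrite ltr_wpDl// mulr_ge0// sqr_ge0.
exists (Num.min (Num.min d1 d2) (Num.min (r / (N + 1)) (e / 2 / K))).
  by rewrite !lt_min d10 d20 !divr_gt0.
move=> s s0; rewrite !lt_min => /andP[/andP[sd1 sd2] /andP[sr se]] x xab.
have l1 := h1 s s0 sd1 x xab; have l2 := h2 s s0 sd2 x xab.
have yr : `|f s x - f t x| <= r.
  by apply: le_trans l1 _; rewrite mulrC -ler_pdivlMr// ltW.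
have l3 := T x _ xab yr.
set D := f s x - f t x in l1 l2 l3 *.
have -> : phi (f s x) - phi (f t x) - (s - t) * (phi' (f t x) * g t x) =
  (phi (f s x) - phi (f t x) - phi' (f t x) * D) +
  phi' (f t x) * (D - (s - t) * g t x) by ring.
apply: le_trans (ler_normD _ _) _; rewrite [leRHS](_ : _ = e / 2 * `|s - t| + e / 2 * `|s - t|); last by field.
apply: lerD.
  apply: le_trans l3 _; rewrite -[D ^+ 2]real_normK ?num_real//.
  apply: (@le_trans _ _ (C * ((N + 1) * `|s - t|) ^+ 2)).
    by rewrite ler_wpM2l// ler_sqr ?nnegrE ?mulr_ge0// ltW.
  rewrite exprMn mulrA [X in _ * X]expr2 mulrA ler_wpM2r//.
  apply: (@le_trans _ _ (K * `|s - t|)); first by rewrite ler_wpM2r// /K lerDl.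
  by rewrite mulrC -ler_pdivlMr// ltW.
rewrite normrM; apply: (@le_trans _ _ ((N + 1) * (e / 2 / (N + 1) * `|s - t|))).
  by rewrite ler_pM// (le_trans (phiN x xab))// lerDl.
by rewrite mulrA mulrCA mulfV ?mulr1// gt_eqF.
Qed.

Lemma UD_M f1 f2 g1 g2 a b t N : UD a b t f1 g1 -> UD a b t f2 g2 -> 0 <= N ->
  (forall x, a <= x <= b -> [/\ `|f1 t x| <= N, `|f2 t x| <= N, `|g1 t x| <= N & `|g2 t x| <= N]) ->
  UD a b t (fun s x => f1 s x * f2 s x) (fun s x => g1 s x * f2 s x + f1 s x * g2 s x).
Proof.
move=> H1 H2 N0 HN e e0.
have [d1 d10 h1] : exists2 d : R, 0 < d & forall s, 0 <= s -> `|s - t| < d -> forall x, a <= x <= b ->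
    `|f1 s x - f1 t x| <= (N + 1) * `|s - t|.
  by apply: UD_lipschitz H1 _ N0 => x /HN[].
have [d2 d20 h2] : exists2 d : R, 0 < d & forall s, 0 <= s -> `|s - t| < d -> forall x, a <= x <= b ->
    `|f2 s x - f2 t x| <= (N + 1) * `|s - t|.
  by apply: UD_lipschitz H2 _ N0 => x /HN[].
have N1 : 0 < N + 1 by rewrite ltr_wpDl.
have e30 : 0 < e / 3 / (N + 1) by rewrite !divr_gt0.
have [d3 d30 h3] := H1 _ e30; have [d4 d40 h4] := H2 _ e30.
have K0 : 0 < (N + 1) ^+ 2 by rewrite exprn_gt0.
exists (Num.min (Num.min d1 d2) (Num.min (Num.min d3 d4) (e / 3 / (N + 1) ^+ 2))).
  by rewrite !lt_min d10 d20 d30 d40 !divr_gt0.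
move=> s s0; rewrite !lt_min => /and3P[/andP[sd1 sd2] /andP[sd3 sd4] se] x xab.
have l1 := h1 s s0 sd1 x xab; have l2 := h2 s s0 sd2 x xab.
have l3 := h3 s s0 sd3 x xab; have l4 := h4 s s0 sd4 x xab.
have [F1 F2 G1 G2] := HN x xab.
set r := s - t in l1 l2 l3 l4 se *.
set D1 := f1 s x - f1 t x in l1 l3 *; set D2 := f2 s x - f2 t x in l2 l4 *.
have -> : f1 s x * f2 s x - f1 t x * f2 t x - r * (g1 t x * f2 t x + f1 t x * g2 t x) =
  (D1 - r * g1 t x) * f2 t x + f1 t x * (D2 - r * g2 t x) + D1 * D2.
  by rewrite /D1 /D2; ring.
have -> : e * `|r| = e / 3 * `|r| + e / 3 * `|r| + e / 3 * `|r| by field.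
have E : e / 3 / (N + 1) * `|r| * (N + 1) = e / 3 * `|r|.
  by field; rewrite gt_eqF.
have F1' : `|f1 t x| <= N + 1 by rewrite (le_trans F1)// lerDl.
have F2' : `|f2 t x| <= N + 1 by rewrite (le_trans F2)// lerDl.
apply: le_trans (ler_normD _ _) _; apply: lerD; first (apply: le_trans (ler_normD _ _) _; apply: lerD).
- by rewrite normrM -E ler_pM.
- by rewrite normrM mulrC -E ler_pM.
- rewrite normrM; apply: le_trans (ler_pM _ _ l1 l2) _ => //.
  rewrite mulrACA -expr2 mulrA ler_wpM2r// mulrC -ler_pdivlMr//; exact: ltW.
Qed.

Lemma UD_integral a b t f g : a <= b -> 0 <= t -> (forall s, 0 <= s -> continuous (f s)) ->
  continuous (g t) -> UD a b t f g ->
  time_der (fun s => \int[mu]_(x in `[a, b]) f s x) t (\int[mu]_(x in `[a, b]) g t x).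
Proof.
move=> ab t0 cf cg H e e0.
pose k := e / (b - a + 1).
have ba1 : 0 < b - a + 1 by rewrite ltr_wpDl// subr_ge0.
have k0 : 0 < k by rewrite divr_gt0.
have [d d0 Hd] := H k k0; exists d => // s s0 sd.
have cfs := cf s s0; have cft := cf t t0.
rewrite -RintegralZl//; last exact: cont_integrable.
rewrite -!RintegralB//; try (apply: cont_integrable; by cont).
have ch : continuous (fun x => f s x - f t x - (s - t) * g t x) by cont.
apply: le_trans (le_normr_Rintegral _ _) _ => //; first exact: cont_integrable.
apply: (@le_trans _ _ (\int[mu]_(x in `[a, b]) (k * `|s - t|))).
  apply: le_Rintegral; [by []|apply: integrable_norm; exact: cont_integrable| |].
    by apply: cont_integrable; exact: contC.
  by move=> x /=; rewrite in_itv/= => xab; exact: Hd.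
rewrite (Rintegral_itv_cst _ ab) mulrAC ler_wpM2r// /k mulrAC ler_pdivrMr// ler_pM2l//.
by rewrite lerDl.
Qed.

End TimeDerivative.

Section PowerLaw.
Variable R : realType.
Implicit Types (a b c e t s x y z r C N : R).

Lemma mean_value (phi phi' : R -> R) x y :
  (forall z, (x <= z <= y) || (y <= z <= x) -> is_derive z 1 phi (phi' z)) ->
  x != y -> exists2 c, (x < c < y) || (y < c < x) &
    phi y - phi x = phi' c * (y - x).
Proof.
wlog xy : x y / x < y => [H D xy|D _].
  have [/H|yx|xy'] := ltgtP x y; [by apply|idtac|by rewrite xy' eqxx in xy].
  have D' z : (y <= z <= x) || (x <= z <= y) -> is_derive z 1 phi (phi' z).
    by rewrite orbC; exact: D.
  have yx' : y != x by rewrite eq_sym.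
  have [c cxy E] := H y x yx D' yx'; exists c; first by rewrite orbC.
  by rewrite -opprB E -mulrN opprB.
have D1 z : x <= z <= y -> is_derive z 1 phi (phi' z) by move=> xzy; apply: D; rewrite xzy.
have Dz z : z \in `]x, y[ -> is_derive z 1 phi (phi' z).
  by rewrite in_itv/= => /andP[xz zy]; apply: D1; rewrite !ltW.
have cz : {within `[x, y], continuous phi}.
  apply: derivable_within_continuous => z; rewrite in_itv/= => xzy.
  by have [] := D1 z xzy.
have [c + E] := MVT xy Dz cz; rewrite in_itv/= => cxy.
by exists c => //; rewrite cxy.
Qed.

Lemma taylor2 (phi phi1 phi2 : R -> R) a b C x y :
  (forall z, a <= z <= b -> is_derive z 1 phi (phi1 z)) ->
  (forall z, a <= z <= b -> is_derive z 1 phi1 (phi2 z)) ->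
  (forall z, a <= z <= b -> `|phi2 z| <= C) ->
  a <= x <= b -> a <= y <= b ->
  `|phi y - phi x - phi1 x * (y - x)| <= C * (y - x) ^+ 2.
Proof.
move=> D1 D2 HC xab yab.
have [<-|xy] := eqVneq x y.
  by rewrite !subrr mulr0 subrr normr0 expr0n mulr0.
have sub u v z : a <= u <= b -> a <= v <= b -> (u <= z <= v) || (v <= z <= u) -> a <= z <= b.
  move=> /andP[au ub] /andP[av vb] /orP[/andP[uz zv]|/andP[vz zu]].
    by rewrite (le_trans au uz) (le_trans zv vb).
  by rewrite (le_trans av vz) (le_trans zu ub).
have lew u v z : (u < z < v) || (v < z < u) -> (u <= z <= v) || (v <= z <= u).
  by move=> /orP[]/andP[/ltW-> /ltW->]; rewrite ?orbT.
have [c cxy ->] := mean_value (fun z zxy => D1 z (sub _ _ _ xab yab zxy)) xy.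
have cab := sub _ _ _ xab yab (lew _ _ _ cxy).
have xc : x != c.
  by case/orP: cxy => /andP[h1 h2]; [rewrite (lt_eqF h1)|rewrite (gt_eqF h2)].
have [d dxc E] := mean_value (fun z zxc => D2 z (sub _ _ _ xab cab zxc)) xc.
have dab := sub _ _ _ xab cab (lew _ _ _ dxc).
rewrite -mulrBl E normrM normrM -mulrA -[(y - x) ^+ 2]real_normK ?num_real// expr2.
apply: ler_pM => //; first exact: HC.
rewrite ler_wpM2r//.
case/orP: cxy => /andP[h1 h2].
  by rewrite !gtr0_norm ?subr_gt0// ?lerD2r ?ltW// (lt_trans h1).
by rewrite !ltr0_norm ?subr_lt0// ?lerN2 ?lerD2r ?ltW// (lt_trans h1).
Qed.

Lemma cont_norm (f : R -> R) : continuous f -> continuous (fun x => `|f x|).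
Proof.
move=> cf x; apply: (@continuous_comp _ _ _ f (fun y => `|y|)); first exact: cf.
exact: norm_continuous.
Qed.

Lemma powR_taylor gamma a b : 0 < a -> exists2 C, 0 <= C &
  forall x y, a <= x <= b -> a <= y <= b ->
  `|y `^ gamma - x `^ gamma - gamma * x `^ (gamma - 1) * (y - x)| <= C * (y - x) ^+ 2.
Proof.
move=> a0.
pose k x := gamma * ((gamma - 1) * (a + `|x - a|) `^ (gamma - 1 - 1)).
have ck : continuous k.
  have : continuous (fun x => (a + `|x - a|) `^ (gamma - 1 - 1)).
    apply: cont_powR => [|x]; last by rewrite ltr_pwDl.
    apply: contD; first exact: contC.
    by apply: cont_norm; cont.
  by move=> h; rewrite /k; cont.
have [C C0 HC] := continuous_itv_bounded a b ck.
exists C => // x y xab yab.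
apply: (@taylor2 (fun x => x `^ gamma) (fun x => gamma * x `^ (gamma - 1)) k a b) => //.
  by move=> z /andP[az _]; apply: is_derive1_powR; exact: lt_le_trans az.
move=> z /andP[az _]; have z0 := lt_le_trans a0 az.
rewrite /k ger0_norm ?subr_ge0// (addrC a) subrK.
by apply: derZ; exact: is_derive1_powR.
Qed.

Definition entropy gamma y := (y `^ gamma - 1 - gamma * (y - 1)) / (gamma - 1).

Lemma entropy1 gamma : entropy gamma 1 = 0.
Proof. by rewrite /entropy powR1 !subrr mulr0 subr0 mul0r. Qed.

Let is_derive_excess gamma th y : 0 < y ->
  is_derive y 1 (fun y => y `^ gamma - 1 - gamma * (y - 1) - th * (y - 1) ^+ 2)
    (gamma * (y `^ (gamma - 1) - 1) - 2 * th * (y - 1)).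
Proof.
move=> y0.
have D1 := derB (der_id y) (der_cst 1 y).
apply: der_eq (derB (derB (derB (is_derive1_powR gamma y0) (der_cst 1 y)) (derZ gamma D1))
  (derZ th (derX 2 D1))) _.
by rewrite /= expr1; ring.
Qed.

Lemma excess_ge gamma th y : 0 < y -> y != 1 ->
  exists2 c, (1 < c < y) || (y < c < 1) &
  y `^ gamma - 1 - gamma * (y - 1) - th * (y - 1) ^+ 2 =
   (gamma * (c `^ (gamma - 1) - 1) - 2 * th * (c - 1)) * (y - 1).
Proof.
move=> y0; rewrite eq_sym => y1.
have D z : (1 <= z <= y) || (y <= z <= 1) ->
  is_derive z 1 (fun y => y `^ gamma - 1 - gamma * (y - 1) - th * (y - 1) ^+ 2)
    (gamma * (z `^ (gamma - 1) - 1) - 2 * th * (z - 1)).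
  move=> zy; apply: is_derive_excess; case/orP: zy => /andP[z1 z2].
    exact: lt_le_trans z1.
  exact: lt_le_trans z1.
have [c cy E] := mean_value D y1; exists c => //.
by rewrite -E powR1 !subrr mulr0 expr0n mulr0 !subr0.
Qed.

Lemma entropy_gt0 gamma y : 1 < gamma -> 0 < y -> y != 1 -> 0 < entropy gamma y.
Proof.
move=> g1 y0 y1; apply: divr_gt0; last by rewrite subr_gt0.
have g0 : 0 < gamma by rewrite (lt_trans _ g1).
have [c cy] := excess_ge gamma 0 y0 y1.
rewrite mulr0 !mul0r !subr0 => ->.
have g10 : 0 < gamma - 1 by rewrite subr_gt0.
move: (gamma - 1) g10 => k k0.
have one : (1 : R) = 1 `^ k by rewrite powR1.
case/orP: cy => /andP[h1 h2].
  rewrite !mulr_gt0// ?subr_gt0 ?(lt_trans h1 h2)//.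
  rewrite [ltLHS]one; apply: gt0_ltr_powR => //; first by rewrite nnegrE.
  by rewrite nnegrE ltW// (lt_trans _ h1).
rewrite nmulr_lgt0 ?subr_lt0 ?(lt_trans h1 h2)// pmulr_rlt0// subr_lt0.
rewrite [ltRHS]one; apply: gt0_ltr_powR => //; last by rewrite nnegrE.
by rewrite nnegrE ltW// (lt_trans _ h1).
Qed.

Lemma entropy_ge0 gamma y : 1 < gamma -> 0 < y -> 0 <= entropy gamma y.
Proof.
move=> g1 y0; have [->|y1] := eqVneq y 1; first by rewrite entropy1.
exact/ltW/entropy_gt0.
Qed.

Lemma powR_near1 gamma e : 0 < e -> exists2 d : R, 0 < d & forall y, `|y - 1| < d ->
  `|y `^ gamma - 1 - gamma * (y - 1)| <= e * `|y - 1|.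
Proof.
move=> e0; have := is_derive1_powR gamma (@ltr01 R).
rewrite powR1 mulr1 => /is_derive1_littleoP/(_ e e0)[d d0 Hd].
exists d => // y /Hd; rewrite powR1 (addrC 1) subrK.
by rewrite (mulrC (y - 1) gamma).
Qed.

(* Near [1], [(y^gamma - 1)^2] is [gamma^2 (y - 1)^2] and the entropy is
   [gamma (y - 1)^2 / 2], up to the factor [5/4]. *)
Lemma pressure_entropy gamma : 1 < gamma -> exists2 d : R, 0 < d < 1 &
  forall y, `|y - 1| < d ->
    (y `^ gamma - 1) ^+ 2 <= 5 / 2 * gamma * entropy gamma y.
Proof.
move=> g1; have g0 : 0 < gamma by rewrite (lt_trans _ g1).
have g10 : 0 < gamma - 1 by rewrite subr_gt0.
have e1 : 0 < gamma / 20 by rewrite divr_gt0.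
have e2 : 0 < (gamma - 1) / 20 by rewrite divr_gt0.
have [d1 d10 H1] := powR_near1 gamma e1.
have [d2 d20 H2] := powR_near1 (gamma - 1) e2.
exists (Num.min (1 / 2) (Num.min d1 d2)).
  rewrite !lt_min d10 d20 !gt_min; apply/andP; split; first by lra.
  by apply/orP; left; lra.
move=> y; rewrite !lt_min => /and3P[yh yd1 yd2].
have [->|y1] := eqVneq y 1; first by rewrite entropy1 powR1 subrr expr0n mulr0.
have y0 : 0 < y by move: yh; rewrite ltr_norml => /andP[? _]; lra.
pose th := 19 / 20 * (gamma * (gamma - 1)) / 2.
have hle : 19 / 40 * gamma * (y - 1) ^+ 2 <= entropy gamma y.
  rewrite /entropy ler_pdivlMr// -subr_ge0.
  have -> : y `^ gamma - 1 - gamma * (y - 1) - 19 / 40 * gamma * (y - 1) ^+ 2 * (gamma - 1) =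
    y `^ gamma - 1 - gamma * (y - 1) - th * (y - 1) ^+ 2 by rewrite /th; field.
  have [c cy ->] := excess_ge gamma th y0 y1.
  have cd : `|c - 1| < d2.
    apply: le_lt_trans yd2; case/orP: cy => /andP[h1 h2].
      by rewrite !gtr0_norm ?subr_gt0 ?lerD2r ?(ltW h2)// (lt_trans h1).
    by rewrite !ltr0_norm ?subr_lt0 ?lerN2 ?lerD2r ?(ltW h1)// (lt_trans h1).
  have := H2 c cd; set X := c `^ (gamma - 1) => hX.
  have -> : gamma * (X - 1) - 2 * th * (c - 1) =
      gamma * (X - 1 - 19 / 20 * (gamma - 1) * (c - 1)) by rewrite /th; field.
  case/orP: cy => /andP[h1 h2].
    have cn : `|c - 1| = c - 1 by rewrite gtr0_norm// subr_gt0.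
    move: hX; rewrite cn ler_norml => /andP[hX _].
    rewrite !mulr_ge0 ?(ltW g0)// ?subr_ge0 ?(ltW (lt_trans h1 h2))//.
    by clearbody X; clear -hX; nra.
  have cn : `|c - 1| = - (c - 1) by rewrite ltr0_norm// subr_lt0.
  move: hX; rewrite cn ler_norml => /andP[_ hX].
  rewrite mulr_le0// ?subr_le0 ?(ltW (lt_trans h1 h2))// pmulr_rle0//.
  by clearbody X; clear -hX; nra.
have hp : `|y `^ gamma - 1| <= 21 / 20 * gamma * `|y - 1|.
  rewrite -[X in `|X|](subrK (gamma * (y - 1))); apply: le_trans (ler_normD _ _) _.
  rewrite normrM (gtr0_norm g0); apply: le_trans (lerD (H1 y yd1) (lexx _)) _.
  by rewrite le_eqVlt; apply/orP; left; apply/eqP; field.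
apply: (@le_trans _ _ ((21 / 20 * gamma * `|y - 1|) ^+ 2)).
  by rewrite -real_normK ?num_real// ler_sqr ?nnegrE// !mulr_ge0 ?(ltW g0).
rewrite exprMn real_normK ?num_real//.
apply: (@le_trans _ _ (5 / 2 * gamma * (19 / 40 * gamma * (y - 1) ^+ 2))); last first.
  by rewrite ler_wpM2l// !mulr_ge0 ?(ltW g0).
rewrite -subr_ge0; have -> : 5 / 2 * gamma * (19 / 40 * gamma * (y - 1) ^+ 2) -
  (21 / 20 * gamma) ^+ 2 * (y - 1) ^+ 2 = 17 / 200 * (gamma ^+ 2 * (y - 1) ^+ 2) by field.
apply: mulr_ge0; first by rewrite divr_ge0.
by apply: mulr_ge0; exact: sqr_ge0.
Qed.

End PowerLaw.

Section UniformRules.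
Variable R : realType.
Implicit Types (f g h : R -> R -> R) (a b c e t s x y z : R).

(* Uniform differentiability in time on [[a, b]] together with continuity in space. *)
Definition CUD a b t f g := [/\ UD a b t f g, continuous (f t) & continuous (g t)].

Lemma CUD_const (k : R -> R) a b t : continuous k -> CUD a b t (fun _ => k) (fun _ _ => 0).
Proof. by move=> ck; split => //; [exact: UD_const|exact: contC]. Qed.

Lemma CUD_D f1 f2 g1 g2 a b t : CUD a b t f1 g1 -> CUD a b t f2 g2 ->
  CUD a b t (fun s x => f1 s x + f2 s x) (fun s x => g1 s x + g2 s x).
Proof.
by move=> [U1 cf1 cg1] [U2 cf2 cg2]; split; [exact: UD_D|cont|cont].
Qed.

Lemma CUD_M f1 f2 g1 g2 a b t : CUD a b t f1 g1 -> CUD a b t f2 g2 ->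
  CUD a b t (fun s x => f1 s x * f2 s x) (fun s x => g1 s x * f2 s x + f1 s x * g2 s x).
Proof.
move=> [U1 cf1 cg1] [U2 cf2 cg2]; split; [|by cont|by cont].
have [N1 N10 H1] := continuous_itv_bounded a b cf1.
have [N2 N20 H2] := continuous_itv_bounded a b cf2.
have [N3 N30 H3] := continuous_itv_bounded a b cg1.
have [N4 N40 H4] := continuous_itv_bounded a b cg2.
apply: (@UD_M _ _ _ _ _ _ _ _ (N1 + N2 + N3 + N4)) => //; first by rewrite !addr_ge0.
move=> x xab; move: (H1 x xab) (H2 x xab) (H3 x xab) (H4 x xab) N10 N20 N30 N40.
by move: `|_| `|_| `|_| `|_|; clear => *; split; lra.
Qed.

Lemma CUD_eq f f' g g' a b t : CUD a b t f g -> (forall s x, f s x = f' s x) ->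
  (forall x, g t x = g' t x) -> CUD a b t f' g'.
Proof.
move=> [U cf cg] ff gg.
have -> : f' = f by apply/funext => s; apply/funext => x; rewrite ff.
have gE : g' t = g t by apply/funext => x; rewrite gg.
split => //; last by rewrite gE.
move=> e e0; have [d d0 Hd] := U e e0; exists d => // s s0 sd x xab.
by rewrite gE; exact: Hd.
Qed.

Lemma CUD_Z f g a b t c : CUD a b t f g ->
  CUD a b t (fun s x => c * f s x) (fun s x => c * g s x).
Proof.
move=> H; apply: CUD_eq (CUD_M (CUD_const a b t (@contC _ c)) H) _ _ => //.
by move=> x; rewrite mul0r add0r.
Qed.

Lemma CUD_powR f g a b t gamma : a <= b -> (forall x, 0 < f t x) -> CUD a b t f g ->
  CUD a b t (fun s x => f s x `^ gamma) (fun s x => gamma * f s x `^ (gamma - 1) * g s x).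
Proof.
move=> ab f0 [U cf cg].
have cp k : continuous (fun x => f t x `^ k) by exact: cont_powR.
split; [|exact: cp|]; last first.
  by have := cp (gamma - 1) => ?; cont.
have [m mab Hm] := EVT_min ab (continuous_subspaceT cf).
have [N N0 HN] := continuous_itv_bounded a b cf.
have [N1 N10 HN1] := continuous_itv_bounded a b cg.
have cp' : continuous (fun x => gamma * f t x `^ (gamma - 1)).
  by have := cp (gamma - 1) => ?; cont.
have [N2 N20 HN2] := continuous_itv_bounded a b cp'.
have m0 := f0 m.
pose lo := f t m / 2.
have lo0 : 0 < lo by rewrite divr_gt0.
have [C C0 HC] := powR_taylor gamma (N + lo) lo0.
apply: (@UD_comp _ (fun y => y `^ gamma) (fun y => gamma * y `^ (gamma - 1)) f g a b t lo C (N1 + N2)) => //.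
- by rewrite addr_ge0.
- by move=> x xab; rewrite (le_trans (HN1 x xab))// lerDl.
- by move=> x xab; rewrite (le_trans (HN2 x xab))// lerDr.
- move=> x y xab; rewrite ler_norml => /andP[y1 y2].
  have h1 : f t m <= f t x by apply: Hm; rewrite in_itv.
  have h2 : f t x <= N by rewrite (le_trans (ler_norm _))// HN.
  have lo2 : f t m = lo + lo by rewrite -splitr.
  by apply: HC; apply/andP; split; move: h1 h2 y1 y2 lo0 lo2; clear; lra.
Qed.

Definition pos z := (z + `|z|) / 2.

Lemma pos_ge0 z : 0 <= pos z.
Proof. by rewrite divr_ge0// -lerBlDl sub0r -normrN ler_norm. Qed.

Lemma posE z : pos z = if 0 <= z then z else 0.
Proof.
rewrite /pos; case: ifPn => z0; first by rewrite ger0_norm// mulrDl -splitr.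
by rewrite ltr0_norm ?ltNge// subrr mul0r.
Qed.

Lemma pos_taylor z y : `|pos y ^+ 2 - pos z ^+ 2 - 2 * pos z * (y - z)| <= 1 * (y - z) ^+ 2.
Proof.
rewrite mul1r !posE; case: (leP 0 y) => y0; case: (leP 0 z) => z0.
- have -> : y ^+ 2 - z ^+ 2 - 2 * z * (y - z) = (y - z) ^+ 2 by ring.
  by rewrite ger0_norm ?sqr_ge0.
- rewrite expr0n mulr0 mul0r !subr0 ger0_norm ?sqr_ge0// ler_sqr ?nnegrE//; first by lra.
  by rewrite subr_ge0; lra.
- rewrite expr0n/= sub0r.
  have zy : 0 <= - (z * y) by rewrite -mulrN mulr_ge0// oppr_ge0 ltW.
  have y2 := sqr_ge0 y; have z2 := sqr_ge0 z.
  by rewrite ler_norml; apply/andP; split; nra.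
- by rewrite mulr0 mul0r !subr0 expr0n subr0 normr0 sqr_ge0.
Qed.

Lemma is_derive_possqr z : is_derive z 1 (fun y => pos y ^+ 2) (2 * pos z).
Proof.
apply/is_derive1_littleoP => e e0; exists e => // h he.
have := pos_taylor z (z + h); rewrite mul1r (addrC z) addrK => H.
rewrite (mulrC h); apply: le_trans H _.
by rewrite -real_normK ?num_real// expr2 ler_wpM2r// ltW.
Qed.

Lemma CUD_possqr f g a b t : CUD a b t f g ->
  CUD a b t (fun s x => pos (f s x) ^+ 2) (fun s x => 2 * pos (f s x) * g s x).
Proof.
move=> [U cf cg].
have cp : continuous (fun x => pos (f t x)).
  rewrite /pos; have := cont_norm cf => ?; cont.
split; [|by cont|by cont].
have [N1 N10 HN1] := continuous_itv_bounded a b cg.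
have cp' : continuous (fun x => 2 * pos (f t x)) by cont.
have [N2 N20 HN2] := continuous_itv_bounded a b cp'.
apply: (@UD_comp _ (fun y => pos y ^+ 2) (fun y => 2 * pos y) f g a b t 1 1 (N1 + N2)) => //.
- by rewrite addr_ge0.
- by move=> x xab; rewrite (le_trans (HN1 x xab))// lerDl.
- by move=> x xab; rewrite (le_trans (HN2 x xab))// lerDr.
- by move=> x y xab _; exact: pos_taylor.
Qed.

Lemma CUD_affine (k : R -> R) a b t t1 c : continuous k ->
  CUD a b t (fun s x => k x - c * (s - t1)) (fun _ _ => - c).
Proof.
move=> ck; split; [|by cont|exact: contC].
move=> e e0; exists 1 => // s s0 _ x _.
have -> : k x - c * (s - t1) - (k x - c * (t - t1)) - (s - t) * - c = 0 by ring.
by rewrite normr0 mulr_ge0// ltW.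
Qed.

End UniformRules.

(** * Energy and finite propagation speed *)

Section Energy.
Variable R : realType.
Variables (tau gamma : R) (rho u S rhot ut St : R -> R -> R).
Implicit Types (a b c e t s x y z : R).
Hypothesis cs : classical_solution tau gamma rho u S rhot ut St.
Hypothesis gamma1 : 1 < gamma.
Hypothesis tau0 : 0 < tau.
Local Notation mu := (leb R).

Definition energy t x := entropy gamma (rho t x) + rho t x * u t x ^+ 2 / 2
  + tau * rho t x * S t x ^+ 2 / 2.

Definition energy_t t x := gamma * (rho t x `^ (gamma - 1) - 1) / (gamma - 1) * rhot t x
  + (rhot t x * u t x ^+ 2 / 2 + rho t x * u t x * ut t x)
  + tau * (rhot t x * S t x ^+ 2 / 2 + rho t x * S t x * St t x).

Definition energy_x t x := gamma * (rho t x `^ (gamma - 1) - 1) / (gamma - 1) * derive1 (rho t) x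
  + (derive1 (rho t) x * u t x ^+ 2 / 2 + rho t x * u t x * derive1 (u t) x)
  + tau * (derive1 (rho t) x * S t x ^+ 2 / 2 + rho t x * S t x * derive1 (S t) x).

Definition flux t x := u t x * (energy t x + (rho t x `^ gamma - 1 - S t x)).

Definition flux_x t x := derive1 (u t) x * (energy t x + (rho t x `^ gamma - 1 - S t x))
  + u t x * (energy_x t x +
     (gamma * rho t x `^ (gamma - 1) * derive1 (rho t) x - derive1 (S t) x)).

Let gam1 : gamma - 1 != 0.
Proof. by rewrite subr_eq0 gt_eqF. Qed.

Lemma cs_rho_cont t : 0 <= t -> continuous (rho t).
Proof. by move=> t0; apply: der_continuous => x; exact: (cs_drho cs). Qed.

Lemma cs_u_cont t : 0 <= t -> continuous (u t).
Proof. by move=> t0; apply: der_continuous => x; exact: (cs_du cs). Qed.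

Lemma cs_S_cont t : 0 <= t -> continuous (S t).
Proof. by move=> t0; apply: der_continuous => x; exact: (cs_dS cs). Qed.

Lemma cs_powR_cont k t : 0 <= t -> continuous (fun x => rho t x `^ k).
Proof. by move=> t0; apply: cont_powR; [exact: cs_rho_cont|move=> x; exact: (cs_pos cs)]. Qed.

Lemma CUD_rho a b t : 0 <= t -> CUD a b t rho rhot.
Proof.
by move=> t0; split; [exact: unif_UD (cs_rhot cs) t0|exact: cs_rho_cont|exact: (cs_crhot cs)].
Qed.

Lemma CUD_u a b t : 0 <= t -> CUD a b t u ut.
Proof.
by move=> t0; split; [exact: unif_UD (cs_ut cs) t0|exact: cs_u_cont|exact: (cs_cut cs)].
Qed.

Lemma CUD_S a b t : 0 <= t -> CUD a b t S St.
Proof.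
by move=> t0; split; [exact: unif_UD (cs_St cs) t0|exact: cs_S_cont|exact: (cs_cSt cs)].
Qed.

Lemma CUD_energy a b t : a <= b -> 0 <= t -> CUD a b t energy energy_t.
Proof.
move=> ab t0; have Ur := CUD_rho a b t0; have Uu := CUD_u a b t0; have US := CUD_S a b t0.
have Up := CUD_powR gamma ab (fun x => cs_pos cs x t0) Ur.
have C k := CUD_const a b t (@contC R k).
have Ue := CUD_Z (gamma - 1)^-1 (CUD_D Up (CUD_D (C (gamma - 1)) (CUD_Z (- gamma) Ur))).
have H := CUD_D (CUD_D Ue (CUD_Z 2^-1 (CUD_M Ur (CUD_M Uu Uu))))
  (CUD_Z (tau / 2) (CUD_M Ur (CUD_M US US))).
apply: CUD_eq H _ _ => [s x|x].
  by rewrite /energy /entropy; field.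
by rewrite /energy_t; field.
Qed.

Lemma is_derive_energy t x : 0 <= t -> is_derive x 1 (energy t) (energy_x t x).
Proof.
move=> t0; have Dr := cs_drho cs x t0; have Du := cs_du cs x t0; have DS := cs_dS cs x t0.
have Dp := dercomp Dr (is_derive1_powR gamma (cs_pos cs x t0)).
have C k := der_cst k x.
have De := derZ (gamma - 1)^-1 (derD Dp (derD (C (gamma - 1)) (derZ (- gamma) Dr))).
have H := derD (derD De (derZ 2^-1 (derM Dr (derM Du Du))))
  (derZ (tau / 2) (derM Dr (derM DS DS))).
have H' := der_eq H (_ : _ = energy_x t x).
apply: der_ext (H' _) _ => [|y].
  by rewrite /energy_x; field.
by rewrite /energy /entropy; field.
Qed.

Lemma is_derive_flux t x : 0 <= t -> is_derive x 1 (flux t) (flux_x t x).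
Proof.
move=> t0; have Dr := cs_drho cs x t0; have Du := cs_du cs x t0; have DS := cs_dS cs x t0.
have Dp := dercomp Dr (is_derive1_powR gamma (cs_pos cs x t0)).
have De := is_derive_energy x t0.
apply: der_eq (derM Du (derD De (derB (derB Dp (der_cst 1 x)) DS))) _.
by rewrite /flux_x subr0.
Qed.

Lemma energy_x_cont t : 0 <= t -> continuous (energy_x t).
Proof.
move=> t0; have c1 := cs_rho_cont t0; have c2 := cs_u_cont t0; have c3 := cs_S_cont t0.
have c4 := cs_crho cs t0; have c5 := cs_cu cs t0; have c6 := cs_cS cs t0.
have c7 := @cs_powR_cont (gamma - 1) t t0; rewrite /energy_x; cont.
Qed.

Lemma energy_cont t : 0 <= t -> continuous (energy t).
Proof. by move=> t0; apply: der_continuous => x; exact: is_derive_energy. Qed.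

Lemma flux_cont t : 0 <= t -> continuous (flux t).
Proof. by move=> t0; apply: der_continuous => x; exact: is_derive_flux. Qed.

Lemma flux_x_cont t : 0 <= t -> continuous (flux_x t).
Proof.
move=> t0; have c1 := cs_rho_cont t0; have c2 := cs_u_cont t0; have c3 := cs_S_cont t0.
have c4 := cs_crho cs t0; have c5 := cs_cu cs t0; have c6 := cs_cS cs t0.
have c7 := @cs_powR_cont (gamma - 1) t t0; have c8 := @cs_powR_cont gamma t t0.
have c9 := energy_cont t0; have c10 := energy_x_cont t0; rewrite /flux_x; cont.
Qed.

Lemma powR_mull y : 0 < y -> y `^ gamma = y * y `^ (gamma - 1).
Proof.
move=> y0; rewrite -[X in X * _](powRr1 (ltW y0)) -powRD; last by rewrite (gt_eqF y0) implybT.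
by rewrite addrC subrK.
Qed.

Lemma energy_identity t x : 0 <= t -> energy_t t x + flux_x t x = - S t x ^+ 2.
Proof.
move=> t0; have := cs_mass cs x t0; have := cs_momentum cs x t0; have := cs_stress cs x t0.
have := powR_mull (cs_pos cs x t0).
rewrite /energy_t /flux_x /energy_x /energy /entropy => ->.
move: (rho t x `^ (gamma - 1)) => Q.
move: (rhot t x) (ut t x) (St t x) (derive1 (rho t) x)
  (derive1 (u t) x) (derive1 (S t) x) (rho t x) (u t x) (S t x).
move=> rt v_t s_t rx ux sx r v s E3 E2 E1.
pose A := gamma * (Q - 1) / (gamma - 1) + v ^+ 2 / 2 + tau * s ^+ 2 / 2.
have e1 : A * (rt + (rx * v + r * ux)) = 0 by rewrite E1 mulr0.
have e2 : v * (r * v_t + r * v * ux + gamma * Q * rx - sx) = 0 by rewrite E2 subrr mulr0.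
have e3 : s * (tau * r * (s_t + v * sx) - ux + s) = 0 by rewrite E3 addNr mulr0.
apply/eqP; rewrite -subr_eq0 opprK; apply/eqP.
rewrite -[RHS]addr0 -[RHS]addr0 -{1}e1 -{1}e2 -e3 /A.
by field.
Qed.

End Energy.

Lemma cone_sub (R : realFieldType) (a b x k k' : R) : k' <= k ->
  a + k < x < b - k -> a + k' < x < b - k'.
Proof. by move=> kk /andP[ax xb]; apply/andP; split; lra. Qed.

Lemma half_sub_lt (R : realFieldType) (s s' r : R) : 0 < r -> s - r / 2 <= s' -> s - s' < r.
Proof. by move=> r0 h; lra. Qed.

Section FiniteSpeed.
Variable R : realType.
Variables (tau gamma : R) (rho u S rhot ut St : R -> R -> R).
Implicit Types (a b c e t s x y z : R).
Hypothesis cs : classical_solution tau gamma rho u S rhot ut St.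
Hypothesis gamma1 : 1 < gamma.
Hypothesis tau0 : 0 < tau.
Local Notation mu := (leb R).
Local Notation energy := (energy tau gamma rho u S).
Local Notation flux := (flux tau gamma rho u S).
Local Notation energy_t := (energy_t tau gamma rho u S rhot ut St).
Local Notation flux_x := (flux_x tau gamma rho u S).

Lemma energy_ge t x : 0 <= t ->
  [/\ 0 <= entropy gamma (rho t x), 0 <= rho t x * u t x ^+ 2 / 2 &
      0 <= tau * rho t x * S t x ^+ 2 / 2].
Proof.
move=> t0; have r0 := cs_pos cs x t0; split; first exact: entropy_ge0.
  by rewrite divr_ge0// mulr_ge0 ?sqr_ge0// ltW.
by rewrite divr_ge0// mulr_ge0 ?sqr_ge0// mulr_ge0// ltW.
Qed.

Lemma energy_ge0 t x : 0 <= t -> 0 <= energy t x.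
Proof. by move=> /energy_ge-/(_ x)[? ? ?]; rewrite !addr_ge0. Qed.

Definition rest t x := [/\ rho t x = 1, u t x = 0 & S t x = 0].

Lemma energy_eq0 t x : 0 <= t -> energy t x = 0 <-> rest t x.
Proof.
move=> t0; have r0 := cs_pos cs x t0; have [e0 k0 s0] := energy_ge x t0.
split=> [|[r1 u1 s1]]; last first.
  by rewrite /energy r1 u1 s1 entropy1 expr0n/= !(mulr0, mul0r, addr0).
move/eqP; rewrite /energy paddr_eq0 ?addr_ge0// paddr_eq0// => /andP[/andP[h1 h2] h3].
split.
- apply/eqP; apply: contraTT h1 => r1.
  by rewrite gt_eqF// entropy_gt0.
- by apply/eqP; move: h2; rewrite !mulf_eq0 invr_eq0 pnatr_eq0 (gt_eqF r0) orbF/= orbb.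
- apply/eqP; move: h3; rewrite !mulf_eq0 invr_eq0 pnatr_eq0 (gt_eqF r0) (gt_eqF tau0).
  by rewrite /= orbF orbb.
Qed.

(* Linearized at rest, the flux is bounded by [sigma] times the energy; the factor
   [3/2] absorbs the nonlinear terms. *)
Lemma flux_bound sigma : 0 < sigma -> sigma ^+ 2 = gamma + tau^-1 ->
  exists2 d : R, 0 < d & forall t x, 0 <= t -> `|rho t x - 1| < d -> `|u t x| < d ->
    `|flux t x| <= 3 / 2 * sigma * energy t x.
Proof.
move=> s0 sE; have g0 : 0 < gamma by rewrite (lt_trans _ gamma1).
have [d /andP[d0 d1] Hd] := pressure_entropy gamma1.
exists (Num.min (Num.min d (1 / 5)) (sigma / 4)).
  by rewrite !lt_min d0 !divr_gt0.
move=> t x t0; rewrite !lt_min => /andP[/andP[rd r5] _] /andP[_ us].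
have [e0 k0 q0] := energy_ge x t0; have en0 := energy_ge0 x t0.
have hp := Hd _ rd.
have r45 : 4 / 5 <= rho t x by move: r5; rewrite ltr_norml => /andP[? _]; lra.
rewrite /flux normrM.
set X := rho t x `^ gamma - 1 - S t x.
set en := energy t x in en0 *.
have enE : entropy gamma (rho t x) + 2 / 5 * u t x ^+ 2 + 2 / 5 * (tau * S t x ^+ 2) <= en.
  have h1 : 0 <= (rho t x - 4 / 5) * u t x ^+ 2 by rewrite mulr_ge0 ?sqr_ge0// subr_ge0.
  have h2 : 0 <= (rho t x - 4 / 5) * (tau * S t x ^+ 2).
    by rewrite mulr_ge0 ?subr_ge0// mulr_ge0 ?sqr_ge0// ltW.
  rewrite /en /energy -subr_ge0.
  have -> : entropy gamma (rho t x) + rho t x * u t x ^+ 2 / 2 + tau * rho t x * S t x ^+ 2 / 2 -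
   (entropy gamma (rho t x) + 2 / 5 * u t x ^+ 2 + 2 / 5 * (tau * S t x ^+ 2)) =
   ((rho t x - 4 / 5) * u t x ^+ 2 + (rho t x - 4 / 5) * (tau * S t x ^+ 2)) / 2 by field.
  by rewrite divr_ge0// addr_ge0.
have X2 : X ^+ 2 <= sigma ^+ 2 * ((rho t x `^ gamma - 1) ^+ 2 / gamma + tau * S t x ^+ 2).
  rewrite sE /X -subr_ge0; set p := rho t x `^ gamma - 1.
  have -> : (gamma + tau^-1) * (p ^+ 2 / gamma + tau * S t x ^+ 2) - (p - S t x) ^+ 2 =
    (p + gamma * tau * S t x) ^+ 2 / (gamma * tau).
    by field; rewrite !gt_eqF.
  by rewrite divr_ge0 ?sqr_ge0// mulr_ge0// ltW.
have P2 : (rho t x `^ gamma - 1) ^+ 2 / gamma <= 5 / 2 * entropy gamma (rho t x).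
  by rewrite ler_pdivrMr// mulrAC.
have uX : `|u t x| * `|X| <= sigma / 2 * (u t x ^+ 2 + 5 / 2 * entropy gamma (rho t x) + tau * S t x ^+ 2).
  have s20 : 0 < 2 * sigma by rewrite mulr_gt0.
  rewrite -(ler_pM2l s20).
  apply: (@le_trans _ _ (sigma ^+ 2 * u t x ^+ 2 + X ^+ 2)).
    rewrite -(real_normK (num_real (u t x))) -(real_normK (num_real X)) -subr_ge0.
    have -> : sigma ^+ 2 * `|u t x| ^+ 2 + `|X| ^+ 2 - 2 * sigma * (`|u t x| * `|X|) =
      (sigma * `|u t x| - `|X|) ^+ 2 by ring.
    exact: sqr_ge0.
  have h : sigma ^+ 2 * ((rho t x `^ gamma - 1) ^+ 2 / gamma + tau * S t x ^+ 2) <=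
    sigma ^+ 2 * (5 / 2 * entropy gamma (rho t x) + tau * S t x ^+ 2).
    by rewrite ler_wpM2l ?sqr_ge0// lerD2r.
  have {X2}h := le_trans X2 h.
  apply: le_trans (lerD (lexx (sigma ^+ 2 * u t x ^+ 2)) h) _.
  by rewrite le_eqVlt; apply/orP; left; apply/eqP; field.
have bX : sigma / 2 * (u t x ^+ 2 + 5 / 2 * entropy gamma (rho t x) + tau * S t x ^+ 2) <=
   5 / 4 * sigma * en.
  have : sigma * (5 / 4) * (entropy gamma (rho t x) + 2 / 5 * u t x ^+ 2 + 2 / 5 * (tau * S t x ^+ 2)) <=
    sigma * (5 / 4) * en by rewrite ler_wpM2l// mulr_ge0// ltW.
  by rewrite (mulrC (5 / 4)) => /(le_trans _); apply; rewrite le_eqVlt; apply/orP; left; apply/eqP; field.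
have ue : `|u t x| * en <= sigma / 4 * en by rewrite ler_wpM2r// ltW.
apply: (@le_trans _ _ (`|u t x| * en + `|u t x| * `|X|)).
  rewrite -mulrDr ler_wpM2l//; apply: le_trans (ler_normD _ _) _.
  by rewrite -/en (ger0_norm en0).
apply: le_trans (lerD ue (le_trans uX bX)) _.
by rewrite le_eqVlt; apply/orP; left; apply/eqP; field.
Qed.

(* The energy of a truncated light cone, with the weight [w] cutting it off in a
   [C^1] way, does not increase. *)
Lemma domain_dependence t1 t2 a b c : 0 <= t1 -> t1 <= t2 -> a <= b -> 0 <= c ->
  (forall t x, t1 <= t <= t2 -> a < x < b -> `|flux t x| <= c * energy t x) ->
  (forall x, a < x < b -> energy t1 x = 0) ->
  forall x, a + c * (t2 - t1) < x < b - c * (t2 - t1) -> energy t2 x = 0.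
Proof.
move=> t10 t12 ab c0 Hf He.
pose l s x := (x - a) - c * (s - t1); pose r s x := (b - x) - c * (s - t1).
pose w s x := pos (l s x) ^+ 2 * pos (r s x) ^+ 2.
pose wt s x := 2 * pos (l s x) * (- c) * pos (r s x) ^+ 2 +
  pos (l s x) ^+ 2 * (2 * pos (r s x) * (- c)).
pose wx s x := 2 * pos (l s x) * pos (r s x) ^+ 2 - pos (l s x) ^+ 2 * (2 * pos (r s x)).
have Ul t : CUD a b t l (fun _ _ => - c) by apply: CUD_affine; cont.
have Ur t : CUD a b t r (fun _ _ => - c) by apply: CUD_affine; cont.
have Uw t : CUD a b t w wt by exact: CUD_M (CUD_possqr (Ul t)) (CUD_possqr (Ur t)).
have Uwe t (t0 : 0 <= t) : CUD a b t (fun s x => w s x * energy s x)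
    (fun s x => wt s x * energy s x + w s x * energy_t s x).
  exact: CUD_M (Uw t) (CUD_energy cs gamma1 ab t0).
have Dw t x : is_derive x 1 (w t) (wx t x).
  have Dl := derB (derB (der_id x) (der_cst a x)) (der_cst (c * (t - t1)) x).
  have Dr := derB (derB (der_cst b x) (der_id x)) (der_cst (c * (t - t1)) x).
  apply: der_eq (derM (dercomp Dl (is_derive_possqr (l t x))) (dercomp Dr (is_derive_possqr (r t x)))) _.
  by rewrite /wx; ring.
have w0 t x : 0 <= w t x by rewrite mulr_ge0 ?sqr_ge0.
have posN y : y <= 0 -> pos y = 0.
  by move=> y0; rewrite posE; case: ifPn => // y0'; apply/eqP; rewrite eq_le y0.
have la t x : t1 <= t -> x <= a -> pos (l t x) = 0.
  move=> tt1 xa; apply: posN; rewrite /l subr_le0; apply: (@le_trans _ _ 0).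
    by rewrite subr_le0.
  by rewrite mulr_ge0// subr_ge0.
have rb t x : t1 <= t -> b <= x -> pos (r t x) = 0.
  move=> tt1 xa; apply: posN; rewrite /r subr_le0; apply: (@le_trans _ _ 0).
    by rewrite subr_le0.
  by rewrite mulr_ge0// subr_ge0.
pose D t := \int[mu]_(x in `[a, b]) (wt t x * energy t x + w t x * energy_t t x).
have I12 : \int[mu]_(x in `[a, b]) (w t2 x * energy t2 x) <=
           \int[mu]_(x in `[a, b]) (w t1 x * energy t1 x).
  apply: (@time_der_nonincr _ (fun s => \int[mu]_(x in `[a, b]) (w s x * energy s x)) D) => //.
    move=> t /andP[tt1 _]; have t0 := le_trans t10 tt1.
    have [U cwe cwet] := Uwe t t0.
    apply: (@UD_integral _ a b t (fun s x => w s x * energy s x)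
      (fun s x => wt s x * energy s x + w s x * energy_t s x)) => // s s0.
    by have [] := Uwe s s0.
  move=> t /andP[tt1 tt2]; have t0 := le_trans t10 tt1.
  have [_ cw cwt] := Uw t.
  have ce := energy_cont cs gamma1 t0; have cq := flux_cont cs gamma1 t0.
  have cqx := flux_x_cont cs gamma1 t0; have cS := cs_S_cont cs t0.
  have [_ cl _] := Ul t; have [_ cr _] := Ur t.
  have cwx : continuous (wx t).
    have pl := cont_norm cl; have pr := cont_norm cr.
    by rewrite /wx /pos; cont.
  have D1 x : is_derive x 1 (fun x => w t x * flux t x) (wx t x * flux t x + w t x * flux_x t x).
    exact: derM (Dw t x) (is_derive_flux cs gamma1 x t0).
  have cD : continuous (fun x => wx t x * flux t x + w t x * flux_x t x) by cont.
  have := Rintegral_FTC2 ab D1 cD.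
  have -> : w t b * flux t b - w t a * flux t a = 0.
    by rewrite /w (la t a)// (rb t b)// expr0n/= !(mulr0, mul0r) subrr.
  move=> Z; rewrite -[D t]addr0 -[X in _ + X <= _]Z -RintegralD//; first last.
  - exact: cont_integrable.
  - by apply: cont_integrable; have [_ _] := Uwe t t0.
  apply: (@le_trans _ _ (\int[mu]_(x in `[a, b]) 0)); last by rewrite Rintegral_itv_cst// mul0r.
  have cet := (Uwe t t0); case: cet => _ _ cet.
  apply: le_Rintegral; [by []| |by apply: cont_integrable; exact: contC|].
    by apply: cont_integrable; exact: contD cet cD.
  move=> x; rewrite /= in_itv/= => /andP[ax xb].
  have -> : wt t x * energy t x + w t x * energy_t t x + (wx t x * flux t x + w t x * flux_x t x) =
    wt t x * energy t x + wx t x * flux t x + w t x * (energy_t t x + flux_x t x) by ring.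
  rewrite energy_identity//.
  have [xa|xa] := leP x a.
    by rewrite /wt /wx /w la// expr0n/= !(mulr0, mul0r, subr0, addr0).
  have [bx|bx] := leP b x.
    by rewrite /wt /wx /w rb// expr0n/= !(mulr0, mul0r, subr0, addr0).
  have tt : t1 <= t <= t2 by rewrite tt1.
  have xx : a < x < b by rewrite xa.
  have := Hf t x tt xx; rewrite ler_norml => /andP[f1 f2].
  have h0 : 0 <= w t x * S t x ^+ 2 by rewrite mulr_ge0 ?sqr_ge0.
  pose A := 2 * pos (l t x) * pos (r t x) ^+ 2; pose B := pos (l t x) ^+ 2 * (2 * pos (r t x)).
  have A0 : 0 <= A by rewrite mulr_ge0 ?sqr_ge0// mulr_ge0 ?pos_ge0.
  have B0 : 0 <= B by rewrite mulr_ge0 ?sqr_ge0// mulr_ge0 ?pos_ge0.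
  have -> : wt t x = - c * (A + B) by rewrite /wt /A /B; ring.
  have -> : wx t x = A - B by [].
  have h1 : 0 <= A * (c * energy t x - flux t x) by rewrite mulr_ge0// subr_ge0.
  have h2 : 0 <= B * (flux t x + c * energy t x) by rewrite mulr_ge0// -lerBlDr sub0r.
  rewrite -oppr_ge0.
  have -> : - (- c * (A + B) * energy t x + (A - B) * flux t x + w t x * - S t x ^+ 2) =
    A * (c * energy t x - flux t x) + B * (flux t x + c * energy t x) + w t x * S t x ^+ 2 by ring.
  by rewrite !addr_ge0.
have I1 : \int[mu]_(x in `[a, b]) (w t1 x * energy t1 x) = 0.
  rewrite /Rintegral integral0_eq// => x /=; rewrite in_itv/= => /andP[ax xb]; congr EFin.
  have [xa|xa] := leP x a; first by rewrite /w la// expr0n/= !mul0r.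
  have [bx|bx] := leP b x; first by rewrite /w rb// expr0n/= mulr0 mul0r.
  by rewrite He ?xa// mulr0.
have t20 := le_trans t10 t12.
move=> x /andP[xa xb]; rewrite I1 in I12.
have h0 : 0 <= c * (t2 - t1) by rewrite mulr_ge0// subr_ge0.
have xab : a < x < b.
  have xk : a + c * (t2 - t1) < x < b - c * (t2 - t1) by rewrite xa.
  by have := cone_sub h0 xk; rewrite addr0 subr0.
have cwe : continuous (fun x => w t2 x * energy t2 x) by have [] := Uwe t2 t20.
have we0 y : a <= y <= b -> 0 <= w t2 y * energy t2 y by move=> _; rewrite mulr_ge0// energy_ge0.
have lx : 0 < l t2 x by rewrite /l -addrA -opprD subr_gt0.
have rx : 0 < r t2 x by rewrite /r addrAC subr_gt0.
have wx0 : 0 < w t2 x by rewrite mulr_gt0// exprn_gt0// posE ltW.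
have /eqP := integral_continuous_ge0_eq0 cwe we0 I12 xab.
by rewrite mulf_eq0 (gt_eqF wx0)/= => /eqP.
Qed.

Lemma time_continuous (f g : R -> R -> R) a b t e : CUD a b t f g -> 0 < e ->
  exists2 d : R, 0 < d & forall s, 0 <= s -> `|s - t| < d -> forall x, a <= x <= b ->
    `|f s x - f t x| < e.
Proof.
move=> [U _ cg] e0; have [N N0 HN] := continuous_itv_bounded a b cg.
have [d d0 Hd] := UD_lipschitz U HN N0.
have N1 : 0 < N + 1 by rewrite ltr_wpDl.
exists (Num.min d (e / (N + 1))); first by rewrite lt_min d0 divr_gt0.
move=> s s0; rewrite lt_min => /andP[sd se] x xab.
by apply: le_lt_trans (Hd s s0 sd x xab) _; rewrite mulrC -ltr_pdivlMr.
Qed.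

(* Continuity in time only gives smallness for a short while; real induction iterates
   [domain_dependence] over such short steps. *)
Lemma finite_speed sigma c a b t : 0 < sigma -> sigma ^+ 2 = gamma + tau^-1 ->
  3 / 2 * sigma <= c -> (forall x, a < x < b -> rest 0 x) -> 0 <= t ->
  forall x, a + c * t < x < b - c * t -> rest t x.
Proof.
move=> s0 sE sc H0 t0.
have c0 : 0 <= c by apply: le_trans sc; rewrite mulr_ge0// ltW.
have [d d0 Hd] := flux_bound s0 sE.
apply: (@real_induction _ 0 t (fun t => forall x, a + c * t < x < b - c * t -> rest t x)) => //.
- by rewrite mulr0 addr0 subr0.
- move=> s /andP[s00 st] IH x xs; have s0' := ltW s00.
  have key (f g : R -> R -> R) k : CUD a b s f g ->
      (forall s', 0 <= s' < s -> f s' x = k) -> f s x = k.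
    move=> Uf Hk; apply: ler_norm_eps => e e0.
    have [r r0 Hr] := time_continuous Uf e0.
    pose s' := Num.max 0 (s - r / 2).
    have s's : s' < s by rewrite gt_max s00/= ltrBlDr ltrDl divr_gt0.
    have s'0 : 0 <= s' by rewrite le_max lexx.
    have h1 : s - r / 2 <= s' by rewrite le_max lexx orbT.
    have s'r : `|s' - s| < r.
      by rewrite distrC gtr0_norm ?subr_gt0//; exact: half_sub_lt.
    have xab : a <= x <= b.
      have h2 : 0 <= c * s by rewrite mulr_ge0.
      by have := cone_sub h2 xs; rewrite addr0 subr0 => /andP[/ltW-> /ltW->].
    have := Hr s' s'0 s'r x xab.
    by rewrite Hk ?s'0// distrC => /ltW.
  have Hs' s' : 0 <= s' < s -> rest s' x.
    move=> /[dup] s's /andP[s'0 /ltW s's']; apply: IH => //.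
    have h2 : c * s' <= c * s by rewrite ler_wpM2l.
    exact: cone_sub h2 xs.
  split.
  + by apply: key (CUD_rho cs a b s0') _ => s' /Hs'[].
  + by apply: key (CUD_u cs a b s0') _ => s' /Hs'[].
  + by apply: key (CUD_S cs a b s0') _ => s' /Hs'[].
- move=> s /andP[s00 st] IH.
  have [r1 r10 Hr] := time_continuous (CUD_rho cs a b s00) d0.
  have [r2 r20 Hu] := time_continuous (CUD_u cs a b s00) d0.
  exists (Num.min r1 r2); first by rewrite lt_min r10.
  move=> s' /andP[ss']; rewrite addrC -ltrBlDr lt_min => /andP[s'1 s'2] _ x xs'.
  have s'0 := le_trans s00 (ltW ss').
  have cs0 : 0 <= c * s by rewrite mulr_ge0.
  have cs1 : c * s <= c * s' by rewrite ler_wpM2l// ltW.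
  apply/energy_eq0 => //.
  apply: (@domain_dependence s s' (a + c * s) (b - c * s) c) => //.
  + exact: ltW.
  + by have /andP[h1 h2] := cone_sub cs1 xs'; exact: ltW (lt_trans h1 h2).
  + move=> t' y /andP[st' t's'] ys.
    have t'0 := le_trans s00 st'.
    have ts : `|t' - s| = t' - s by rewrite ger0_norm// subr_ge0.
    have yab : a <= y <= b.
      by have := cone_sub cs0 ys; rewrite addr0 subr0 => /andP[/ltW-> /ltW->].
    have t'1 : `|t' - s| < r1 by rewrite ts (le_lt_trans _ s'1)// lerD2r.
    have t'2 : `|t' - s| < r2 by rewrite ts (le_lt_trans _ s'2)// lerD2r.
    have [R1 U0 _] := IH y ys.
    have := Hr t' t'0 t'1 y yab; rewrite R1 => h1.
    have := Hu t' t'0 t'2 y yab; rewrite U0 subr0 => h2.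
    apply: le_trans (Hd t' y t'0 h1 h2) _.
    by rewrite ler_wpM2r// energy_ge0.
  + by move=> y ys; apply/energy_eq0 => //; exact: IH.
  + have -> : a + c * s + c * (s' - s) = a + c * s' by ring.
    by have -> : b - c * s - c * (s' - s) = b - c * s' by ring.
Qed.

End FiniteSpeed.

(** * Riccati blow-up of the moment *)

(* Dropping the squares [r (v - k x)^2] and [(l s - 1)^2 / (2 l)]; integrated in [x]
   with the optimal [k], this plays the role of the Cauchy-Schwarz inequality. *)
Lemma quad_lower (R : realFieldType) (r v x y k p s l g : R) : 0 < r -> 0 < l ->
  - y <= x <= y -> g * (r - 1) <= p - 1 ->
  2 * k * (x * (r * v)) + ((g - k ^+ 2 * y ^+ 2) * (r - 1) + - (k ^+ 2 * y ^+ 2)) <=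
  r * v ^+ 2 + (p - 1) - s + (l / 2 * s ^+ 2 + (2 * l)^-1).
Proof.
move=> r0 l0 /andP[yx xy] gp.
have h1 : 0 <= r * (v - k * x) ^+ 2 by rewrite mulr_ge0 ?sqr_ge0// ltW.
have h2 : 0 <= (y - x) * (y + x) by rewrite mulr_ge0 ?subr_ge0// -lerBlDl sub0r.
have h3 : 0 <= k ^+ 2 * r * ((y - x) * (y + x)) by rewrite mulr_ge0// mulr_ge0 ?sqr_ge0// ltW.
have h4 : 0 <= (l * s - 1) ^+ 2 / (2 * l) by rewrite divr_ge0 ?sqr_ge0// mulr_ge0// ltW.
rewrite -subr_ge0.
have -> : r * v ^+ 2 + (p - 1) - s + (l / 2 * s ^+ 2 + (2 * l)^-1) -
   (2 * k * (x * (r * v)) + ((g - k ^+ 2 * y ^+ 2) * (r - 1) + - (k ^+ 2 * y ^+ 2))) =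
  r * (v - k * x) ^+ 2 + k ^+ 2 * r * ((y - x) * (y + x)) + (l * s - 1) ^+ 2 / (2 * l)
  + (p - 1 - g * (r - 1)) by field; rewrite gt_eqF.
have h5 : 0 <= p - 1 - g * (r - 1) by rewrite subr_ge0.
exact: addr_ge0 (addr_ge0 (addr_ge0 h1 h3) h4) h5.
Qed.

Section TimeRules.
Variable R : realType.
Implicit Types (I J : R -> R) (a b c d e t s x y z : R).

Lemma time_der_CUD I t d : time_der I t d <-> CUD 0 0 t (fun s _ => I s) (fun _ _ => d).
Proof.
split=> [H|[H _ _] e e0].
  split; [|exact: contC|exact: contC].
  by move=> e e0; have [r r0 Hr] := H e e0; exists r => // s s0 sr x _; exact: Hr.
have [r r0 Hr] := H e e0; exists r => // s s0 sr.
by apply: (Hr s s0 sr 0); rewrite lexx.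
Qed.

Lemma time_der_D I J t c d : time_der I t c -> time_der J t d ->
  time_der (fun s => I s + J s) t (c + d).
Proof. by move=> /time_der_CUD H1 /time_der_CUD H2; apply/time_der_CUD; exact: CUD_D H1 H2. Qed.

Lemma time_der_Z I t c k : time_der I t c -> time_der (fun s => k * I s) t (k * c).
Proof. by move=> /time_der_CUD H1; apply/time_der_CUD; exact: CUD_Z k H1. Qed.

Lemma time_der_M I J t c d : time_der I t c -> time_der J t d ->
  time_der (fun s => I s * J s) t (c * J t + I t * d).
Proof. by move=> /time_der_CUD H1 /time_der_CUD H2; apply/time_der_CUD; exact: CUD_M H1 H2. Qed.

Lemma time_der_powR I t c k : time_der I t c -> 0 < I t ->
  time_der (fun s => I s `^ k) t (k * I t `^ (k - 1) * c).
Proof.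
move=> /time_der_CUD H I0; apply/time_der_CUD.
by apply: CUD_eq (CUD_powR k (lexx 0) (fun=> I0) H) _ _.
Qed.

Lemma time_der_affine t b c : time_der (fun s => b + c * s) t c.
Proof.
move=> e e0; exists 1 => // s _ _.
have -> : b + c * s - (b + c * t) - (s - t) * c = 0 by ring.
by rewrite normr0 mulr_ge0// ltW.
Qed.

Lemma time_der_cst t c : time_der (fun=> c) t 0.
Proof. by move=> e e0; exists 1 => // s _ _; rewrite subrr mulr0 subrr normr0 mulr_ge0// ltW. Qed.

Lemma time_der_eq I J t c d : time_der I t c -> I =1 J -> c = d -> time_der J t d.
Proof. by move=> + /funext <- <-. Qed.

Lemma powRN_nat a n : 0 <= a -> a `^ (- n%:R) = (a ^+ n)^-1.
Proof. by move=> a0; rewrite powRN powR_mulrn. Qed.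

End TimeRules.

Section BlowUp.
Variable R : realType.
Variables (tau gamma : R) (rho u S rhot ut St : R -> R -> R).
Variables (sigma st m M : R).
Implicit Types (a b e t s x z : R).
Hypothesis cs : classical_solution tau gamma rho u S rhot ut St.
Hypothesis gamma1 : 1 < gamma.
Hypothesis tau0 : 0 < tau.
Hypothesis sigma0 : 0 < sigma.
Hypothesis sigmaE : sigma ^+ 2 = gamma + tau^-1.
Hypothesis sigma_st : sigma <= st.
Hypothesis M0 : 0 < M.
Hypothesis m1 : 1 <= m.
Hypothesis st_m : 1 <= 8 * m * st ^+ 2.
Hypothesis rest0 : forall x, M < `|x| -> rest rho u S 0 x.
Hypothesis rho0m : forall x, rho 0 x <= m.
Local Notation mu := (leb R).
Local Notation energy := (energy tau gamma rho u S).
Local Notation energy_t := (energy_t tau gamma rho u S rhot ut St).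
Local Notation rest := (rest rho u S).

(* Up to time [t0], when [y] has grown from [M] to [2 M], the solution is at rest
   outside [[- y t, y t]]. *)
Let c := 3 / 2 * st.
Let y t := M + c * t.
Let A := 2 * M + 1.
Let t0 := M / c.

Let st0 : 0 < st. Proof. exact: lt_le_trans sigma0 sigma_st. Qed.
Let c0 : 0 < c. Proof. by rewrite mulr_gt0. Qed.
Let t00 : 0 < t0. Proof. by rewrite divr_gt0. Qed.

Let yt t : 0 <= t <= t0 -> M <= y t <= 2 * M.
Proof.
move=> /andP[tp tt0]; rewrite /y lerDl mulr_ge0 ?(ltW c0)//=.
by rewrite mulr2n mulrDl mul1r lerD2l mulrC -ler_pdivlMr.
Qed.

Let rest_out t x : 0 <= t -> y t < `|x| -> rest t x.
Proof.
move=> tp; rewrite /y => yx.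
have sc : 3 / 2 * sigma <= c by rewrite /c ler_wpM2l// divr_ge0.
have [x0|x0] := leP 0 x.
  rewrite ger0_norm// in yx.
  apply: (finite_speed cs gamma1 tau0 (a := M) (b := x + c * t + 1) sigma0 sigmaE sc) => //.
    by move=> z /andP[Mz _]; apply: rest0; rewrite (lt_le_trans Mz)// ler_norm.
  by rewrite yx/= addrAC addrK ltrDl.
rewrite ltr0_norm// in yx.
apply: (finite_speed cs gamma1 tau0 (a := x - c * t - 1) (b := - M) sigma0 sigmaE sc) => //.
  by move=> z /andP[_ zM]; apply: rest0; rewrite ltrNr in zM; rewrite (lt_le_trans zM)// -normrN ler_norm.
by rewrite addrAC subrK gtrDl ltrN10/= -opprD ltrNr.
Qed.

Let restA t x : 0 <= t <= t0 -> 2 * M < `|x| -> rest t x.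
Proof.
move=> /[dup] tt /andP[tp _] Mx; apply: rest_out => //.
by have /andP[_ y2] := yt tt; exact: le_lt_trans y2 Mx.
Qed.

Let rest_end t : 0 <= t <= t0 -> rest t A /\ rest t (- A).
Proof.
move=> tt; have A0 : 0 < A by rewrite /A addr_gt0// mulr_gt0.
by split; apply: restA => //; rewrite ?normrN gtr0_norm// /A ltrDl.
Qed.

Let AA : - A <= A.
Proof.
have A0 : 0 <= A by rewrite addr_ge0// mulr_ge0// ltW.
by rewrite (le_trans _ A0)// oppr_le0.
Qed.

Let suppI f t : 0 <= t <= t0 -> (forall x, rest t x -> f x = 0) ->
  \int[mu]_(x in `[- A, A]) f x = \int[mu]_(x in `[- y t, y t]) f x.
Proof.
move=> tt Hf; have /andP[tp _] := tt.
rewrite -(@Rintegral_support _ (- A) A); last first.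
  move=> x xA; apply: Hf; apply: restA => //; rewrite ltNge; apply: contra xA => xM.
  by rewrite in_itv/= -ler_norml (le_trans xM)// /A lerDl.
rewrite (@Rintegral_support _ (- y t) (y t))// => x xy.
apply: Hf; apply: rest_out => //; rewrite ltNge; apply: contra xy => xM.
by rewrite in_itv/= -ler_norml.
Qed.

Let N t := \int[mu]_(x in `[- A, A]) (rho t x - 1).
Let E t := \int[mu]_(x in `[- A, A]) energy t x.
Let F t := \int[mu]_(x in `[- A, A]) (x * (rho t x * u t x)).
Let G t x := rho t x * u t x ^+ 2 + (rho t x `^ gamma - 1) - S t x.

Let dN t : 0 <= t <= t0 -> time_der N t 0.
Proof.
move=> /[dup] tt /andP[tp _].
have U s (s0 : 0 <= s) := CUD_D (CUD_rho cs (- A) A s0) (CUD_const (- A) A s (@contC R (- 1))).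
have D x := derM (cs_drho cs x tp) (cs_du cs x tp).
have cD : continuous (fun x => derive1 (rho t) x * u t x + rho t x * derive1 (u t) x).
  have h1 := cs_rho_cont cs tp; have h2 := cs_u_cont cs tp.
  by have h3 := cs_crho cs tp; have h4 := cs_cu cs tp; cont.
have [[_ uA _] [_ uB _]] := rest_end tt.
have [Ut _ crt] := U t tp.
apply: (@time_der_eq _ N _ _ (\int[mu]_(x in `[- A, A]) (rhot t x + 0))) => //.
  apply: (@UD_integral _ (- A) A t (fun s x => rho s x + - 1) (fun s x => rhot s x + 0)) => //.
  by move=> s s0; have [] := U s s0.
have -> : \int[mu]_(x in `[- A, A]) (rhot t x + 0) =
    \int[mu]_(x in `[- A, A]) (- 1 * (derive1 (rho t) x * u t x + rho t x * derive1 (u t) x)).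
  apply: eq_Rintegral => x _; have := cs_mass cs x tp => /eqP.
  by rewrite addr_eq0 addr0 mulN1r => /eqP.
rewrite RintegralZl//; last exact: cont_integrable.
by rewrite (Rintegral_FTC2 AA D cD) uA uB !mulr0 subrr mulr0.
Qed.

Let dE t : 0 <= t <= t0 -> time_der E t (- \int[mu]_(x in `[- A, A]) (S t x ^+ 2)).
Proof.
move=> /[dup] tt /andP[tp _].
have [Ut _ cet] := CUD_energy cs gamma1 AA tp.
have cq := flux_x_cont cs gamma1 tp; have cS := cs_S_cont cs tp.
have cS2 : continuous (fun x => S t x ^+ 2) by cont.
have [[_ uA _] [_ uB _]] := rest_end tt.
apply: (@time_der_eq _ E _ _ (\int[mu]_(x in `[- A, A]) energy_t t x)) => //.
  apply: (@UD_integral _ (- A) A t energy energy_t) => //.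
  by move=> s s0; have := energy_cont cs gamma1 s0.
have Z : \int[mu]_(x in `[- A, A]) flux_x tau gamma rho u S t x = 0.
  rewrite (Rintegral_FTC2 AA (fun x => is_derive_flux cs gamma1 x tp) cq).
  by rewrite /flux uA uB !mul0r subrr.
rewrite -[LHS]addr0 -[X in _ + X = _]Z -RintegralD//; try exact: cont_integrable.
rewrite -[RHS]mulN1r -RintegralZl//; last exact: cont_integrable.
by apply: eq_Rintegral => x _; rewrite mulN1r energy_identity.
Qed.

Let G_cont t : 0 <= t -> continuous (G t).
Proof.
move=> tp; have h1 := cs_rho_cont cs tp; have h2 := cs_u_cont cs tp.
have h3 := cs_S_cont cs tp; have h4 := @cs_powR_cont _ _ _ _ _ _ _ _ _ cs gamma t tp.
by rewrite /G; cont.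
Qed.

Let dF t : 0 <= t <= t0 -> time_der F t (\int[mu]_(x in `[- A, A]) G t x).
Proof.
move=> /[dup] tt /andP[tp _].
have U s (s0 : 0 <= s) := CUD_M (CUD_const (- A) A s (@contid R))
  (CUD_M (CUD_rho cs (- A) A s0) (CUD_u cs (- A) A s0)).
have [Ut _ cFt] := U t tp.
apply: (@time_der_eq _ F _ _ (\int[mu]_(x in `[- A, A])
  (0 * (rho t x * u t x) + x * (rhot t x * u t x + rho t x * ut t x)))) => //.
  apply: (@UD_integral _ (- A) A t (fun s x => x * (rho s x * u s x))
    (fun s x => 0 * (rho s x * u s x) + x * (rhot s x * u s x + rho s x * ut s x))) => //.
  by move=> s s0; have [] := U s s0.
pose Gx x := derive1 (rho t) x * (u t x * u t x) + rho t x * (derive1 (u t) x * u t x + u t x * derive1 (u t) x)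
  + gamma * rho t x `^ (gamma - 1) * derive1 (rho t) x - derive1 (S t) x.
have DG x : is_derive x 1 (G t) (Gx x).
  have Dr := cs_drho cs x tp; have Du := cs_du cs x tp; have DS := cs_dS cs x tp.
  have Dp := dercomp Dr (is_derive1_powR gamma (cs_pos cs x tp)).
  have H := derB (derD (derM Dr (derM Du Du)) (derB Dp (der_cst 1 x))) DS.
  have H' := der_eq H (_ : _ = Gx x).
  apply: der_ext (H' _) _ => [|z]; first by rewrite /Gx subr0.
  by rewrite /G expr2.
have DxG x := derM (der_id x) (DG x).
have h1 := cs_rho_cont cs tp; have h2 := cs_u_cont cs tp.
have h3 := cs_S_cont cs tp; have h4 := @cs_powR_cont _ _ _ _ _ _ _ _ _ cs (gamma - 1) t tp.
have h5 := cs_crho cs tp; have h6 := cs_cu cs tp; have h7 := cs_cS cs tp.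
have cGx : continuous Gx by rewrite /Gx; cont.
have cG := G_cont tp.
have cxG : continuous (fun x => 1 * G t x + x * Gx x) by cont.
have [[rA uA sA] [rB uB sB]] := rest_end tt.
have Z : \int[mu]_(x in `[- A, A]) (1 * G t x + x * Gx x) = 0.
  rewrite (Rintegral_FTC2 AA DxG cxG) /G rA uA sA rB uB sB powR1 expr0n/=.
  by rewrite !(mulr0, subrr, subr0, addr0).
rewrite -[LHS]addr0 -[X in _ + X = _]Z -RintegralD//; try exact: cont_integrable.
apply: eq_Rintegral => x _; rewrite mul0r add0r mul1r.
have E1 := cs_mass cs x tp; have E2 := cs_momentum cs x tp.
have e1 : x * (u t x * (rhot t x + (derive1 (rho t) x * u t x + rho t x * derive1 (u t) x))) = 0.
  by rewrite E1 !mulr0.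
have e2 : x * (rho t x * ut t x + rho t x * u t x * derive1 (u t) x
    + gamma * rho t x `^ (gamma - 1) * derive1 (rho t) x - derive1 (S t) x) = 0.
  by rewrite E2 subrr mulr0.
by rewrite -[RHS]addr0 -[RHS]addr0 -{1}e1 -e2 /Gx; ring.
Qed.

Let N_const t : 0 <= t <= t0 -> N t = N 0.
Proof.
move=> /andP[tp tt0]; apply/eqP; rewrite eq_le; apply/andP; split.
  apply: (@time_der_nonincr _ N (fun=> 0)) => // s /andP[s0 st1].
  by apply: dN; rewrite s0 (le_trans st1).
rewrite -lerN2 -[leRHS]mulN1r -[leLHS]mulN1r.
apply: (@time_der_nonincr _ (fun t => - 1 * N t) (fun=> - 1 * 0)) => // s /andP[s0 st1].
  by apply: time_der_Z; apply: dN; rewrite s0 (le_trans st1).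
Qed.

Let tt0 : 0 <= (0 : R) <= t0. Proof. by rewrite lexx ltW. Qed.

Let m0 : 0 < m. Proof. exact: lt_le_trans ltr01 m1. Qed.

Hypothesis mass0 : 0 <= \int[mu]_(x in `[- M, M]) (rho 0 x - 1).

Let N0 : 0 <= N 0 <= 2 * M * (m - 1).
Proof.
have -> : N 0 = \int[mu]_(x in `[- M, M]) (rho 0 x - 1).
  rewrite /N (suppI tt0); first by rewrite /y mulr0 addr0.
  by move=> x [-> _ _]; rewrite subrr.
rewrite mass0/=; have MM : - M <= M by rewrite (@le_trans _ _ 0)// ?oppr_le0 ltW.
apply: (@le_trans _ _ (\int[mu]_(x in `[- M, M]) (m - 1))).
  apply: le_Rintegral; [by []| |by apply: cont_integrable; exact: contC|].
    by apply: cont_integrable; have h := cs_rho_cont cs (lexx 0); cont.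
  by move=> x _; rewrite lerD2r.
rewrite (Rintegral_itv_cst _ MM) opprK mulrC le_eqVlt; apply/orP; left; apply/eqP; ring.
Qed.

Let y_gt0 t : 0 <= t -> 0 < y t.
Proof. by move=> tp; rewrite /y ltr_wpDr// mulr_ge0// ltW. Qed.

Let Kd_ge t lam : 0 <= t <= t0 -> 0 < lam ->
  F t ^+ 2 / (2 * m * y t ^+ 3) <=
  \int[mu]_(x in `[- A, A]) G t x + lam / 2 * \int[mu]_(x in `[- A, A]) (S t x ^+ 2) + y t / lam.
Proof.
move=> /[dup] tt /andP[tp _] l0.
have yp := y_gt0 tp; have yy : - y t <= y t by rewrite (@le_trans _ _ 0)// ?oppr_le0 ltW.
have h1 := cs_rho_cont cs tp; have h2 := cs_u_cont cs tp; have h3 := cs_S_cont cs tp.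
have hG := G_cont tp.
have cS2 : continuous (fun x => S t x ^+ 2) by cont.
have GI : \int[mu]_(x in `[- A, A]) G t x = \int[mu]_(x in `[- y t, y t]) G t x.
  apply: suppI => // x [r1 u1 s1]; rewrite /G r1 u1 s1 powR1 expr0n/=.
  by rewrite mulr0 subrr subr0 addr0.
have SI : \int[mu]_(x in `[- A, A]) (S t x ^+ 2) = \int[mu]_(x in `[- y t, y t]) (S t x ^+ 2).
  by apply: suppI => // x [_ _ ->]; rewrite expr0n.
have FI : F t = \int[mu]_(x in `[- y t, y t]) (x * (rho t x * u t x)).
  by apply: suppI => // x [_ -> _]; rewrite !mulr0.
have NI : N t = \int[mu]_(x in `[- y t, y t]) (rho t x - 1).
  by apply: suppI => // x [-> _ _]; rewrite subrr.
set k := F t / (2 * m * y t ^+ 3).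
have Nt := N_const tt; have := N0; rewrite -Nt => /andP[N1 N2].
have lhs : \int[mu]_(x in `[- y t, y t]) (2 * k * (x * (rho t x * u t x)) +
    ((gamma - k ^+ 2 * y t ^+ 2) * (rho t x - 1) + - (k ^+ 2 * y t ^+ 2))) =
   2 * k * F t + ((gamma - k ^+ 2 * y t ^+ 2) * N t - k ^+ 2 * y t ^+ 2 * (2 * y t)).
  rewrite !RintegralD//; try (by apply: cont_integrable; cont).
  rewrite !RintegralZl//; try (by apply: cont_integrable; cont).
  rewrite (Rintegral_itv_cst _ yy) -FI -NI opprK; congr (_ + (_ + _)); ring.
have rhs : \int[mu]_(x in `[- y t, y t]) (G t x + (lam / 2 * S t x ^+ 2 + (2 * lam)^-1)) =
  \int[mu]_(x in `[- A, A]) G t x + lam / 2 * \int[mu]_(x in `[- A, A]) (S t x ^+ 2) + y t / lam.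
  have IG : mu.-integrable `[- y t, y t] (EFin \o G t) by apply: cont_integrable.
  rewrite (RintegralD _ IG)//; last by apply: cont_integrable; cont.
  rewrite -GI -addrA; congr (_ + _).
  rewrite RintegralD//; [|by apply: cont_integrable; cont|by apply: cont_integrable; cont].
  rewrite RintegralZl//; last by apply: cont_integrable; cont.
  rewrite (Rintegral_itv_cst _ yy) -SI opprK; congr (_ + _).
  by field; rewrite gt_eqF.
rewrite -rhs; apply: (@le_trans _ _ (2 * k * F t +
   ((gamma - k ^+ 2 * y t ^+ 2) * N t - k ^+ 2 * y t ^+ 2 * (2 * y t)))); last first.
  rewrite -lhs; apply: le_Rintegral; [by []|by apply: cont_integrable; cont|by apply: cont_integrable; cont|].
  move=> x /=; rewrite in_itv/= => xy; apply: quad_lower => //.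
    exact: (cs_pos cs x tp).
  have := entropy_ge0 gamma1 (cs_pos cs x tp).
  by rewrite /entropy pmulr_lge0 ?invr_gt0 ?subr_gt0// subr_ge0.
have yM : M <= y t by have /andP[] := yt tt.
have g0 : 0 < gamma by rewrite (lt_trans _ gamma1).
have D0 : 0 < 2 * m * y t ^+ 3 by rewrite mulr_gt0 ?exprn_gt0// mulr_gt0.
have -> : F t ^+ 2 / (2 * m * y t ^+ 3) = 2 * k * F t - k ^+ 2 * y t ^+ 2 * (2 * m * y t).
  by rewrite /k; field; rewrite !gt_eqF.
rewrite lerD2l mulrBl -addrA -opprD -mulrDr.
apply: (@le_trans _ _ (0 - k ^+ 2 * y t ^+ 2 * (N t + 2 * y t))).
  rewrite sub0r lerN2; apply: ler_wpM2l; first by apply: mulr_ge0; exact: sqr_ge0.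
  have hm : 0 <= (y t - M) * (m - 1) by rewrite mulr_ge0// subr_ge0.
  have : N t + 2 * y t <= 2 * M * (m - 1) + 2 * y t by rewrite lerD2r.
  move/le_trans; apply; rewrite -subr_ge0.
  have -> : 2 * m * y t - (2 * M * (m - 1) + 2 * y t) = 2 * ((y t - M) * (m - 1)) by ring.
  by rewrite mulr_ge0.
by rewrite lerD2r mulr_ge0// ltW.
Qed.

Hypothesis energy0 : \int[mu]_(x in `[- M, M]) energy 0 x <= 2 * st * M ^+ 2 * m.
Hypothesis moment0 : 16 * st * M ^+ 2 * m < \int[mu]_(x in `[- M, M]) (x * (rho 0 x * u 0 x)).

(* [K] is the moment [F] corrected so that the stress integral, absorbed by the
   dissipation, disappears from its time derivative; it satisfies the Riccati
   inequality [K' >= K^2 / (2 m y^3)]. *)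
Lemma no_global_solution : False.
Proof.
pose q := Num.sqrt (8 * m).
have m80 : 0 < 8 * m by rewrite mulr_gt0.
have q0 : 0 < q by rewrite sqrtr_gt0.
have q2 : q ^+ 2 = 8 * m by rewrite sqr_sqrtr// ltW.
have stq : 1 <= st * q.
  rewrite -(@ler_pXn2r _ 2)// ?nnegrE//; last by rewrite mulr_ge0// ltW.
  by rewrite expr1n exprMn q2 mulrC.
pose lam := 3 / (q * st).
have l0 : 0 < lam by rewrite divr_gt0// mulr_gt0.
pose K t := F t + (- (lam / 2) * E t + ((2 * c * lam)^-1 * (y t * y t) + - (2 * M ^+ 2 / (c * lam)))).
pose Kd t := \int[mu]_(x in `[- A, A]) G t x + lam / 2 * \int[mu]_(x in `[- A, A]) (S t x ^+ 2) + y t / lam.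
have dK t : 0 <= t <= t0 -> time_der K t (Kd t).
  move=> tt; have dy : time_der y t c by exact: time_der_affine.
  have := time_der_D (dF tt) (time_der_D (time_der_Z (- (lam / 2)) (dE tt))
   (time_der_D (time_der_Z (2 * c * lam)^-1 (time_der_M dy dy)) (time_der_cst t _))).
  move=> H; apply: time_der_eq (H (- (2 * M ^+ 2 / (c * lam)))) _ _ => //.
  by rewrite /Kd addr0 mulrNN -addrA; congr (_ + (_ + _)); field; rewrite !gt_eqF.
have E0 t : 0 <= t -> 0 <= E t.
  by move=> tp; apply: Rintegral_ge0 => x _; exact: (energy_ge0 cs gamma1 tau0 x tp).
have FK t : 0 <= t <= t0 -> K t <= F t.
  move=> /[dup] tt /andP[tp _]; rewrite /K gerDl.
  have /andP[_ y2] := yt tt; have yp := y_gt0 tp.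
  have h1 : 0 <= lam / 2 * E t by rewrite mulr_ge0 ?E0// divr_ge0// ltW.
  have h2 : (2 * c * lam)^-1 * (y t * y t) <= (2 * c * lam)^-1 * (2 * M * (2 * M)).
    have cl0 : 0 < 2 * c * lam by apply: mulr_gt0 => //; apply: mulr_gt0.
    apply: ler_wpM2l; first by rewrite invr_ge0 ltW.
    by apply: ler_pM => //; exact: ltW.
  rewrite mulNr addrC subr_le0; apply: le_trans h1; rewrite subr_le0.
  apply: le_trans h2 _; rewrite le_eqVlt; apply/orP; left; apply/eqP.
  by field; rewrite !gt_eqF.
have E0I : E 0 = \int[mu]_(x in `[- M, M]) energy 0 x.
  rewrite /E (suppI tt0); first by rewrite /y mulr0 addr0.
  by move=> x Hx; apply/(energy_eq0 cs gamma1 tau0).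
have F0I : F 0 = \int[mu]_(x in `[- M, M]) (x * (rho 0 x * u 0 x)).
  rewrite /F (suppI tt0); first by rewrite /y mulr0 addr0.
  by move=> x [_ -> _]; rewrite !mulr0.
have mq : m = q ^+ 2 / 8 by rewrite q2; field.
have M20 : 0 < M ^+ 2 by rewrite exprn_gt0.
have K0 : 8 * m * st * M ^+ 2 < K 0.
  have hE : E 0 <= 2 * st * M ^+ 2 * m by rewrite E0I.
  have hF : 16 * st * M ^+ 2 * m < F 0 by rewrite F0I.
  have hE' : lam / 2 * E 0 <= 3 / 8 * (q * M ^+ 2).
    apply: (@le_trans _ _ (lam / 2 * (2 * st * M ^+ 2 * m))).
      by rewrite ler_wpM2l// divr_ge0// ltW.
    by rewrite le_eqVlt; apply/orP; left; apply/eqP; rewrite /lam mq; field; rewrite !gt_eqF.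
  have hc : (2 * c * lam)^-1 * (y 0 * y 0) - 2 * M ^+ 2 / (c * lam) = - (1 / 3 * (q * M ^+ 2)).
    by rewrite /lam /y /c mulr0 addr0; field; rewrite !gt_eqF.
  have hq : q * M ^+ 2 <= q ^+ 2 * st * M ^+ 2.
    rewrite ler_wpM2r ?(ltW M20)// expr2 -mulrA ler_peMr ?(ltW q0)//.
    by rewrite mulrC.
  rewrite /K hc mulNr.
  have e1 : 16 * st * M ^+ 2 * m = 2 * (q ^+ 2 * st * M ^+ 2) by rewrite mq; field.
  have e2 : 8 * m * st * M ^+ 2 = q ^+ 2 * st * M ^+ 2 by rewrite mq; field.
  rewrite e1 in hF; rewrite e2.
  move: hF hE' hq; set X := q ^+ 2 * st * M ^+ 2; set Y := q * M ^+ 2.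
  have Y0 : 0 < Y by rewrite mulr_gt0.
  move: Y0; move: (F 0) (lam / 2 * E 0) X Y => f e X Y ? ? ? ?.
  lra.
have Kd0 t : 0 <= t <= t0 -> 0 <= Kd t.
  move=> tt; apply: le_trans (Kd_ge tt l0).
  have /andP[tp _] := tt; have yp := y_gt0 tp.
  by rewrite divr_ge0 ?sqr_ge0// !mulr_ge0 ?exprn_ge0 ?(ltW m0) ?(ltW yp).
have K00 : 0 < K 0 by apply: lt_trans K0; rewrite !mulr_gt0.
have Kpos t : 0 <= t <= t0 -> 0 < K t.
  move=> /andP[tp tt1]; apply: (lt_le_trans K00).
  rewrite -lerN2 -[leRHS]mulN1r -[leLHS]mulN1r.
  apply: (@time_der_nonincr _ (fun t => - 1 * K t) (fun t => - 1 * Kd t)) => //.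
    by move=> s /andP[s0 s1]; apply: time_der_Z; apply: dK; rewrite s0 (le_trans s1).
  by move=> s /andP[s0 s1]; rewrite mulN1r oppr_le0; apply: Kd0; rewrite s0 (le_trans s1).
pose k4 := - (4 * m * c)^-1.
pose Phi t := K t `^ (-1) + k4 * y t `^ (- 2).
pose Phid t := -1 * K t `^ (- 1 - 1) * Kd t + k4 * (- 2 * y t `^ (- 2 - 1) * c).
have Phi_dec : Phi t0 <= Phi 0.
  apply: (@time_der_nonincr _ Phi Phid) => //; first exact: ltW.
    move=> t tt; have /andP[tp _] := tt.
    have dy : time_der y t c by exact: time_der_affine.
    exact: (time_der_D (time_der_powR (- 1) (dK t tt) (Kpos t tt))
      (time_der_Z k4 (time_der_powR (- 2) dy (y_gt0 tp)))).
  move=> t tt; have /andP[tp _] := tt; have yp := y_gt0 tp.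
  have Kp := Kpos t tt.
  rewrite /Phid; have -> : - 1 - 1 = - 2%:R :> R by ring.
  have -> : - 2 - 1 = - 3%:R :> R by ring.
  rewrite !powRN_nat ?(ltW Kp) ?(ltW yp)//.
  have h1 := Kd_ge tt l0.
  have h2 : K t ^+ 2 / (2 * m * y t ^+ 3) <= Kd t.
    apply: le_trans h1; rewrite ler_wpM2r ?invr_ge0 ?mulr_ge0 ?exprn_ge0 ?(ltW m0) ?(ltW yp)//.
    by rewrite ler_sqr ?nnegrE ?(ltW Kp)// ?(le_trans (ltW Kp))// FK.
  have h3 : (2 * m * y t ^+ 3)^-1 <= (K t ^+ 2)^-1 * Kd t.
    by rewrite [leRHS]mulrC ler_pdivlMr ?exprn_gt0// mulrC.
  have -> : -1 / K t ^+ 2 * Kd t + k4 * (-2 / y t ^+ 3 * c) =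
    (2 * m * y t ^+ 3)^-1 - (K t ^+ 2)^-1 * Kd t.
    by rewrite /k4; field; rewrite !gt_eqF.
  by rewrite subr_le0.
have y00 : y 0 = M by rewrite /y mulr0 addr0.
have y0t : y t0 = 2 * M by rewrite /y /t0; field; rewrite gt_eqF.
have t0t : 0 <= t0 <= t0 by rewrite lexx ltW.
have Kt := Kpos t0 t0t.
move: Phi_dec; rewrite /Phi -[-1]/(- 1%:R) !powRN_nat ?(ltW Kt) ?(ltW K00) ?y00 ?y0t ?mulr_ge0 ?(ltW M0)//.
rewrite !expr1 -lerBlDr => h.
have h' : 3 / (16 * m * c * M ^+ 2) < (K 0)^-1.
  apply: lt_le_trans h; rewrite -subr_gt0.
  have -> : (K t0)^-1 + k4 / (2 * M) ^+ 2 - k4 / M ^+ 2 - 3 / (16 * m * c * M ^+ 2) = (K t0)^-1.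
    by rewrite /k4; field; rewrite !gt_eqF.
  by rewrite invr_gt0.
have h2 : (K 0)^-1 < (8 * m * st * M ^+ 2)^-1.
  by rewrite ltf_pV2 ?posrE// !mulr_gt0.
have := lt_trans h' h2; rewrite /c.
have -> : 3 / (16 * m * (3 / 2 * st) * M ^+ 2) = (8 * m * st * M ^+ 2)^-1.
  by field; rewrite !gt_eqF.
by rewrite ltxx.
Qed.

End BlowUp.

(** * The initial data *)

Section InitialVelocity.
Variables (R : realType) (L M : R).
Implicit Types x : R.
Local Notation v := (u_LM L M).

Lemma u_LM_out x : 4 <= M -> M < `|x| -> v x = 0.
Proof.
move=> M4; rewrite /u_LM lter_normr => /orP[Mx|Mx]; last by rewrite ifT// ltW// ltrNr.
by do 6 (rewrite ifF; last by apply/negbTE; rewrite -ltNge; lra).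
Qed.

Lemma u_LM_norm x : 0 < L -> `|v x| <= L.
Proof.
move=> L0; have h (b : R) : -1 <= cos b <= 1 by rewrite cos_geN1 cos_le1.
rewrite ler_norml /u_LM; repeat case: ifP => _;
  try (match goal with |- context [cos ?b] => move: (cos b) (h b) => w /andP[w1 w2] end);
  apply/andP; split; nra.
Qed.

Lemma mul_u_LM_ge0 x : 0 < L -> 4 <= M -> 0 <= x * v x.
Proof.
move=> L0 M4; rewrite /u_LM.
case: (lerP x (- M)) => x1; first by rewrite mulr0.
case: (lerP x (- M + 1)) => x2.
  apply: mulr_le0; first lra.
  by move: (cos_le1 (pi * (x + M))); move: (cos _) => w ?; nra.
case: (lerP x (-1)) => x3; first by apply: mulr_le0; lra.
case: (lerP x 1) => x4.
  have -> : pi / 2 * (x - 1) = pi / 2 * x - pi / 2 by ring.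
  rewrite cosBpihalf; have pi0 := pi_gt0 R; case: (lerP 0 x) => x5.
    by rewrite !mulr_ge0 ?(ltW L0)//; apply: sin_ge0_pi; apply/andP; split; nra.
  rewrite -mulrNN -mulrN -sinN !mulr_ge0 ?(ltW L0)//; first lra.
  by apply: sin_ge0_pi; apply/andP; split; nra.
case: (lerP x (M - 1)) => x5; first by rewrite mulr_ge0//; lra.
case: (lerP x M) => x6; last by rewrite mulr0.
apply: mulr_ge0; first lra.
by move: (cos_geN1 (pi * (x - M + 1))); move: (cos _) => w ?; nra.
Qed.

Lemma u_LM_right x : 4 <= M -> 1 <= x <= M - 1 -> v x = L.
Proof.
move=> M4 /andP[x1 x2]; rewrite /u_LM.
do 3 (rewrite ifF; last by apply/negbTE; rewrite -ltNge; lra).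
case: lerP => x3; last by rewrite x2.
have -> : x = 1 by apply/eqP; rewrite eq_le x1 x3.
by rewrite subrr mulr0 cos0 mulr1.
Qed.

Lemma u_LM_left x : 4 <= M -> - (M - 1) <= x <= - 1 -> v x = - L.
Proof.
move=> M4 /andP[x1 x2]; rewrite /u_LM.
rewrite ifF; last by apply/negbTE; rewrite -ltNge; lra.
case: lerP => x3; last by rewrite x2.
have -> : x = - M + 1 by apply/eqP; rewrite eq_le x3/=; lra.
have -> : pi * (- M + 1 + M) = pi by ring.
by rewrite cospi; field.
Qed.

End InitialVelocity.

Section InitialMoment.
Variables (R : realType) (L M a : R) (rho0 : R -> R).
Hypotheses (L0 : 0 < L) (M4 : 4 <= M) (a0 : 0 <= a) (rho_a : forall x, a <= rho0 x).
Hypotheses (crho : continuous rho0) (cv : continuous (u_LM L M)).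
Local Notation mu := (leb R).
Local Notation v := (u_LM L M).

Let f x := x * (rho0 x * v x).

Let cf : continuous f. Proof. by rewrite /f; cont. Qed.

Let f_ge0 x : 0 <= f x.
Proof.
rewrite /f mulrCA mulr_ge0 ?mul_u_LM_ge0//; exact: le_trans a0 (rho_a x).
Qed.

Let int_ge (b c k : R) : b <= c -> (forall x, b <= x <= c -> 2 * (x * k) <= f x) ->
  k * (c ^+ 2 - b ^+ 2) <= \int[mu]_(x in `[b, c]) f x.
Proof.
move=> bc H; have dF (x : R) : is_derive x 1 (fun z : R => k * (z * z)) (2 * (x * k)).
  by apply: der_eq (derZ k (derM (der_id x) (der_id x))) _; ring.
have cg : continuous (fun x : R => 2 * (x * k)) by cont.
rewrite mulrBr !expr2 -(Rintegral_FTC2 bc dF cg).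
apply: le_Rintegral; [by []|exact: cont_integrable|exact: cont_integrable|].
by move=> x /=; rewrite in_itv/=; exact: H.
Qed.

Lemma initial_moment :
  L * a * M ^+ 2 / 2 <= \int[mu]_(x in `[- M, M]) (x * (rho0 x * u_LM L M x)).
Proof.
move: (L0) (M4) (a0) => L0' M4' a0'.
have I b c : mu.-integrable `[b, c] (EFin \o f) by exact: cont_integrable.
have P b c : 0 <= \int[mu]_(x in `[b, c]) f x by apply: Rintegral_ge0 => x _; exact: f_ge0.
rewrite (@Rintegral_chasles R (- M) (- (M - 1)) M f)//; [|lra|lra].
rewrite (@Rintegral_chasles R (- (M - 1)) (- 1) M f)//; [|lra|lra].
rewrite (@Rintegral_chasles R (- 1) 1 M f)//; last lra.
rewrite (@Rintegral_chasles R 1 (M - 1) M f)//; [|lra|lra].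
have h1 : - (a * L / 2) * ((- 1) ^+ 2 - (- (M - 1)) ^+ 2) <=
    \int[mu]_(x in `[- (M - 1), - 1]) f x.
  apply: int_ge => [|x xI]; first lra.
  have /andP[_ x1] := xI; rewrite /f (u_LM_left _ M4 xI) -subr_ge0.
  have -> : x * (rho0 x * - L) - 2 * (x * - (a * L / 2)) = - x * L * (rho0 x - a) by field.
  by rewrite !mulr_ge0 ?subr_ge0 ?(ltW L0)//; lra.
have h2 : (a * L / 2) * ((M - 1) ^+ 2 - 1 ^+ 2) <= \int[mu]_(x in `[1, M - 1]) f x.
  apply: int_ge => [|x xI]; first lra.
  have /andP[x1 _] := xI; rewrite /f (u_LM_right _ M4 xI) -subr_ge0.
  have -> : x * (rho0 x * L) - 2 * (x * (a * L / 2)) = x * L * (rho0 x - a) by field.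
  by rewrite !mulr_ge0 ?subr_ge0 ?(ltW L0)//; lra.
have := P (- M) (- (M - 1)); have := P (- 1) 1; have := P (M - 1) M.
move: h1 h2; move: (Rintegral _ _ _) (Rintegral _ _ _) (Rintegral _ _ _)
  (Rintegral _ _ _) (Rintegral _ _ _) => i1 i2 i3 i4 i5 h1 h2 p1 p2 p3.
have aL : 0 <= a * L by rewrite mulr_ge0// ltW.
have h3 : 0 <= a * L * (M * (M - 4)) by rewrite !mulr_ge0//; lra.
rewrite -subr_ge0; nra.
Qed.

End InitialMoment.
Lemma supp_eq0 (R : realType) (V : zmodType) (f : R -> V) (r x : R) :
  supp f `<=` `](- r), r[ -> r <= `|x| -> f x = 0.
Proof.
move=> H rx; apply/eqP; apply: contraTT isT => fx.
have : supp f x by apply: subset_closure; exact: fx.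
by move=> /H /=; rewrite in_itv/= -ltr_norml ltNge rx.
Qed.

Lemma energy_density_le (R : realType) (gamma tau r u S L m : R) : 0 < r -> r <= m -> `|u| <= L ->
  (r `^ gamma - 1 - gamma * (r - 1)) / (gamma - 1) + r * u ^+ 2 / 2 + tau * r * S ^+ 2 / 2 <=
  ((r `^ gamma - 1 - gamma * (r - 1)) / (gamma - 1) + tau * r * S ^+ 2 / 2) + m * L ^+ 2 / 2.
Proof.
move=> r0 rm uL; rewrite addrAC lerD2l.
have L0 : 0 <= L by apply: le_trans uL.
have : u ^+ 2 <= L ^+ 2 by rewrite -real_normK ?num_real// ler_sqr ?nnegrE.
move=> uL2; rewrite ler_pM2r ?invr_gt0//; apply: ler_pM => //; [exact: ltW|exact: sqr_ge0].
Qed.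

Unset Implicit Arguments.
Set Strict Implicit.

Theorem theorem2p4 (R : realType) (tau gamma r : R) (rho0 S0 : R -> R)
    (rmax rmin sigma sigmat L M : R) (T : \bar R) (rho u S : R -> R -> R)
    (p := fun y : R => y `^ gamma) (H0 := H_zero p gamma tau rho0 S0) :
  0 < tau -> 1 < gamma -> 0 < r ->
  C1 rho0 -> C1 S0 ->
  in_H 2 (fun x => rho0 x - 1) -> in_H 2 S0 ->
  (forall x, 0 < rho0 x) ->
  supp (fun x => (rho0 x - 1, S0 x)) `<=` `](- r), r[ ->
  0 <= \int[leb R]_x (rho0 x - 1) ->
  is_max (range rho0) rmax -> is_min (range rho0) rmin ->
  sigma = Num.sqrt (gamma + tau^-1) ->
  0 < sigmat -> 0 < L ->
  sigmat ^+ 2 = Num.max (sigma ^+ 2) (8 * rmax)^-1 ->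
  Num.max (Num.sqrt (8 * rmax)) (16 * sigmat * rmax) < L / 2 * rmin ->
  Num.max 4 r <= M ->
  H0 + rmax * L ^+ 2 * M <= 2 * sigmat * M ^+ 2 * rmax ->
  is_maximal_time p tau 1 rho0 (u_LM L M) S0 T ->
  is_solution p tau 1 rho0 (u_LM L M) S0 T rho u S ->
  (T < +oo)%E /\
  Num.max (16 * sigmat * M ^+ 2 * rmax) (M ^+ 2 * Num.sqrt (8 * rmax))
    < \int[leb R]_x (x * rho0 x * u_LM L M x).
Proof.
move=> tau0 gamma1 r0 [drho _] [dS _] _ _ rho_gt0 hsupp mass [[xmax _ rhomax] ub] [[xmin _ rhomin] lb].
move=> sigmaE st0 L0 st2 hL; rewrite ge_max => /andP[M4 rM] hM [T0 _ _] sol.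
have M0 : 0 < M by apply: lt_le_trans M4.
have rho_le x : rho0 x <= rmax by apply: ub; exists x.
have rho_ge x : rmin <= rho0 x by apply: lb; exists x.
have rmin0 : 0 < rmin by rewrite -rhomin.
have rest x : r <= `|x| -> rho0 x = 1 /\ S0 x = 0.
  by move=> /(supp_eq0 hsupp) [/eqP]; rewrite subr_eq0 => /eqP.
have m1 : 1 <= rmax by have [<- _] := rest r (ler_norm r); exact: rho_le.
have m0 : 0 < rmax by apply: lt_le_trans m1.
have [_ ct [rhoE uE SE] _ _] := sol.
have [_ cu _] := ct 0 (conj (lexx 0) T0).
have cv : continuous (u_LM L M) by rewrite -(funext uE).
have crho : continuous rho0.
  by move=> x; apply: differentiable_continuous; apply/derivable1_diffP; exact: drho.
have cS : continuous S0.
  by move=> x; apply: differentiable_continuous; apply/derivable1_diffP; exact: dS.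
have cp := cont_powR (gamma := gamma) crho rho_gt0.
have out x : x \notin `[- M, M] -> M < `|x|.
  by rewrite in_itv/= -ler_norml -ltNge.
have vout x : x \notin `[- M, M] -> u_LM L M x = 0.
  by move=> /out; exact: u_LM_out.
have MM : - M <= M by rewrite (@le_trans _ _ 0)// ?oppr_le0 ltW.
set I := \int[leb R]_(x in `[- M, M]) (x * (rho0 x * u_LM L M x)).
have IE : \int[leb R]_x (x * rho0 x * u_LM L M x) = I.
  rewrite (@Rintegral_support R (- M) M)//; last by move=> x /vout ->; rewrite mulr0.
  by apply: eq_Rintegral => x _; rewrite mulrA.
have hI := initial_moment L0 M4 (ltW rmin0) rho_ge crho cv.
have moment : Num.max (16 * sigmat * M ^+ 2 * rmax) (M ^+ 2 * Num.sqrt (8 * rmax)) < I.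
  have M2 : 0 < M ^+ 2 by rewrite exprn_gt0.
  apply: lt_le_trans hI.
  have -> : L * rmin * M ^+ 2 / 2 = M ^+ 2 * (L / 2 * rmin) by field.
  have -> : 16 * sigmat * M ^+ 2 * rmax = M ^+ 2 * (16 * sigmat * rmax) by ring.
  by move: hL; rewrite !gt_max !ltr_pM2l// andbC.
split; last by rewrite IE.
rewrite ltNge; apply/negP; rewrite leye_eq => /eqP Too.
have := sol; rewrite Too => /solution_classical[rhot [ut [St cs]]].
have s0 : 0 < gamma + tau^-1 by rewrite addr_gt0 ?invr_gt0// (lt_trans ltr01).
have s2 : sigma ^+ 2 = gamma + tau^-1 by rewrite sigmaE sqr_sqrtr// ltW.
have sigma0 : 0 < sigma by rewrite sigmaE sqrtr_gt0.
apply: (no_global_solution cs gamma1 tau0 sigma0 s2 (st := sigmat) (m := rmax) _ M0 m1).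
- by rewrite -ler_sqr ?nnegrE ?(ltW sigma0) ?(ltW st0)// st2 le_max lexx.
- by rewrite -ler_pdivrMl ?mulr_gt0// mulr1 st2 le_max lexx orbT.
- move=> x Mx; have [e1 e2] := rest x (le_trans rM (ltW Mx)).
  by split; rewrite ?rhoE ?uE ?SE// u_LM_out.
- by move=> x; rewrite rhoE.
- move: mass; rewrite (@Rintegral_support R (- M) M)//; last first.
    by move=> x /out Mx; have [-> _] := rest x (le_trans rM (ltW Mx)); rewrite subrr.
  by rewrite (funext rhoE).
- apply: le_trans hM; rewrite /H0 /H_zero (@Rintegral_support R (- M) M); last first.
    move=> x /out Mx; have [-> ->] := rest x (le_trans rM (ltW Mx)).
    by rewrite /p powR1 !subrr mulr0 subr0 mul0r expr0n/= mulr0 mul0r addr0.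
  have -> : rmax * L ^+ 2 * M = \int[leb R]_(x in `[- M, M]) (rmax * L ^+ 2 / 2).
    by rewrite (Rintegral_itv_cst _ MM); field.
  rewrite -RintegralD//; [|by apply: cont_integrable; rewrite /p; cont|
    by apply: cont_integrable; exact: contC].
  apply: le_Rintegral; [by []| | |].
  + by apply: cont_integrable; rewrite /energy /entropy (funext rhoE) (funext uE) (funext SE); cont.
  + by apply: cont_integrable; rewrite /p; cont.
  move=> x _; rewrite /energy /entropy rhoE uE SE.
  exact: energy_density_le (rho_gt0 x) (rho_le x) (u_LM_norm M x L0).
- rewrite (funext rhoE) (funext uE).
  by move: moment; rewrite gt_max => /andP[].
Qed.
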